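(* Let $w\in C^1(\Omega;\mathbb{C})\cap C(\overline{\Omega};\mathbb{C})$ and put $f=\partial_{\overline z}w$ in $\Omega$. Then for $z\in\Omega$ $$ \begin{aligned} w(z)={}&\frac{\alpha}{2\pi i}\int_{\Gamma_1\cup\Gamma_2}\mathrm{Re}\,w(\tau)\,H_1(z^\alpha,\tau^\alpha)\frac{d\tau}{\tau}+\frac{\alpha}{\pi i}\int_{[\varpi,\omega]\cup[r,1]}\mathrm{Re}\,w(\tau)\,H_2(z^\alpha,\tau^\alpha)\tau^{\alpha-1}\,d\tau\\ &+\frac{\alpha}{\pi}\int_{\Gamma_1}\frac{\mathrm{Im}\,w(\tau)}{\tau}\,d\tau-\frac{\alpha}{\pi}\iint_{\Omega}\Big[\tau^{\alpha-1}H_2(z^\alpha,\tau^\alpha)f(\tau)-\overline{\tau^{\alpha-1}}\,H_2(z^\alpha,\overline{\tau^\alpha})\,\overline{f(\tau)}\Big]\,d\tau_1\,d\tau_2, \end{aligned} $$ where $\tau=\tau_1+i\tau_2$ with $\tau_1,\tau_2\in\mathbb{R}$ in the area integral.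
   Context: Fix $0<r<1$, $\alpha\ge 1/2$, $\theta=\pi/\alpha$. The sector ring is $\Omega=\{z\in\mathbb{C}: r<|z|<1,\ 0<\arg z<\pi/\alpha\}$, with corner points $r$, $1$, $\varpi=e^{i\theta}$, $\omega=re^{i\theta}$. Its boundary $\partial\Omega=[r,1]\cup\Gamma_1\cup[\varpi,\omega]\cup\Gamma_2$ is oriented counter-clockwise: $[r,1]$ is the segment from $r$ to $1$; $\Gamma_1$ is $\tau\mapsto e^{i\tau}$ with $\tau$ running from $0$ to $\pi/\alpha$; $[\varpi,\omega]$ is the segment from $\varpi$ to $\omega$; $\Gamma_2$ is $\tau\mapsto re^{i\tau}$ with $\tau$ running from $\pi/\alpha$ to $0$. Powers are $z^\beta=|z|^\beta e^{i\beta\arg z}$ with $\arg z\in[0,\pi/\alpha]$ on $\overline\Omega$ ($\arg=0$ on $[r,1]$, $\arg=\pi/\alpha$ on $[\varpi,\omega]$), and $\overline{z^\beta}$ is the complex conjugate of $z^\beta$. $\partial_{\overline z}=\frac12(\partial_x+i\partial_y)$. The kernels are $$H_1(z,\zeta)=\frac{\zeta+z}{\zeta-z}-\frac{\overline{\zeta}+z}{\overline{\zeta}-z}+2\sum_{n=1}^\infty r^{2\alpha n}\left[\frac{\zeta}{r^{2\alpha n}\zeta-z}-\frac{z}{r^{2\alpha n}z-\zeta}-\frac{\overline{\zeta}}{r^{2\alpha n}\overline{\zeta}-z}+\frac{z}{r^{2\alpha n}z-\overline{\zeta}}\right],$$ $$H_2(z,\zeta)=\frac{1}{\zeta-z}-\frac{z}{1-z\zeta}+\sum_{n=1}^\infty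 r^{2\alpha n}\left[\frac{1}{r^{2\alpha n}\zeta-z}-\frac{z}{\zeta(r^{2\alpha n}z-\zeta)}-\frac{1}{\zeta(r^{2\alpha n}-z\zeta)}+\frac{z}{r^{2\alpha n}z\zeta-1}\right].$$
   Formalization: The area integral over Ω need not converge under the stated hypotheses; the formula is proved whenever its integrand is integrable on Ω, and in general as the limit, as e→0+, with the area integral taken over r+e<|τ|<1−e, e<arg τ<π/α−e. *)

(* Defs.v *)
From HB Require Import structures.
From mathcomp Require Import all_boot all_order all_algebra.
From mathcomp Require Import all_classical all_reals all_analysis.
From mathcomp Require Export complex.
Set Implicit Arguments.
Unset Strict Implicit.
Unset Printing Implicit Defensive.
Import Order.TTheory GRing.Theory Num.Theory.
Import numFieldNormedType.Exports.
Local Open Scope classical_set_scope.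
Local Open Scope ring_scope.
Local Open Scope complex_scope.

(* [R[i]] packaged as a numFieldType: it is through this structure that it gets
   the topology of the modulus. *)
Definition C (R : realType) : numFieldType := R[i].

Section Defs.
Variable R : realType.
Implicit Types (z zeta : C R) (w f : C R -> C R) (D : set (C R)).

Definition cmod z : R := ComplexField.Normc.normc z.

(* The argument with values in [0, 2pi[ (a junk value at 0). *)
Definition carg z : R :=
  if 0 <= complex.Im z then acos (complex.Re z / cmod z)
  else 2 * pi - acos (complex.Re z / cmod z).

Definition polar (rho t : R) : C R := (rho * cos t) +i* (rho * sin t).

(* The power tau^beta of tau = rho e^(it), computed with the argument t.  The
   argument is passed explicitly because on the edge arg = pi / alpha it is
   [pi / alpha] and not [carg] when alpha = 1/2: the two edges then lie on the
   same segment and carry different powers. *)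
Definition ppow (beta rho t : R) : C R := polar (rho `^ beta) (beta * t).

Definition cpow (beta : R) z : C R := ppow beta (cmod z) (carg z).

Definition sector_ring (r1 r2 t1 t2 : R) : set (C R) :=
  [set z | r1 < cmod z < r2 /\ t1 < carg z < t2].

Definition Omega (alpha r : R) : set (C R) := sector_ring r 1 0 (pi / alpha).

(* Relatively compact truncations of Omega, exhausting it as e tends to 0+. *)
Definition Omega_trunc (alpha r e : R) : set (C R) :=
  sector_ring (r + e) (1 - e) e (pi / alpha - e).

(* w along the line through z in direction v, split into real functions. *)
Definition re_line w z (v : C R) (t : R) : R := complex.Re (w (z + t%:C * v)).
Definition im_line w z (v : C R) (t : R) : R := complex.Im (w (z + t%:C * v)).

Definition partial (v : C R) w z : C R :=
  (derive1 (re_line w z v) 0) +i* (derive1 (im_line w z v) 0).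

Definition has_partial (v : C R) w z : Prop :=
  derivable (re_line w z v) 0 1 /\ derivable (im_line w z v) 0 1.

Definition dx := partial 1.
Definition dy := partial (0 +i* 1).

Definition C1_on D w : Prop := forall z, D z ->
  [/\ has_partial 1 w z, has_partial (0 +i* 1) w z,
      {for z, continuous (dx w)} & {for z, continuous (dy w)}].

Definition dbar w z : C R := 2^-1 * (dx w z + (0 +i* 1) * dy w z).

Definition H1 (alpha r : R) z zeta : C R :=
  let q n : C R := (r `^ (2 * alpha * n%:R))%:C in
  (zeta + z) / (zeta - z) - (conjc zeta + z) / (conjc zeta - z)
  + 2 * \big[+%R/0]_(1 <= n <oo)
      (q n * (zeta / (q n * zeta - z) - z / (q n * z - zeta)
              - conjc zeta / (q n * conjc zeta - z) + z / (q n * z - conjc zeta))).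

Definition H2 (alpha r : R) z zeta : C R :=
  let q n : C R := (r `^ (2 * alpha * n%:R))%:C in
  1 / (zeta - z) - z / (1 - z * zeta)
  + \big[+%R/0]_(1 <= n <oo)
      (q n * (1 / (q n * zeta - z) - z / (zeta * (q n * z - zeta))
              - 1 / (zeta * (q n - z * zeta)) + z / (q n * z * zeta - 1))).

(* Integral from a to b, with the usual sign change when b < a. *)
Definition oint (a b : R) (g : R -> R) : R :=
  if a <= b then \int[lebesgue_measure]_(t in `[a, b]) g t
  else - \int[lebesgue_measure]_(t in `[b, a]) g t.

Definition coint (a b : R) (g : R -> C R) : C R :=
  oint a b (fun t => complex.Re (g t)) +i* oint a b (fun t => complex.Im (g t)).

(* Contour integrals of F(tau) dtau along tau = rho e^(it).  The integrand is
   given as a function of (rho, t), so that it may involve powers of tau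
   computed with the argument t.  On an arc dtau = i rho e^(it) dt, on a ray
   dtau = e^(it) drho. *)
Definition arc_int (rho a b : R) (F : R -> R -> C R) : C R :=
  coint a b (fun t => F rho t * ((0 +i* 1) * polar rho t)).

Definition ray_int (t a b : R) (F : R -> R -> C R) : C R :=
  coint a b (fun rho => F rho t * polar 1 t).

Definition int_Gamma1 (alpha : R) F : C R := arc_int 1 0 (pi / alpha) F.
Definition int_Gamma2 (alpha r : R) F : C R := arc_int r (pi / alpha) 0 F.
Definition int_varpi_omega (alpha r : R) F : C R := ray_int (pi / alpha) 1 r F.
Definition int_r_1 (r : R) F : C R := ray_int 0 r 1 F.

Definition plane D : set (R * R) := [set p | D (p.1 +i* p.2)].

Definition iint D (g : C R -> C R) : C R :=
  (\int[(lebesgue_measure \x lebesgue_measure)%E]_(p in plane D)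
      complex.Re (g (p.1 +i* p.2)))
  +i* (\int[(lebesgue_measure \x lebesgue_measure)%E]_(p in plane D)
      complex.Im (g (p.1 +i* p.2))).

Definition area_integrable D (g : C R -> C R) : Prop :=
  (lebesgue_measure \x lebesgue_measure)%E.-integrable (plane D)
    (fun p : R * R => (complex.Re (g (p.1 +i* p.2)))%:E) /\
  (lebesgue_measure \x lebesgue_measure)%E.-integrable (plane D)
    (fun p : R * R => (complex.Im (g (p.1 +i* p.2)))%:E).

(* The integrand of the area term. *)
Definition area_density (alpha r : R) f z (tau : C R) : C R :=
  cpow (alpha - 1) tau * H2 alpha r (cpow alpha z) (cpow alpha tau) * f tau
  - conjc (cpow (alpha - 1) tau)
    * H2 alpha r (cpow alpha z) (conjc (cpow alpha tau)) * conjc (f tau).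

(* The right-hand side of the representation formula, the area term being
   taken over D. *)
Definition representation (alpha r : R) w f z D : C R :=
  let ipi : C R := pi%:C * (0 +i* 1) in
  let Rew rho t : C R := (complex.Re (w (polar rho t)))%:C in
  let Imw rho t : C R := (complex.Im (w (polar rho t)))%:C in
  let F1 rho t :=
    Rew rho t * H1 alpha r (cpow alpha z) (ppow alpha rho t) / polar rho t in
  let F2 rho t :=
    Rew rho t * H2 alpha r (cpow alpha z) (ppow alpha rho t)
    * ppow (alpha - 1) rho t in
  alpha%:C / (2 * ipi) * (int_Gamma1 alpha F1 + int_Gamma2 alpha r F1)
  + alpha%:C / ipi * (int_varpi_omega alpha r F2 + int_r_1 r F2)
  + alpha%:C / pi%:C * int_Gamma1 alpha (fun rho t => Imw rho t / polar rho t)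
  - alpha%:C / pi%:C * iint D (area_density alpha r f z).

End Defs.

(* Main.v *)
From HB Require Import structures.
Require Import Defs.
From mathcomp Require Import all_boot all_order all_algebra.
From mathcomp Require Import all_classical all_reals all_analysis.
From mathcomp Require Import measurable_realfun ring lra.
Import Order.TTheory GRing.Theory Num.Theory.
Import numFieldNormedType.Exports.
Local Open Scope classical_set_scope.
Local Open Scope ring_scope.
Set Implicit Arguments.
Unset Strict Implicit.
Unset Printing Implicit Defensive.
Local Open Scope complex_scope.

Section change_of_variables.
Local Open Scope ereal_scope.
Context d1 d2 (X : measurableType d1) (Y : measurableType d2) (R : realType).
Variables (mu : {measure set X -> \bar R}) (nu : {measure set Y -> \bar R}).
Variables (phi : X -> Y) (h : X -> \bar R).
Hypotheses (mphi : measurable_fun setT phi) (mh : measurable_fun setT h).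
Hypotheses (h0 : forall x, 0 <= h x) (hfin : forall x, h x \is a fin_num).
Hypothesis nuE : forall A, measurable A ->
  nu A = \int[mu]_(x in phi @^-1` A) h x.

Import HBNNSimple.

Lemma ge0_integral_density (f : Y -> \bar R) :
  measurable_fun setT f -> (forall y, 0 <= f y) ->
  \int[nu]_y f y = \int[mu]_x (f (phi x) * h x).
Proof.
move=> mf f0; pose g := nnsfun_approx measurableT mf.
have gf y : EFin \o g ^~ y @ \oo --> f y by exact: cvg_nnsfun_approx.
have -> : \int[nu]_y f y = lim (\int[nu]_y (g n y)%:E @[n --> \oo]).
  under eq_integral => y _ do rewrite -(cvg_lim _ (gf y))//.
  apply: monotone_convergence => //.
  - by move=> n; exact/measurable_EFinP.
  - by move=> n y _; rewrite lee_fin.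
  - by move=> y _ a b ab; rewrite lee_fin; exact/lefP/nd_nnsfun_approx.
have -> : \int[mu]_x (f (phi x) * h x) =
    lim (\int[mu]_x ((g n (phi x))%:E * h x) @[n --> \oo]).
  have gfh x : (g n (phi x))%:E * h x @[n --> \oo] --> f (phi x) * h x.
    by apply: cvgeZr (gf (phi x)); exact: hfin.
  under eq_integral => x _ do rewrite -(cvg_lim _ (gfh x))//.
  apply: (monotone_convergence mu measurableT
    (g' := fun n x => (g n (phi x))%:E * h x)) => //.
  - move=> n; apply: emeasurable_funM => //.
    by apply/measurable_EFinP; exact: measurableT_comp.
  - by move=> n x _; rewrite mule_ge0// lee_fin.
  - move=> x _ a b ab; rewrite lee_wpmul2r// lee_fin.
    exact/lefP/nd_nnsfun_approx.
suff suf n : \int[nu]_y (g n y)%:E = \int[mu]_x ((g n (phi x))%:E * h x).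
  by under eq_fun do rewrite suf.
transitivity (\int[nu]_y (\sum_(k \in range (g n))
    (k * \1_(g n @^-1` [set k]) y)%:E)).
  by apply: eq_integral => y _; rewrite fimfunE -fsumEFin.
have mind k : measurable (g n @^-1` [set k]) by exact: measurable_sfunP.
have mindphi k : measurable (phi @^-1` (g n @^-1` [set k])).
  by rewrite -(setTI (phi @^-1` _)); exact: mphi.
rewrite ge0_integral_fsum//; last 2 first.
- by move=> k; apply/measurable_EFinP; exact: measurable_funM.
- by move=> k y _; exact: nnfun_muleindic_ge0.
transitivity (\int[mu]_x (\sum_(k \in range (g n))
    (k * \1_(g n @^-1` [set k]) (phi x))%:E * h x)); last first.
  apply: eq_integral => x _.
  rewrite -ge0_mule_fsuml => [|y]; last exact: nnfun_muleindic_ge0.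
  by rewrite fsumEFin// -(fimfunE _ (phi x)).
rewrite ge0_integral_fsum//; last 2 first.
- move=> k; apply: emeasurable_funM => //; apply/measurable_EFinP.
  apply: measurable_funM => //.
  exact: (measurableT_comp (measurable_indic (mind k)) mphi).
- by move=> k x _; rewrite mule_ge0// nnfun_muleindic_ge0.
apply: eq_fsbigr => k; rewrite inE => -[y0 _ gk].
have k0 : (0 <= k)%R by rewrite -gk.
under eq_integral do rewrite EFinM.
rewrite integralZl_indic_nnsfun//= integral_indic// setIT nuE//.
under [RHS]eq_integral do rewrite EFinM -muleA.
rewrite ge0_integralZl//.
- congr (_ * _); rewrite integral_mkcond; apply: eq_integral => x _.
  by rewrite epatch_indic muleC.
- apply: emeasurable_funM => //; apply/measurable_EFinP.
  exact: (measurableT_comp (measurable_indic (mind k)) mphi).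
- by move=> x _; rewrite mule_ge0// lee_fin.
Qed.

End change_of_variables.

Lemma FTC_is_derive (R : realType) (f F : R -> R) (a b : R) : a <= b ->
  (forall x, a <= x <= b -> is_derive x 1 F (f x)) ->
  {within `[a, b], continuous f} ->
  (\int[lebesgue_measure]_(x in `[a, b]) (f x)%:E = (F b - F a)%:E)%E.
Proof.
rewrite le_eqVlt => /predU1P[<- _ _|ab dF cf].
  by rewrite set_itv1 integral_set1 subrr.
have cF x : a <= x <= b -> {for x, continuous F}.
  move=> /dF xd; apply/differentiable_continuous/derivable1_diffP.
  exact: ex_derive.
rewrite EFinB; apply: continuous_FTC2 => //.
- split.
  + move=> x; rewrite in_itv/= => /andP[ax xb].
    have xd : is_derive x 1 F (f x) by apply: dF; lra.
    exact: ex_derive.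
  + by apply: cvg_at_right_filter; apply: cF; lra.
  + by apply: cvg_at_left_filter; apply: cF; lra.
- move=> x; rewrite in_itv/= => /andP[ax xb].
  have xd : is_derive x 1 F (f x) by apply: dF; lra.
  by rewrite derive1E derive_val.
Qed.

Section substitution.
Local Open Scope ereal_scope.
Context (R : realType).
Notation mu := (@lebesgue_measure R).

Lemma ge0_lebesgue_substitution (phi h : R -> R) :
  measurable_fun setT phi -> measurable_fun setT h -> (forall t, (0 <= h t)%R) ->
  (forall p q, (p < q)%R ->
     \int[mu]_(t in phi @^-1` `]p, q]) (h t)%:E = (q - p)%:E) ->
  forall G : R -> \bar R, measurable_fun setT G -> (forall y, 0 <= G y) ->
  \int[mu]_y G y = \int[mu]_t (G (phi t) * (h t)%:E).
Proof.
move=> mphi mh h0 hpq.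
have mpre A : measurable A -> measurable (phi @^-1` A).
  by move=> mA; rewrite -(setTI (phi @^-1` _)); exact: mphi.
pose nu (A : set (measurableTypeR R)) := \int[mu]_(t in phi @^-1` A) (h t)%:E.
have nu0 : nu set0 = 0 by rewrite /nu preimage_set0 integral_set0.
have nu_ge0 A : 0 <= nu A.
  by apply: integral_ge0 => t _; rewrite lee_fin.
have nu_sigma : semi_sigma_additive nu.
  move=> A mA tA mUA; rewrite /nu preimage_bigcup ge0_integral_bigcup//=.
  - apply: is_cvg_ereal_nneg_natsum_cond => n _ _.
    by apply: integral_ge0 => t _; rewrite lee_fin.
  - by move=> k; exact: (mpre (A k) (mA k)).
  - by apply/measurable_EFinP; exact: (measurable_funTS mh).
  - by move=> t _; rewrite lee_fin.
  - apply/trivIsetP => i j _ _ ij; rewrite -preimage_setI.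
    by move/trivIsetP : tA => /(_ _ _ I I ij) ->; rewrite preimage_set0.
pose nuM : {measure set (measurableTypeR R) -> \bar R} :=
  HB.pack nu (isMeasure.Build _ _ _ nu nu0 nu_ge0 nu_sigma).
have muE A : measurable A -> mu A = nuM A.
  apply: lebesgue_measure_unique => _ [[p q] _ <-].
  have [pq|qp] := ltP p q.
    by rewrite /= /nu hpq// lebesgue_measure_itv/= lte_fin pq EFinB.
  rewrite set_itv_ge.
  by rewrite !measure0.
  by rewrite bnd_simp -leNgt.
move=> G mG G0.
apply: (@ge0_integral_density _ _ (measurableTypeR R) (measurableTypeR R) R
  mu mu phi (EFin \o h)) => //; exact/measurable_EFinP.
Qed.

Lemma ge0_integral_scale (s : R) (G : R -> \bar R) : (0 < s)%R ->
  measurable_fun setT G -> (forall y, 0 <= G y) ->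
  \int[mu]_y G y = \int[mu]_t (G (s * t)%R * s%:E).
Proof.
move=> s0 mG G0; apply: (ge0_lebesgue_substitution
  (phi := fun t => (s * t)%R) (h := cst s)) => //.
- exact: measurable_funM.
- by move=> t; exact: ltW.
- move=> p q pq.
  have -> : (fun t => (s * t)%R) @^-1` `]p, q] = `](p / s)%R, (q / s)%R]%classic.
    apply/seteqP; split=> t /=; rewrite !in_itv/=.
      by rewrite ltr_pdivrMr// ler_pdivlMr// ![(t * s)%R]mulrC.
    by rewrite ltr_pdivrMr// ler_pdivlMr// ![(t * s)%R]mulrC.
  rewrite (integral_cst mu _ s%:E)//= lebesgue_measure_itv/= lte_fin.
  rewrite ltr_pM2r ?invr_gt0//.
  rewrite pq -EFinB -EFinM; congr EFin.
  by field; rewrite gt_eqF.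
Qed.

Lemma ge0_integral_reflect (k : R) (G : R -> \bar R) :
  measurable_fun setT G -> (forall y, 0 <= G y) ->
  \int[mu]_y G y = \int[mu]_t G (k - t)%R.
Proof.
move=> mG G0; under [RHS]eq_integral do rewrite -[G _]mule1.
apply: (ge0_lebesgue_substitution
  (phi := fun t => (k - t)%R) (h := cst 1%R)) => //.
- exact: measurable_funB.
- move=> p q pq.
  have -> : (fun t => (k - t)%R) @^-1` `]p, q] = `[(k - q)%R, (k - p)%R[%classic.
    by apply/seteqP; split=> t /=; rewrite !in_itv/=; lra.
  rewrite (integral_cst mu _ 1%:E)//= lebesgue_measure_itv/= lte_fin mul1e.
  rewrite ltrD2l ltrN2.
  by rewrite pq -EFinB; congr EFin; ring.
Qed.

Lemma ge0_integral_cot (y : R) (G : R -> \bar R) : (0 < y)%R ->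
  measurable_fun setT G -> (forall x, 0 <= G x) ->
  \int[mu]_x G x =
  \int[mu]_(t in `]0%R, pi[) (G (y * cos t / sin t)%R * (y / sin t ^+ 2)%:E).
Proof.
move=> y0 mG G0.
have sin0 t : t \in `]0%R, pi[ -> (0 < sin t :> R)%R.
  by rewrite in_itv/= => /sin_gt0_pi.
have mI : measurable (`]0%R, pi[%classic : set R) by exact: measurable_itv.
have csin : continuous (@sin R) by exact: continuous_sin.
pose phi t : R := (y * cos t / sin t)%R.
pose h t : R := (y / sin t ^+ 2)%R.
have cinv : {in `]0%R, pi[, continuous (fun t : R => (sin t)^-1)%R}.
  move=> t tI; apply: continuousV; last exact: continuous_sin.
  by rewrite gt_eqF// sin0.
have ch t : t \in `]0%R, pi[ -> {for t, continuous h}.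
  move=> tI; rewrite (_ : h = (fun t => y * ((sin t)^-1 * (sin t)^-1))%R); last first.
    by apply/funext => x; rewrite /h -exprVn expr2.
  apply: (@continuousM _ R (cst y)); first exact: cvg_cst.
  apply: (@continuousM _ R (fun t => (sin t)^-1)%R (fun t => (sin t)^-1)%R); exact: cinv.
have mphi : measurable_fun setT (phi \_ `]0%R, pi[).
  apply/(measurable_restrictT phi mI); apply: open_continuous_measurable_fun.
    exact: interval_open.
  move=> t tI; apply: (@continuousM _ R (fun t => y * cos t)%R (fun t => (sin t)^-1)%R).
    apply: (@continuousM _ R (cst y)); [exact: cvg_cst|exact: continuous_cos].
  by apply: cinv; rewrite inE in tI.
have mh : measurable_fun setT (h \_ `]0%R, pi[).
  apply/(measurable_restrictT h mI); apply: open_continuous_measurable_fun.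
    exact: interval_open.
  by move=> t; rewrite inE/= => tI; exact: ch.
transitivity (\int[mu]_t (G ((phi \_ `]0%R, pi[) t) * ((h \_ `]0%R, pi[) t)%:E)).
  apply: ge0_lebesgue_substitution => //.
    move=> t; rewrite patchE; case: ifPn => //; rewrite inE => /sin0 s0.
    by rewrite divr_ge0// ?sqr_ge0// ltW.
  move=> p q pq; pose psi x : R := (pi / 2 - atan (x / y))%R.
  have psi0 x : (0 < psi x < pi)%R.
    have := atan_gtNpi2 (x / y); have := atan_ltpi2 (x / y); rewrite /psi; lra.
  have phipsi x : phi (psi x) = x.
    rewrite /phi /psi cosB sinB cos_pihalf sin_pihalf !mul0r !mul1r add0r subr0.
    by rewrite -mulrA -/(tan _) atanK; field; rewrite gt_eqF.
  have psi_lt u v : (u < v)%R -> (psi v < psi u)%R.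
    by move=> uv; rewrite ltrD2l ltrN2; apply: lt_atan; rewrite ltr_pM2r// invr_gt0.
  have phi_gt t x : (0 < t < pi)%R -> (x < phi t)%R = (t < psi x)%R.
    move=> tI; have ts : psi (phi t) = t.
      rewrite /psi /phi -[in RHS](subKr (pi / 2)%R t); congr (_ - _)%R.
      rewrite -(tanK (x := (pi / 2 - t)%R)); last first.
        by rewrite in_itv/=; move: tI; lra.
      congr atan; rewrite /tan cosB sinB cos_pihalf sin_pihalf.
      rewrite !mul0r !mul1r add0r subr0; field.
      by rewrite !gt_eqF// sin0.
    apply/idP/idP => [/psi_lt|]; first by rewrite ts.
    rewrite !ltNge; apply: contra; rewrite le_eqVlt => /predU1P[<-|/psi_lt].
      by rewrite ts.
    by rewrite ts => /ltW.
  transitivity (\int[mu]_(t in `[psi q, psi p[) (h t)%:E).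
    rewrite integral_mkcond [RHS]integral_mkcond; apply: eq_integral => t _.
    rewrite !patchE; have [tI|tI] := boolP (t \in (`]0%R, pi[%classic : set R)).
      have tpi : (0 < t < pi)%R by move: tI; rewrite inE/= in_itv.
      rewrite (_ : (t \in _ @^-1` _) = (t \in `[psi q, psi p[%classic))//.
      apply/idP/idP; rewrite !inE /= patchE tI !in_itv/= !leNgt -!phi_gt//.
        by rewrite andbC.
      by rewrite andbC.
    rewrite if_same ifN//; apply: contra tI.
    rewrite !inE/= !in_itv/= => /andP[qt tp].
    by have := psi0 p; have := psi0 q; lra.
  rewrite integral_itv_bndo_bndc; last first.
    apply: (@measurable_funS _ _ _ _ `]0%R, pi[%classic) => //.
      apply: subset_itv; rewrite bnd_simp.
        by have := psi0 q; lra.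
      by have := psi0 p; lra.
    apply/measurable_EFinP; apply: open_continuous_measurable_fun.
      exact: interval_open.
    by move=> t; rewrite inE/=; exact: ch.
  transitivity ((- phi (psi p) - - phi (psi q))%R%:E); last first.
    by rewrite !phipsi; congr EFin; ring.
  apply: (@FTC_is_derive _ h (fun t => - phi t)%R).
  - by apply/ltW/psi_lt.
  - move=> t tpq.
    have s0 : (0 < sin t :> R)%R.
      by apply: sin0; rewrite in_itv/=; have := psi0 p; have := psi0 q; lra.
    have sn : (sin t != 0)%R by rewrite gt_eqF.
    rewrite /phi /h; apply: is_derive_eq; rewrite /GRing.scale/=.
    transitivity (y * (cos t ^+ 2 + sin t ^+ 2) / sin t ^+ 2)%R.
      by field.
    by rewrite cos2Dsin2 mulr1.
  - apply: continuous_in_subspaceT => t; rewrite inE/= in_itv/= => tpq.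
    apply: ch; rewrite in_itv/=.
    by have := psi0 p; have := psi0 q; lra.
rewrite [RHS]integral_mkcond; apply: eq_integral => t _.
by rewrite !patchE; case: ifPn => //; rewrite mule0.
Qed.

End substitution.

Lemma measurable_inv (R : realType) : measurable_fun setT (@GRing.inv R).
Proof.
have -> : @GRing.inv R = (@GRing.inv R) \_ [set~ 0].
  apply/funext => x; rewrite patchE; case: ifPn => //.
  by rewrite notin_setE/= => /contrapT ->; rewrite invr0.
have o0 : open [set~ (0 : R)] by apply/closed_openC/closed_eq.
apply/(measurable_restrictT _ (open_measurable o0)).
apply: open_continuous_measurable_fun => // x; rewrite inE/= => /eqP x0.
exact: inv_continuous.
Qed.

Lemma measurable_sin (R : realType) : measurable_fun setT (@sin R).
Proof. by apply: continuous_measurable_fun; exact: continuous_sin. Qed.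

Lemma measurable_cos (R : realType) : measurable_fun setT (@cos R).
Proof. by apply: continuous_measurable_fun; exact: continuous_cos. Qed.

Section polar_integral.
Local Open Scope ereal_scope.
Context (R : realType).
Notation mu := (@lebesgue_measure R).
Notation mu2 := (mu \x mu)%E.

Lemma measurable_polar :
  measurable_fun setT (fun q : R * R => (q.1 * cos q.2, q.1 * sin q.2)%R).
Proof.
apply: measurable_fun_pair; apply: measurable_funM => //.
  by apply: (measurableT_comp (@measurable_cos R)); exact: measurable_snd.
by apply: (measurableT_comp (@measurable_sin R)); exact: measurable_snd.
Qed.

Let polar_int (G : R * R -> \bar R) t :=
  \int[mu]_(rho in `]0%R, +oo[) (G (rho * cos t, rho * sin t)%R * rho%:E).

Let upper_half (G : R * R -> \bar R) :
  measurable_fun setT G -> (forall p, 0 <= G p) ->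
  \int[mu]_(y in `]0%R, +oo[) \int[mu]_x G (x, y) =
  \int[mu]_(t in `]0%R, pi[) polar_int G t.
Proof.
move=> mG G0.
pose H (q : R * R) := G (q.2 * cos q.1 / sin q.1, q.2)%R *
  (q.2 / sin q.1 ^+ 2 * \1_(`]0%R, pi[%classic : set R) q.1
     * \1_(`]0%R, +oo[%classic : set R) q.2)%:E.
have mc1 : measurable_fun setT (fun q : R * R => cos q.1).
  by apply: (measurableT_comp (@measurable_cos R)); exact: measurable_fst.
have ms1 : measurable_fun setT (fun q : R * R => (sin q.1)^-1)%R.
  apply: (@measurableT_comp _ _ _ _ _ _ (@GRing.inv R) _
    (fun q : R * R => sin q.1) (measurable_inv (R:=R))).
  by apply: (measurableT_comp (@measurable_sin R)); exact: measurable_fst.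
have mH : measurable_fun setT H.
  apply: emeasurable_funM.
    apply: measurableT_comp => //; apply: measurable_fun_pair => //.
    by apply: measurable_funM => //; apply: measurable_funM.
  apply/measurable_EFinP; apply: measurable_funM; last first.
    apply: (@measurableT_comp _ _ _ _ _ _
      (\1_(`]0%R, +oo[%classic : set R) : R -> R) _ snd) => //;
      exact: measurable_indic.
  apply: measurable_funM; last first.
    apply: (@measurableT_comp _ _ _ _ _ _
      (\1_(`]0%R, pi[%classic : set R) : R -> R) _ fst) => //;
      exact: measurable_indic.
  apply: measurable_funM => //.
  by under eq_fun do rewrite -exprVn; exact: measurable_funX.
have H0 q : 0 <= H q.
  rewrite mule_ge0// lee_fin; have [q0|q0] := ltP 0%R q.2.
    by rewrite !mulr_ge0 ?invr_ge0 ?sqr_ge0// ltW.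
  rewrite [X in (_ * X)%R]indicE memNset ?mulr0//= in_itv/= andbT.
  by apply/negP; rewrite -leNgt.
transitivity (\int[mu]_y \int[mu]_t H (t, y)).
  rewrite integral_mkcond; apply: eq_integral => y _; rewrite patchE.
  case: ifPn => [|yI]; last first.
    by rewrite integral0_eq// => t _; rewrite /H/= !indicE (negbTE yI) mulr0 mule0.
  rewrite inE/= in_itv/= andbT => y0.
  rewrite (ge0_integral_cot y0)//; last first.
    exact: measurableT_comp.
  rewrite integral_mkcond; apply: eq_integral => t _; rewrite patchE /H/= !indicE.
  have -> : y \in `]0%R, +oo[%classic by rewrite mem_set//= in_itv/= y0.
  by case: ifPn => _; rewrite ?mulr1 ?mul0r ?mulr0 ?mul0r ?mule0.
transitivity (\int[mu]_t \int[mu]_y H (t, y)).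
  exact/esym/(fubini_tonelli (m1 := mu) (m2 := mu) H mH H0).
rewrite [RHS]integral_mkcond; apply: eq_integral => t _; rewrite patchE.
case: ifPn => [|tI]; last first.
  rewrite integral0_eq// => y _.
  by rewrite /H/= !indicE (negbTE tI) mulr0 mul0r mule0.
rewrite inE/= in_itv/= => /[dup] tI /sin_gt0_pi s0.
rewrite (ge0_integral_scale s0)//; last exact: measurableT_comp.
rewrite /polar_int [RHS]integral_mkcond; apply: eq_integral => rho _.
rewrite patchE /H/= !indicE (mem_set (A := `]0%R, pi[%classic)); last first.
  by rewrite /= in_itv.
case: ifPn => rhoI.
  rewrite (mem_set (A := `]0%R, +oo[%classic)); last first.
    move: rhoI; rewrite inE/= !in_itv/= !andbT => rho0.
    by rewrite mulr_gt0.
  rewrite -muleA -EFinM; congr (G _ * _%:E).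
    by congr (_, _); [field; rewrite gt_eqF|ring].
  by rewrite mulr1n; field; rewrite gt_eqF.
rewrite memNset ?mulr0 ?mule0 ?mul0e//=.
move: rhoI; rewrite notin_setE/= !in_itv/= !andbT.
by rewrite pmulr_rgt0.
Qed.

Theorem polar_integral (G : R * R -> \bar R) :
  measurable_fun setT G -> (forall p, 0 <= G p) ->
  \int[mu2]_p G p =
  \int[mu2]_(q in `]0%R, +oo[ `*` `]0%R, (2 * pi)%R[)
    (G (q.1 * cos q.2, q.1 * sin q.2)%R * q.1%:E).
Proof.
move=> mG G0; have pi2 := pi_gt0 R.
pose F y := \int[mu]_x G (x, y).
have mF : measurable_fun setT F.
  exact: (measurable_fun_fubini_tonelli_G (m1 := mu) G).
have F0 y : 0 <= F y by exact: integral_ge0.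
pose G' (p : R * R) := G (p.1, - p.2)%R.
have mG' : measurable_fun setT G'.
  apply: measurableT_comp => //; apply: measurable_fun_pair => //.
  exact: measurableT_comp.
pose K := polar_int G.
have mK : measurable_fun setT K.
  pose L (q : R * R) := G (q.1 * cos q.2, q.1 * sin q.2)%R *
    (q.1 * \1_(`]0%R, +oo[%classic : set R) q.1)%:E.
  have mL : measurable_fun setT L.
    apply: emeasurable_funM.
      exact: (measurableT_comp mG measurable_polar).
    apply/measurable_EFinP; apply: measurable_funM => //.
    apply: (@measurableT_comp _ _ _ _ _ _
      (\1_(`]0%R, +oo[%classic : set R) : R -> R) _ fst) => //;
      exact: measurable_indic.
  have L0 q : 0 <= L q.
    rewrite mule_ge0// lee_fin; have [q0|q0] := ltP 0%R q.1.
      by rewrite !mulr_ge0// ltW.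
    rewrite [X in (_ * X)%R]indicE memNset ?mulr0//= in_itv/= andbT.
  by apply/negP; rewrite -leNgt.
  rewrite (_ : K = fun t => \int[mu]_rho L (rho, t)).
    exact: (measurable_fun_fubini_tonelli_G (m1 := mu) L).
  apply/funext => t; rewrite /K /polar_int integral_mkcond.
  apply: eq_integral => rho _; rewrite patchE /L/= indicE.
  by case: ifPn => _; rewrite ?mulr1 ?mulr0 ?mule0.
have K0 t : 0 <= K t.
  apply: integral_ge0 => rho; rewrite /= in_itv/= andbT => rho0.
  by rewrite mule_ge0// lee_fin ltW.
have -> : \int[mu2]_p G p = \int[mu]_(t in `]0%R, pi[) K t +
    \int[mu]_(t in `]pi, (2 * pi)%R[) K t.
  rewrite fubini_tonelli2// -/F.
  have -> : [set: R] = `]-oo, 0%R[%classic `|` `[0%R, +oo[%classic.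
    by rewrite -setCitvl setUv.
  rewrite (@ge0_integral_setU _ _ _ mu _ _ _ _ F); first last.
  - rewrite disj_set2E; apply/eqP; rewrite -subset0 => x []/=.
    by rewrite !in_itv/= andbT ltNge => /negP.
  - by [].
  - exact: (measurable_funTS mF).
  - exact: measurable_itv.
  - exact: measurable_itv.
  have -> : \int[mu]_(y in `[0%R, +oo[) F y = \int[mu]_(t in `]0%R, pi[) K t.
    rewrite -integral_itv_obnd_cbnd; last exact: (measurable_funTS mF).
    exact: (upper_half mG G0).
  rewrite [LHS]addeC; congr (_ + _).
  transitivity (\int[mu]_(y in `]0%R, +oo[) \int[mu]_x G' (x, y)).
    rewrite integral_mkcond (ge0_integral_reflect 0); last 2 first.
    - apply/(measurable_restrictT F (measurable_itv _)).
      exact: (measurable_funTS mF).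
    - by move=> y; rewrite patchE; case: ifPn.
    rewrite [RHS]integral_mkcond; apply: eq_integral => y _.
    rewrite !patchE sub0r.
    rewrite (_ : (_ \in _) = (y \in `]0%R, +oo[%classic))//.
    by apply/idP/idP; rewrite !inE/= !in_itv/= andbT oppr_lt0.
  transitivity (\int[mu]_(t in `]0%R, pi[) polar_int G' t).
    exact: (upper_half mG' (fun p => G0 _)).
  transitivity (\int[mu]_t (K \_ `]pi, (2 * pi)%R[) t); last first.
    by rewrite [RHS]integral_mkcond.
  rewrite [RHS](ge0_integral_reflect (2 * pi)); last 2 first.
  - apply/(measurable_restrictT K (measurable_itv _)).
    exact: (measurable_funTS mK).
  - by move=> y; rewrite patchE; case: ifPn.
  rewrite integral_mkcond; apply: eq_integral => t _; rewrite !patchE.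
  have -> : ((2 * pi - t)%R \in `]pi, (2 * pi)%R[%classic) =
      (t \in `]0%R, pi[%classic).
    by apply/idP/idP; rewrite !inE/= !in_itv/=; lra.
  case: ifPn => // _; apply: eq_integral => rho _; rewrite /G'/=.
  rewrite cosB sinB mulr_natl cos2pi sin2pi !mul0r !mul1r addr0 sub0r.
  by rewrite mulrN.
rewrite [X in _ + X]integral_itv_obnd_cbnd; last exact: (measurable_funTS mK).
rewrite -(@ge0_integral_setU _ _ _ mu _ _ _ _ K); first last.
- rewrite disj_set2E; apply/eqP; rewrite -subset0 => x []/=.
  by rewrite !in_itv/=; lra.
- by [].
- exact: (measurable_funTS mK).
- exact: measurable_itv.
- exact: measurable_itv.
rewrite -itv_bndbnd_setU ?bnd_simp; [|lra|lra].
pose S : set (R * R) := `]0%R, +oo[ `*` `]0%R, (2 * pi)%R[.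
have mS : measurable S by apply: measurableX.
pose L (q : R * R) := G (q.1 * cos q.2, q.1 * sin q.2)%R * q.1%:E.
have mL : measurable_fun setT (L \_ S).
  apply/(measurable_restrictT L mS); apply: measurable_funTS.
  apply: emeasurable_funM; last exact/measurable_EFinP.
  by apply: (measurableT_comp mG); exact: measurable_polar.
have L0 q : 0 <= (L \_ S) q.
  rewrite patchE; case: ifPn => //; rewrite inE => -[/=].
  by rewrite in_itv/= andbT => q0 _; rewrite mule_ge0// lee_fin ltW.
transitivity (\int[mu2]_q (L \_ S) q); last by rewrite -integral_mkcond.
transitivity (\int[mu]_t \int[mu]_rho (L \_ S) (rho, t)); last first.
  exact/esym/(fubini_tonelli2 (m1 := mu) (m2 := mu) _ mL L0).
rewrite integral_mkcond; apply: eq_integral => t _; rewrite patchE.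
case: ifPn => tI; last first.
  rewrite integral0_eq// => rho _; rewrite patchE memNset// => -[/= _ tI'].
  by move: tI; rewrite notin_setE.
rewrite /K /polar_int integral_mkcond; apply: eq_integral => rho _.
rewrite !patchE; congr (if _ then _ else _).
apply/idP/idP; rewrite !inE; first by split=> //; move: tI; rewrite inE.
by case.
Qed.

End polar_integral.

Section polar_coordinates.
Context (R : realType).
Implicit Types (z : C R) (rho t : R).

Lemma cmodE z : cmod z = Num.sqrt (complex.Re z ^+ 2 + complex.Im z ^+ 2).
Proof. by case: z. Qed.

Lemma cmod_ge0 z : 0 <= cmod z.
Proof. by rewrite cmodE sqrtr_ge0. Qed.

Lemma cmod_polar rho t : 0 <= rho -> cmod (polar rho t) = rho.
Proof.
move=> rho0; rewrite cmodE /= !exprMn -mulrDr cos2Dsin2 mulr1 sqrtr_sqr.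
by rewrite ger0_norm.
Qed.

Lemma polar_neq0 rho t : 0 < rho -> polar rho t != 0.
Proof.
move=> rho0; apply/eqP => /(congr1 (@cmod R)); rewrite cmod_polar ?(ltW rho0)//.
by rewrite /= expr0n/= addr0 sqrtr0 => rhoe; move: rho0; rewrite rhoe ltxx.
Qed.

Lemma carg_polar rho t : 0 < rho -> 0 <= t < 2 * pi -> carg (polar rho t) = t.
Proof.
move=> rho0 /andP[t0 t2]; rewrite /carg cmod_polar ?(ltW rho0)//=.
rewrite mulrAC mulfV ?gt_eqF// mul1r pmulr_rge0//.
have [tpi|pit] := leP t pi.
  by rewrite sin_ge0_pi ?t0// cosK// in_itv/= t0.
have -> : cos t = cos (2 * pi - t).
  by rewrite cosB mulr_natl cos2pi sin2pi mul1r mul0r addr0.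
rewrite cosK; last by rewrite in_itv/=; lra.
rewrite ifF ?subKr//; apply/negbTE; rewrite -ltNge.
have -> : sin t = - sin (2 * pi - t).
  by rewrite sinB mulr_natl cos2pi sin2pi mul1r mul0r sub0r opprK.
by rewrite oppr_lt0 sin_gt0_pi//; lra.
Qed.

Lemma cmod_gt0 z : z != 0 -> 0 < cmod z.
Proof.
case: z => x y; rewrite eq_complex/= negb_and/= sqrtr_gt0 => xy.
rewrite lt0r addr_ge0 ?sqr_ge0// andbT paddr_eq0 ?sqr_ge0// !sqrf_eq0.
by rewrite negb_and.
Qed.

Lemma cmod_sqr z : cmod z ^+ 2 = complex.Re z ^+ 2 + complex.Im z ^+ 2.
Proof. by rewrite cmodE sqr_sqrtr// addr_ge0// sqr_ge0. Qed.

Lemma Re_le_cmod z : `|complex.Re z| <= cmod z.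
Proof.
by rewrite -sqrtr_sqr cmodE ler_wsqrtr// lerDl sqr_ge0.
Qed.

Lemma Im_le_cmod z : `|complex.Im z| <= cmod z.
Proof.
by rewrite -sqrtr_sqr cmodE ler_wsqrtr// lerDr sqr_ge0.
Qed.

Lemma polarK z : z != 0 -> polar (cmod z) (carg z) = z.
Proof.
move=> z0; have m0 := cmod_gt0 z0; have mn : cmod z != 0 by rewrite gt_eqF.
set c := complex.Re z / cmod z.
have c1 : -1 <= c <= 1.
  by rewrite -ler_norml normrM normfV (ger0_norm (ltW m0)) ler_pdivrMr// mul1r Re_le_cmod.
have cE : cmod z * c = complex.Re z by rewrite /c mulrC divfK.
have sE : cmod z * Num.sqrt (1 - c ^+ 2) = `|complex.Im z|.
  transitivity (Num.sqrt (cmod z ^+ 2) * Num.sqrt (1 - c ^+ 2)).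
    by rewrite sqrtr_sqr ger0_norm ?ltW.
  rewrite -sqrtrM ?sqr_ge0// mulrBr mulr1 -exprMn cE cmod_sqr addrAC subrr add0r sqrtr_sqr//.
rewrite /polar /carg -/c; case: z => x y in z0 m0 mn c c1 cE sE *.
case: ifPn => [y0|]; first by rewrite acosK ?in_itv//= sin_acos// cE sE ger0_norm.
rewrite -ltNge => y0; rewrite cosB sinB mulr_natl cos2pi sin2pi !mul0r !mul1r.
rewrite addr0 sub0r acosK ?in_itv//= sin_acos// mulrN cE sE ltr0_norm//.
by rewrite opprK.
Qed.

Lemma carg_ge0 z : z != 0 -> 0 <= carg z < 2 * pi.
Proof.
move=> z0; have m0 := cmod_gt0 z0.
have c1 : -1 <= complex.Re z / cmod z <= 1.
  by rewrite -ler_norml normrM normfV (ger0_norm (ltW m0)) ler_pdivrMr// mul1r Re_le_cmod.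
have := acos_ge0 c1; have := acos_lepi c1; have := pi_gt0 R.
rewrite /carg; case: ifPn => y0 pi0 cpi c0; first by apply/andP; split; lra.
suff : 0 < acos (complex.Re z / cmod z) by lra.
rewrite acos_gt0//; case/andP: c1 => -> c1; rewrite lt_neqAle c1 andbT.
apply: contra y0 => /eqP /(canRL (divfK _)) ; rewrite gt_eqF// mul1r => /(_ isT) E.
have /eqP : complex.Im z ^+ 2 = 0 by have := cmod_sqr z; rewrite -E; lra.
by rewrite sqrf_eq0 => /eqP ->.
Qed.

Lemma carg_atan z : z != 0 -> carg z =
  if (complex.Im z == 0) && (0 <= complex.Re z) then 0
  else pi - 2 * atan (complex.Im z / (cmod z - complex.Re z)).
Proof.
move=> z0; suff key (m t : R) : 0 < m -> 0 <= t < 2 * pi -> t =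
    if (complex.Im (polar m t) == 0) && (0 <= complex.Re (polar m t)) then 0
    else pi - 2 * atan (complex.Im (polar m t) / (m - complex.Re (polar m t))).
  by have := key _ _ (cmod_gt0 z0) (carg_ge0 z0); rewrite polarK.
move=> m0 /andP[t0 t2] /=.
have [->|tn] := eqVneq t 0; first by rewrite cos0 sin0 mulr0 mulr1 eqxx ltW.
have {tn}t0 : 0 < t by rewrite lt_neqAle eq_sym tn.
have sh : 0 < sin (t / 2) by rewrite sin_gt0_pi//; lra.
have tE : t = (t / 2) *+ 2 by rewrite -mulr_natr divfK.
have c1 : 1 - cos t = 2 * sin (t / 2) ^+ 2.
  by rewrite {1}tE cos_mulr2n cos2sin2; ring.
rewrite ifF; last first.
  apply/negbTE/negP => /andP[]; rewrite mulf_eq0 gt_eqF//= => /eqP s0.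
  rewrite pmulr_rge0// => c0.
  have : cos t ^+ 2 = 1 by rewrite cos2sin2 s0 expr0n subr0.
  move/eqP; rewrite sqrf_eq1 => /orP[/eqP c|/eqP c]; last by move: c0; rewrite c; lra.
  by move: c1; rewrite c subrr => /esym/eqP; rewrite mulf_eq0 pnatr_eq0/= sqrf_eq0 gt_eqF.
have -> : m * sin t / (m - m * cos t) = tan (pi / 2 - t / 2).
  rewrite /tan sinB cosB sin_pihalf cos_pihalf !mul1r !mul0r subr0 add0r.
  have -> : m - m * cos t = m * (2 * sin (t / 2) ^+ 2) by rewrite -c1; ring.
  by rewrite {1}tE sin_mulr2n; field; rewrite !gt_eqF.
by rewrite tanK ?in_itv/=; lra.
Qed.

End polar_coordinates.

Section sector_integral.
Context (R : realType) (r1 r2 t1 t2 : R).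
Hypotheses (r1_ge0 : 0 <= r1) (t1_ge0 : 0 <= t1) (t2_le : t2 <= 2 * pi).
Notation mu := (@lebesgue_measure R).
Notation mu2 := (mu \x mu)%E.

Let S : set (R * R) := `]r1, r2[ `*` `]t1, t2[.
Let sector := plane (sector_ring r1 r2 t1 t2).

Let mS : measurable S. Proof. exact: measurableX. Qed.

(* Agrees with [(cmod, carg)] away from the origin. *)
Let coord (p : R * R) : R * R :=
  (Num.sqrt (p.1 ^+ 2 + p.2 ^+ 2),
   if (p.2 == 0) && (0 <= p.1) then 0
   else pi - 2 * atan (p.2 / (Num.sqrt (p.1 ^+ 2 + p.2 ^+ 2) - p.1))).

Let mcoord : measurable_fun setT coord.
Proof.
have msqrt : measurable_fun setT
    (fun p : R * R => Num.sqrt (p.1 ^+ 2 + p.2 ^+ 2)).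
  apply: (@measurableT_comp _ _ _ _ _ _ (@Num.sqrt R : R -> R) _
    (fun p : R * R => p.1 ^+ 2 + p.2 ^+ 2)).
    by apply: continuous_measurable_fun; exact: sqrt_continuous.
  by apply: measurable_funD; exact: measurable_funX.
apply: measurable_fun_pair => //; apply: measurable_fun_ifT => //.
  apply: measurable_and.
    by apply: measurable_fun_eqr.
  by apply: measurable_fun_ler.
apply: measurable_funB => //; apply: measurable_funM => //.
apply: (@measurableT_comp _ _ _ _ _ _ (@atan R : R -> R) _
    (fun p : R * R => p.2 / (Num.sqrt (p.1 ^+ 2 + p.2 ^+ 2) - p.1))).
  by apply: continuous_measurable_fun; exact: continuous_atan.
apply: measurable_funM => //.
apply: (@measurableT_comp _ _ _ _ _ _ (@GRing.inv R : R -> R) _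
    (fun p : R * R => Num.sqrt (p.1 ^+ 2 + p.2 ^+ 2) - p.1)).
  exact: measurable_inv.
exact: measurable_funB.
Qed.

Let coordE (p : R * R) : p.1 +i* p.2 != 0 ->
  coord p = (cmod (p.1 +i* p.2), carg (p.1 +i* p.2)).
Proof. by move=> p0; rewrite (carg_atan p0) /coord cmodE. Qed.

Let coord0 : coord (0, 0) = (0, 0).
Proof. by rewrite /coord/= eqxx lexx expr0n/= addr0 sqrtr0. Qed.

Let coord_sector (p : R * R) : sector p <-> S (coord p).
Proof.
have [p0|p0] := eqVneq (p.1 +i* p.2) 0.
  rewrite (_ : p = (0, 0)); last first.
    by case: p p0 => x y/= [-> ->].
  rewrite coord0 /sector /plane/= /sector_ring/=.
  split=> [[]|[/=]].
    by rewrite expr0n/= addr0 sqrtr0 => /andP[/(le_lt_trans r1_ge0)]; rewrite ltxx.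
  by rewrite in_itv/= => /andP[/(le_lt_trans r1_ge0)]; rewrite ltxx.
by rewrite coordE// /sector /plane /S /sector_ring/= !in_itv.
Qed.

Let coord_neq0 (p : R * R) : sector p -> p.1 +i* p.2 != 0.
Proof.
move=> sp; apply/eqP => p0; move: sp; rewrite /sector /plane/= p0 => -[].
by rewrite /= expr0n/= addr0 sqrtr0 => /andP[/(le_lt_trans r1_ge0)]; rewrite ltxx.
Qed.

Let coord_polar (q : R * R) : 0 < q.1 -> 0 <= q.2 < 2 * pi ->
  coord (q.1 * cos q.2, q.1 * sin q.2) = q.
Proof.
move=> q1 q2; rewrite coordE; last exact: (polar_neq0 q.2 q1).
rewrite [X in cmod X](_ : _ = polar q.1 q.2)//.
rewrite [X in carg X](_ : _ = polar q.1 q.2)//.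
by rewrite cmod_polar ?(ltW q1)// carg_polar// -surjective_pairing.
Qed.

Local Open Scope ereal_scope.

Let ge0_integral_sector (h : R * R -> \bar R) :
  measurable_fun S h -> (forall q, S q -> 0 <= h q) ->
  \int[mu2]_(p in sector) h (cmod (p.1 +i* p.2), carg (p.1 +i* p.2)) =
  \int[mu2]_(q in S) (h q * q.1%:E).
Proof.
move=> mh h0; pose H := h \_ S.
have mH : measurable_fun setT (H \o coord).
  by apply: measurableT_comp => //; exact/(measurable_restrictT h mS).
have H0 p : 0 <= H p.
  by rewrite /H patchE; case: ifPn => //; rewrite inE; exact: h0.
transitivity (\int[mu2]_p (H \o coord) p).
  rewrite integral_mkcond; apply: eq_integral => p _; rewrite patchE /H/= patchE.
  case: ifPn => [|ps]; rewrite ?inE.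
    by move=> sp; rewrite mem_set ?coordE ?coord_neq0//; exact/coord_sector.
  by rewrite memNset//= => /coord_sector; move: ps; rewrite notin_setE.
rewrite (polar_integral mH) => [|p]; last exact: H0.
rewrite integral_mkcond [RHS]integral_mkcond; apply: eq_integral => q _.
rewrite !patchE; have [Sq|Sq] := boolP (q \in S).
  move: (Sq); rewrite inE => -[/=]; rewrite !in_itv/= => /andP[q1 q1'] /andP[q2 q2'].
  have q10 : (0 < q.1)%R by exact: le_lt_trans r1_ge0 q1.
  rewrite mem_set//=; last first.
    rewrite !in_itv/= andbT q10; split=> //; have := t1_ge0; have := t2_le.
    by move=> *; apply/andP; split; lra.
  by rewrite coord_polar ?q10// ?/H ?patchE ?Sq//; apply/andP; split;
    have := t1_ge0; have := t2_le; lra.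
case: ifPn => // q0; rewrite /H/= patchE ifN ?mul0e//.
move: q0; rewrite inE => -[/=]; rewrite !in_itv/= andbT => q10 /andP[q20 q2pi].
by rewrite coord_polar// q2pi andbT ltW.
Qed.

Lemma integral_sector (h : R * R -> R) : measurable_fun S h ->
  \int[mu2]_(p in sector) (h (cmod (p.1 +i* p.2), carg (p.1 +i* p.2)))%:E =
  \int[mu2]_(q in S) (h q * q.1)%:E.
Proof.
move=> mh; have mhE : measurable_fun S (EFin \o h) by exact/measurable_EFinP.
have S1 q : S q -> (0 <= q.1)%R.
  by move=> [/=]; rewrite in_itv/= => /andP[q1 _] _; exact: ltW (le_lt_trans r1_ge0 q1).
rewrite integralE [RHS]integralE; congr (_ - _).
- transitivity (\int[mu2]_(q in S) ((EFin \o h)^\+ q * q.1%:E)).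
    rewrite -(ge0_integral_sector (measurable_funepos mhE))//.
    by apply: eq_integral => p _; rewrite !funeposE.
  apply: eq_integral => q; rewrite inE => Sq.
  by rewrite !funeposE/= EFinM maxe_pMl ?lee_fin ?S1// mul0e.
- transitivity (\int[mu2]_(q in S) ((EFin \o h)^\- q * q.1%:E)).
    rewrite -(ge0_integral_sector (measurable_funeneg mhE))//.
    by apply: eq_integral => p _; rewrite !funenegE.
  apply: eq_integral => q; rewrite inE => Sq.
  by rewrite !funenegE/= -mulNr EFinM maxe_pMl ?lee_fin ?S1// mul0e.
Qed.

End sector_integral.

Section complex_topology.
Context (R : realType).
Implicit Types z : C R.

Lemma normCE z : `|z| = (cmod z)%:C.
Proof. by []. Qed.

Lemma ltc_real (x y : R) : (x%:C < y%:C :> C R) = (x < y).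
Proof. by rewrite ltcE/= eqxx. Qed.

Lemma posC_real (e : C R) : 0 < e -> 0 < complex.Re e /\ e = (complex.Re e)%:C.
Proof. by case: e => a b; rewrite ltcE/= => /andP[/eqP -> a0]. Qed.

Lemma cvg_cmodP (T : Type) (F : set_system T) (FF : Filter F) (f : T -> C R)
    (l : C R) :
  f @ F --> l <-> forall e : R, 0 < e -> \forall x \near F, cmod (l - f x) < e.
Proof.
split=> [/cvgrPdist_lt fl e e0|fl].
  have e0' : 0 < e%:C :> C R by rewrite ltc_real.
  by apply: filterS (fl _ e0') => x; rewrite normCE ltc_real.
apply/cvgrPdist_lt => e /posC_real[e0 ->].
by apply: filterS (fl _ e0) => x; rewrite normCE ltc_real.
Qed.

Lemma cmod_le_ReIm z : cmod z <= `|complex.Re z| + `|complex.Im z|.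
Proof.
rewrite -(ler_pXn2r (n := 2))// ?nnegrE ?cmod_ge0 ?addr_ge0// cmod_sqr sqrrD.
rewrite !real_normK ?num_real// -addrA lerD2l lerDr mulrn_wge0//.
Qed.

Lemma cvg_complexP (T : Type) (F : set_system T) (FF : Filter F) (f : T -> C R)
    (l : C R) :
  f @ F --> l <-> complex.Re (f x) @[x --> F] --> complex.Re l /\
                  complex.Im (f x) @[x --> F] --> complex.Im l.
Proof.
split=> [/cvg_cmodP fl|[/cvgrPdist_lt fr /cvgrPdist_lt fi]].
  by split; apply/cvgrPdist_lt => e e0; apply: filterS (fl _ e0) => x;
    apply: le_lt_trans; [have := Re_le_cmod (l - f x)|have := Im_le_cmod (l - f x)];
    rewrite raddfB.
apply/cvg_cmodP => e e0; have e2 : 0 < e / 2 by rewrite divr_gt0.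
apply: filterS2 (fr _ e2) (fi _ e2) => x; rewrite -!raddfB => hr hi.
by apply: le_lt_trans (cmod_le_ReIm _) _; rewrite (splitr e) ltrD.
Qed.

Lemma cvg_pair_complex (T : Type) (F : set_system T) (FF : Filter F)
    (f g : T -> R) (a b : R) :
  f @ F --> a -> g @ F --> b -> (f x +i* g x : C R) @[x --> F] --> (a +i* b : C R).
Proof. by move=> fa gb; apply/cvg_complexP. Qed.

Lemma cvg_real_complex (T : Type) (F : set_system T) (FF : Filter F)
    (f : T -> R) (a : R) :
  f @ F --> a -> ((f x)%:C : C R) @[x --> F] --> (a%:C : C R).
Proof. by move=> fa; apply: cvg_pair_complex => //; exact: cvg_cst. Qed.

Lemma Re_conjc z : complex.Re (conjc z) = complex.Re z.
Proof. by case: z. Qed.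

Lemma Im_conjc z : complex.Im (conjc z) = - complex.Im z.
Proof. by case: z. Qed.

Lemma cvg_conjc (T : Type) (F : set_system T) (FF : Filter F)
    (f : T -> C R) (l : C R) :
  f @ F --> l -> (conjc (f x) : C R) @[x --> F] --> (conjc l : C R).
Proof.
move=> /cvg_complexP[fr fi]; apply/cvg_complexP; split.
  by under eq_fun do rewrite Re_conjc; rewrite Re_conjc.
by under eq_fun do rewrite Im_conjc; rewrite Im_conjc; exact: cvgN.
Qed.

Lemma continuous_polar : continuous (fun q : R * R => polar q.1 q.2 : C R).
Proof.
move=> q; apply: cvg_pair_complex; apply: cvgM; (try exact: cvg_fst).
  by apply: continuous_comp; [exact: cvg_snd|exact: continuous_cos].
by apply: continuous_comp; [exact: cvg_snd|exact: continuous_sin].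
Qed.

Lemma cmodM (z1 z2 : C R) : cmod (z1 * z2) = cmod z1 * cmod z2.
Proof.
by have /(congr1 (@complex.Re R)) := normrM z1 z2; rewrite !normCE /= mul0r subr0.
Qed.

Lemma cmodV (z : C R) : cmod z^-1 = (cmod z)^-1.
Proof.
have /(congr1 (@complex.Re R)) := normfV z; rewrite !normCE.
by rewrite -fmorphV.
Qed.

Lemma cmodN (z : C R) : cmod (- z) = cmod z.
Proof. by have /(congr1 (@complex.Re R)) := normrN z. Qed.

Lemma cmodB (z1 z2 : C R) : cmod (z1 - z2) = cmod (z2 - z1).
Proof. by rewrite -cmodN opprB. Qed.

Lemma cmodD (z1 z2 : C R) : cmod (z1 + z2) <= cmod z1 + cmod z2.
Proof. by have := ler_normD z1 z2; rewrite lecE/= => /andP[]. Qed.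

Lemma cmod_subl (z1 z2 : C R) : cmod z1 - cmod z2 <= cmod (z1 - z2).
Proof. by rewrite lerBlDr (le_trans _ (cmodD _ _))// subrK. Qed.

Lemma cmod_conj (z : C R) : cmod (conjc z) = cmod z.
Proof. by rewrite !cmodE Re_conjc Im_conjc sqrrN. Qed.

Lemma cmod_real (x : R) : cmod (x%:C) = `|x|.
Proof. by rewrite cmodE/= expr0n/= addr0 sqrtr_sqr. Qed.

Lemma cmod_eq0 (z : C R) : (cmod z == 0) = (z == 0).
Proof.
apply/idP/eqP => [|->]; last by rewrite cmod_real normr0.
by move=> z0; apply/eqP; apply: contraTT z0 => /cmod_gt0/gt_eqF ->.
Qed.

End complex_topology.

Section complex_integral.
Context d (T : measurableType d) (R : realType).
Variable mu : {measure set T -> \bar R}.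
Implicit Types (D : set T) (F G : T -> C R).

Definition cint D F : C R :=
  (\int[mu]_(x in D) complex.Re (F x)) +i* (\int[mu]_(x in D) complex.Im (F x)).

Definition cmeasurable D F :=
  measurable_fun D (fun x => complex.Re (F x)) /\
  measurable_fun D (fun x => complex.Im (F x)).

Definition cintegrable D F :=
  mu.-integrable D (fun x => (complex.Re (F x))%:E) /\
  mu.-integrable D (fun x => (complex.Im (F x))%:E).

Lemma ReD (z1 z2 : C R) :
  complex.Re (z1 + z2) = complex.Re z1 + complex.Re z2.
Proof. by case: z1; case: z2. Qed.

Lemma ImD (z1 z2 : C R) :
  complex.Im (z1 + z2) = complex.Im z1 + complex.Im z2.
Proof. by case: z1; case: z2. Qed.

Lemma ReN (z : C R) : complex.Re (- z) = - complex.Re z.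
Proof. by case: z. Qed.

Lemma ImN (z : C R) : complex.Im (- z) = - complex.Im z.
Proof. by case: z. Qed.

Lemma ReM (z1 z2 : C R) : complex.Re (z1 * z2) =
  complex.Re z1 * complex.Re z2 - complex.Im z1 * complex.Im z2.
Proof. by case: z1; case: z2. Qed.

Lemma ImM (z1 z2 : C R) : complex.Im (z1 * z2) =
  complex.Re z1 * complex.Im z2 + complex.Im z1 * complex.Re z2.
Proof. by case: z1 => a b; case: z2 => a' b' /=. Qed.

Lemma complexP (z1 z2 : C R) : complex.Re z1 = complex.Re z2 ->
  complex.Im z1 = complex.Im z2 -> z1 = z2.
Proof. by case: z1 => a b; case: z2 => a' b' /= -> ->. Qed.

Lemma eq_cint D F G : {in D, F =1 G} -> cint D F = cint D G.
Proof. by move=> FG; congr (_ +i* _); apply: eq_Rintegral => x /FG ->. Qed.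

Lemma cintegrableD D F G : measurable D -> cintegrable D F ->
  cintegrable D G -> cintegrable D (fun x => F x + G x).
Proof.
move=> mD [F1 F2] [G1 G2]; split.
  under eq_fun do rewrite raddfD EFinD; exact: integrableD.
by under eq_fun do rewrite raddfD EFinD; exact: integrableD.
Qed.

Lemma cintegrableZl D (c : C R) F : measurable D -> cintegrable D F ->
  cintegrable D (fun x => c * F x).
Proof.
move=> mD [F1 F2]; split.
  under eq_fun do rewrite ReM EFinB !EFinM.
  by apply: integrableB => //; exact: integrableZl.
under eq_fun do rewrite ImM EFinD !EFinM.
by apply: integrableD => //; exact: integrableZl.
Qed.

Lemma cintegrableN D F : measurable D -> cintegrable D F ->
  cintegrable D (fun x => - F x).
Proof.
move=> mD iF; under eq_fun do rewrite -mulN1r; exact: cintegrableZl.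
Qed.

Lemma cintegrableB D F G : measurable D -> cintegrable D F ->
  cintegrable D G -> cintegrable D (fun x => F x - G x).
Proof.
by move=> mD iF iG; apply: cintegrableD => //; exact: cintegrableN.
Qed.

Lemma cintegrable_conj D F : measurable D -> cintegrable D F ->
  cintegrable D (fun x => conjc (F x)).
Proof.
move=> mD [F1 F2]; split; first by under eq_fun do rewrite Re_conjc.
by under eq_fun do rewrite Im_conjc EFinN; exact: integrableN.
Qed.

Lemma cintegrableS D D' F : measurable D -> measurable D' -> D' `<=` D ->
  cintegrable D F -> cintegrable D' F.
Proof.
by move=> mD mD' D'D [F1 F2]; split; [exact: integrableS F1|exact: integrableS F2].
Qed.

Lemma cintD D F G : measurable D -> cintegrable D F -> cintegrable D G ->
  cint D (fun x => F x + G x) = cint D F + cint D G.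
Proof.
move=> mD [F1 F2] [G1 G2]; apply: complexP; rewrite /= -RintegralD//.
  by apply: eq_Rintegral => x _; rewrite raddfD.
by apply: eq_Rintegral => x _; rewrite raddfD.
Qed.

Let integrable_scale D (k : R) (f : T -> R) : measurable D ->
  mu.-integrable D (fun x => (f x)%:E) ->
  mu.-integrable D (EFin \o (fun x => k * f x)).
Proof. by move=> mD /(integrableZl mD k). Qed.

Lemma cintZl D (c : C R) F : measurable D -> cintegrable D F ->
  cint D (fun x => c * F x) = c * cint D F.
Proof.
move=> mD [F1 F2]; apply: complexP.
  rewrite ReM/= -!RintegralZl// -RintegralB//; last 2 first.
    exact: integrable_scale.
    exact: integrable_scale.
  by apply: eq_Rintegral => x _; rewrite ReM.
rewrite ImM/= -!RintegralZl// -RintegralD//; last 2 first.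
  exact: integrable_scale.
  exact: integrable_scale.
by apply: eq_Rintegral => x _; rewrite ImM.
Qed.

Lemma cintN D F : measurable D -> cintegrable D F ->
  cint D (fun x => - F x) = - cint D F.
Proof.
move=> mD iF; rewrite -mulN1r -cintZl//.
by apply: eq_cint => x _; rewrite mulN1r.
Qed.

Lemma cintB D F G : measurable D -> cintegrable D F -> cintegrable D G ->
  cint D (fun x => F x - G x) = cint D F - cint D G.
Proof.
by move=> mD iF iG; rewrite -cintN// -cintD//; exact: cintegrableN.
Qed.

Lemma cint_conj D F : measurable D -> cintegrable D F ->
  cint D (fun x => conjc (F x)) = conjc (cint D F).
Proof.
move=> mD [F1 F2]; apply: complexP; rewrite ?Re_conjc ?Im_conjc/=.
  by apply: eq_Rintegral => x _; rewrite Re_conjc.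
rewrite -mulN1r -RintegralZl//.
by apply: eq_Rintegral => x _; rewrite Im_conjc mulN1r.
Qed.

Lemma cint_setU D D' F : measurable D -> measurable D' ->
  cintegrable (D `|` D') F -> [disjoint D & D'] ->
  cint (D `|` D') F = cint D F + cint D' F.
Proof.
move=> mD mD' [F1 F2] DD'; apply: complexP => /=.
  by rewrite Rintegral_setU.
by rewrite Rintegral_setU.
Qed.

Lemma cmod_cint_le D F (g : T -> R) : measurable D -> cintegrable D F ->
  mu.-integrable D (EFin \o g) -> (forall x, D x -> cmod (F x) <= g x) ->
  cmod (cint D F) <= 2 * \int[mu]_(x in D) g x.
Proof.
move=> mD [F1 F2] ig Fg; rewrite mulr_natl mulr2n.
apply: le_trans (cmod_le_ReIm _) _; apply: lerD => /=.
  apply: le_trans (le_normr_Rintegral mD F1) _; apply: le_Rintegral => //.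
    exact: integrable_norm F1.
  by move=> x Dx; apply: le_trans (Re_le_cmod _) (Fg _ Dx).
apply: le_trans (le_normr_Rintegral mD F2) _; apply: le_Rintegral => //.
  exact: integrable_norm F2.
by move=> x Dx; apply: le_trans (Im_le_cmod _) (Fg _ Dx).
Qed.

Lemma cintegrable_dominated D F (g : T -> R) : measurable D ->
  cmeasurable D F -> mu.-integrable D (EFin \o g) ->
  (forall x, D x -> cmod (F x) <= g x) -> cintegrable D F.
Proof.
move=> mD [F1 F2] ig Fg; split.
  apply: le_integrable ig => //; first exact/measurable_EFinP.
  move=> x Dx /=; rewrite lee_fin; apply: le_trans (Re_le_cmod _) _.
  by apply: le_trans (Fg _ Dx) (ler_norm _).
apply: le_integrable ig => //; first exact/measurable_EFinP.
move=> x Dx /=; rewrite lee_fin; apply: le_trans (Im_le_cmod _) _.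
by apply: le_trans (Fg _ Dx) (ler_norm _).
Qed.

End complex_integral.

Section plane_measurability.
Context (R : realType).

Lemma open_measurable_plane (U : set (R * R)) : open U -> measurable U.
Proof.
move=> oU.
pose B (q : rat * rat * nat) : set (R * R) :=
  `]ratr q.1.1 - q.2.+1%:R^-1, ratr q.1.1 + q.2.+1%:R^-1[ `*`
  `]ratr q.1.2 - q.2.+1%:R^-1, ratr q.1.2 + q.2.+1%:R^-1[.
have -> : U = \bigcup_(q in [set q | B q `<=` U]) B q.
  apply/seteqP; split=> [[x y] Uxy|p [q Bq]]; last exact: Bq.
  have /nbhs_ballP[e /= e0 eU] := open_nbhs_nbhs (conj oU Uxy).
  have [k _ ke] : exists2 k, True & k.+1%:R^-1 < e / 2.
    have e2 : 0 < e / 2 by rewrite divr_gt0.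
    have [k _ hk] := near_infty_natSinv_lt (PosNum e2).
    by exists k => //; exact: (hk k (leqnn k)).
  have : 0 < k.+1%:R^-1 :> R by rewrite invr_gt0.
  have BE qx qy : B (qx, qy, k) =
    `]ratr qx - k.+1%:R^-1, ratr qx + k.+1%:R^-1[ `*`
    `]ratr qy - k.+1%:R^-1, ratr qy + k.+1%:R^-1[ by [].
  move: BE ke; move: (k.+1%:R^-1) => h BE ke k0.
  have [qx hx] : exists q : rat, ratr q \in `]x - h, x + h[.
    by apply: rat_in_itvoo; lra.
  have [qy hy] : exists q : rat, ratr q \in `]y - h, y + h[.
    by apply: rat_in_itvoo; lra.
  move: hx hy; rewrite !in_itv/= => /andP[x1 x2] /andP[y1 y2].
  exists (qx, qy, k) => /=; rewrite BE; last by split; rewrite /= in_itv/=; lra.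
  move=> [u v] [/=]; rewrite !in_itv/= => /andP[a1 a2] /andP[b1 b2].
  by apply: eU; split; rewrite /ball/= ltr_norml; lra.
rewrite bigcup_mkcond; apply: countable_bigcupT_measurable => [|q].
  exact: countableP.
case: ifPn => // _; apply: measurableX; exact: measurable_itv.
Qed.

Lemma within_continuous_measurable_plane (D : set (R * R)) (f : R * R -> R) :
  measurable D -> {within D, continuous f} -> measurable_fun D f.
Proof.
move=> mD /continuousP cf; apply: (measurability _ (RGenOpens.measurableE R)).
move=> _ [_ [a [b ->] <-]].
have /open_subspaceP[V oV VD] := cf `]a, b[%classic (interval_open (a := BRight a) (b := BLeft b) isT isT).
rewrite setIC -VD; apply: measurableI => //; exact: open_measurable_plane.
Qed.

Lemma compact_bounded_cmod (T : topologicalType) (K : set T) (F : T -> C R) :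
  compact K -> {within K, continuous F} ->
  exists M, forall x, K x -> cmod (F x) <= M.
Proof.
move=> cK cF.
have cN : {within K, continuous (fun x => cmod (F x))}.
  move=> x; apply/cvgrPdist_lt => e e0.
  have /cvg_cmodP/(_ _ e0) := cF x; apply: filterS => y.
  apply: le_lt_trans; rewrite ler_norml; apply/andP; split.
    by rewrite lerNl opprB cmodB cmod_subl.
  exact: cmod_subl.
have /compact_bounded[M [_ /(_ (M + 1))]] := continuous_compact cN cK.
rewrite ltrDl ltr01 => /(_ isT) hM; exists (M + 1) => x Kx.
by apply: le_trans (ler_norm _) (hM _ _); exists x.
Qed.

Lemma within_continuous_Re (T : topologicalType) (K : set T) (F : T -> C R) :
  {within K, continuous F} -> {within K, continuous (fun x => complex.Re (F x))}.
Proof. by move=> cF x; have /cvg_complexP[] := cF x. Qed.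

Lemma within_continuous_Im (T : topologicalType) (K : set T) (F : T -> C R) :
  {within K, continuous F} -> {within K, continuous (fun x => complex.Im (F x))}.
Proof. by move=> cF x; have /cvg_complexP[] := cF x. Qed.

Notation mu := (@lebesgue_measure R).
Notation mu2 := (mu \x mu)%E.

Lemma continuous_cmeasurable (a b : R) (F : R -> C R) :
  {within `[a, b], continuous F} -> cmeasurable `[a, b] F.
Proof.
by move=> cF; split; apply: subspace_continuous_measurable_fun => //;
  [exact: within_continuous_Re|exact: within_continuous_Im].
Qed.

Lemma continuous_cmeasurable_plane D (F : R * R -> C R) : measurable D ->
  {within D, continuous F} -> cmeasurable D F.
Proof.
by move=> mD cF; split; apply: within_continuous_measurable_plane => //;
  [exact: within_continuous_Re|exact: within_continuous_Im].
Qed.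

Lemma continuous_cintegrable (a b : R) (F : R -> C R) :
  {within `[a, b], continuous F} -> cintegrable mu `[a, b] F.
Proof.
move=> cF; have [M FM] := compact_bounded_cmod (@segment_compact _ a b) cF.
apply: (cintegrable_dominated (g := cst M)) => //.
  exact: continuous_cmeasurable.
apply: measurable_bounded_integrable => //.
  by apply: compact_finite_measure; exact: segment_compact.
by exists `|M|; split; [exact: num_real|move=> y My x _; exact: ltW].
Qed.

Lemma rect_finite (a b c d : R) : (mu2 (`[a, b] `*` `[c, d]) < +oo)%E.
Proof.
have mI u v : measurable (`[u, v]%classic : set R) by exact: measurable_itv.
rewrite [ltLHS](product_measure1E mu mu (mI a b) (mI c d)).
have f u v : (mu `[u, v] < +oo)%E.
  by apply: compact_finite_measure; exact: segment_compact.
apply: lte_mul_pinfty; [exact: measure_ge0| |exact: f].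
by rewrite ge0_fin_numE; [exact: f|exact: measure_ge0].
Qed.

Lemma rect_compact (a b c d : R) : compact (`[a, b] `*` `[c, d] : set (R * R)).
Proof. by apply: compact_setX; exact: segment_compact. Qed.

Lemma measurable_rect (a b c d : R) :
  measurable (`[a, b] `*` `[c, d] : set (R * R)).
Proof. by apply: measurableX; exact: measurable_itv. Qed.

Lemma measurable_set1_plane (q : R * R) : measurable [set q].
Proof.
case: q => x0 y0; rewrite (_ : [set (x0, y0)] = [set x0] `*` [set y0]).
  by apply: measurableX; exact: measurable_set1.
by apply/seteqP; split=> [q ->//|[x y] [/= -> ->]].
Qed.

Lemma cmeasurable_punctured (D : set (R * R)) (q : R * R) (F : R * R -> C R) :
  measurable D -> cmeasurable (D `\` [set q]) F -> cmeasurable D F.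
Proof.
move=> mD; have m1 := measurable_set1_plane q.
have mU (h : R * R -> R) : measurable_fun (D `\` [set q]) h -> measurable_fun D h.
  move=> mh; apply: (@measurable_funS _ _ _ _ ((D `\` [set q]) `|` [set q])).
  - by apply: measurableU => //; exact: measurableD.
  - by move=> p Dp; have [->|pq] := eqVneq p q; [right|left; split=> //; exact/eqP].
  - apply/measurable_funU => //; first exact: measurableD.
    by split=> //; exact: measurable_fun_set1.
by move=> [mR mI]; split; exact: mU.
Qed.

Lemma bounded_rect_integrable (a b c d : R) (f : R * R -> R) M :
  measurable_fun (`[a, b] `*` `[c, d]) f ->
  (forall q, (`[a, b] `*` `[c, d]) q -> `|f q| <= M) ->
  mu2.-integrable (`[a, b] `*` `[c, d]) (EFin \o f).
Proof.
move=> mf fM; apply: measurable_bounded_integrable => //.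
- exact: measurable_rect.
- exact: rect_finite.
- by exists M; split; [exact: num_real|move=> y My x /fM/le_trans; apply; exact: ltW].
Qed.

Lemma continuous_cintegrable_rect (a b c d : R) (F : R * R -> C R) :
  {within `[a, b] `*` `[c, d], continuous F} ->
  cintegrable mu2 (`[a, b] `*` `[c, d]) F.
Proof.
move=> cF; have [M FM] := compact_bounded_cmod (@rect_compact a b c d) cF.
apply: (cintegrable_dominated (g := cst M)) => //.
- exact: measurable_rect.
- by apply: continuous_cmeasurable_plane => //; exact: measurable_rect.
- by apply: (@bounded_rect_integrable _ _ _ _ _ `|M|).
Qed.

Lemma mu2_line1 (x : R) : mu2 ([set x] `*` setT) = 0%E.
Proof.
transitivity (mu [set x] * mu setT)%E.
  exact: (product_measure1E mu mu (measurable_set1 x) measurableT).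
by rewrite (_ : mu [set x] = 0%E) ?mul0e//; exact: lebesgue_measure_set1.
Qed.

Lemma mu2_line2 (y : R) : mu2 (setT `*` [set y]) = 0%E.
Proof.
transitivity (mu setT * mu [set y])%E.
  exact: (product_measure1E mu mu measurableT (measurable_set1 y)).
by rewrite (_ : mu [set y] = 0%E) ?mule0//; exact: lebesgue_measure_set1.
Qed.

(* Removing part of the boundary of a rectangle changes no integral. *)
Lemma cint_rect_boundary (a b c d : R) (E : set (R * R)) (F : R * R -> C R) :
  measurable E -> `]a, b[ `*` `]c, d[ `<=` E -> E `<=` `[a, b] `*` `[c, d] ->
  cintegrable mu2 (`[a, b] `*` `[c, d]) F ->
  cint mu2 E F = cint mu2 (`[a, b] `*` `[c, d]) F.
Proof.
move=> mE oE Ec [F1 F2].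
pose N : set (R * R) := ([set a] `*` setT `|` [set b] `*` setT) `|`
  (setT `*` [set c] `|` setT `*` [set d]).
have m1 x : measurable ([set x] `*` setT : set (R * R)).
  by apply: measurableX => //; exact: measurable_set1.
have m2 x : measurable (setT `*` [set x] : set (R * R)).
  by apply: measurableX => //; exact: measurable_set1.
have mN : measurable N by apply: measurableU; exact: measurableU.
have N0 : mu2 N = 0%E.
  apply: (@null_set_setU _ _ _ mu2).
  - exact: (measurableU _ _ (m1 a) (m1 b)).
  - exact: (measurableU _ _ (m2 c) (m2 d)).
  - exact: (@null_set_setU _ _ _ mu2 _ _ (m1 a) (m1 b) (mu2_line1 a) (mu2_line1 b)).
  - exact: (@null_set_setU _ _ _ mu2 _ _ (m2 c) (m2 d) (mu2_line2 c) (mu2_line2 d)).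
have EN : E `\` N = (`[a, b] `*` `[c, d]) `\` N.
  apply/seteqP; split=> [q [Eq Nq]|q [Eq Nq]]; split=> //; first exact: Ec.
  apply: oE; move: Eq => [/=]; rewrite !in_itv/= => /andP[qa qb] /andP[qc qd].
  have [qa' qb' qc' qd'] : [/\ a != q.1, q.1 != b, c != q.2 & q.2 != d].
    split; apply/eqP => e; apply: Nq;
      [left; left|left; right|right; left|right; right]; split=> //=; congruence.
  by rewrite !lt_neqAle qa qb qc qd qa' qb' qc' qd'.
have key f : mu2.-integrable (`[a, b] `*` `[c, d]) (EFin \o f) ->
    (\int[mu2]_(q in E) f q = \int[mu2]_(q in `[a, b] `*` `[c, d]) f q)%R.
  move=> i_f; have mr := measurable_rect a b c d.
  have i_fE : mu2.-integrable E (EFin \o f) by exact: integrableS i_f.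
  congr fine; rewrite (@negligible_integral _ _ _ mu2 E N)//.
  by rewrite EN -(@negligible_integral _ _ _ mu2 _ N).
by congr (_ +i* _); exact: key.
Qed.

End plane_measurability.

Lemma within_continuous_comp_within (S T U : topologicalType) (A : set S)
    (B : set T) (g : S -> T) (f : T -> U) : (forall x, A x -> B (g x)) ->
  {within A, continuous g} -> {within B, continuous f} ->
  {within A, continuous (f \o g)}.
Proof.
move=> AB /subspace_continuousP cg /subspace_continuousP cf.
apply/subspace_continuousP => x Ax; apply: cvg_comp (cf _ (AB _ Ax)).
move=> P /=; rewrite /within/= => hP.
move: (cg x Ax _ hP); apply: (@filterS _ (nbhs x)) => y h Ay.
exact: h Ay (AB _ Ay).
Qed.

Lemma continuous_pairl (R : realType) (y : R) : continuous (fun x : R => (x, y)).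
Proof. by move=> x; exact: (cvg_pair cvg_id (cvg_cst y)). Qed.

Lemma continuous_pairr (R : realType) (x : R) : continuous (fun y : R => (x, y)).
Proof. by move=> y; exact: (cvg_pair (cvg_cst x) cvg_id). Qed.

Section complex_calculus.
Context (R : realType).
Implicit Types (F G : R -> C R) (x a b c d : R) (l : C R).
Notation mu := (@lebesgue_measure R).
Notation mu2 := (mu \x mu)%E.

Definition imag : C R := 0 +i* 1.

Definition is_cderive F x l :=
  is_derive x 1 (fun y => complex.Re (F y)) (complex.Re l) /\
  is_derive x 1 (fun y => complex.Im (F y)) (complex.Im l).

Lemma is_cderive_continuous F x l : is_cderive F x l -> {for x, continuous F}.
Proof.
move=> [[d1 _] [d2 _]]; apply/cvg_complexP.
by split; [move/derivable1_diffP/differentiable_continuous : d1|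
  move/derivable1_diffP/differentiable_continuous : d2].
Qed.

Lemma is_cderive_eq F x l l' : is_cderive F x l -> l = l' -> is_cderive F x l'.
Proof. by move=> + <-. Qed.

Lemma is_cderive_cst l x : is_cderive (cst l) x 0.
Proof. by split; exact: is_derive_cst. Qed.

Lemma is_cderiveD F G x l l' : is_cderive F x l -> is_cderive G x l' ->
  is_cderive (fun y => F y + G y) x (l + l').
Proof.
move=> [d1 d2] [e1 e2]; split; rewrite raddfD.
  by under eq_fun do rewrite raddfD; exact: is_deriveD.
by under eq_fun do rewrite raddfD; exact: is_deriveD.
Qed.

Lemma is_cderiveM F G x l l' : is_cderive F x l -> is_cderive G x l' ->
  is_cderive (fun y => F y * G y) x (l * G x + F x * l').
Proof.
move=> [d1 d2] [e1 e2]; split.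
  under eq_fun do rewrite ReM.
  apply: (@is_derive_eq _ _ _ _ _ _ _ _ (is_deriveB (is_deriveM d1 e1) (is_deriveM d2 e2))).
  by rewrite ReD !ReM /GRing.scale/=; ring.
under eq_fun do rewrite ImM.
apply: (@is_derive_eq _ _ _ _ _ _ _ _ (is_deriveD (is_deriveM d1 e2) (is_deriveM d2 e1))).
by rewrite ImD !ImM /GRing.scale/=; ring.
Qed.

Lemma is_cderiveV F x l : F x != 0 -> is_cderive F x l ->
  is_cderive (fun y => (F y)^-1) x (- l / F x ^+ 2).
Proof.
move=> F0 [d1 d2].
pose N y := complex.Re (F y) ^+ 2 + complex.Im (F y) ^+ 2.
have N0 : N x != 0.
  by rewrite /N -cmod_sqr sqrf_eq0 cmod_eq0.
have ReV z : complex.Re z^-1 =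
    complex.Re z * (complex.Re z ^+ 2 + complex.Im z ^+ 2)^-1.
  by case: z.
have ImV z : complex.Im z^-1 =
    - complex.Im z * (complex.Re z ^+ 2 + complex.Im z ^+ 2)^-1.
  by case: z => p q /=; rewrite mulNr.
have dN : is_derive x 1 N (2 * complex.Re (F x) * complex.Re l +
    2 * complex.Im (F x) * complex.Im l).
  apply: (@is_derive_eq _ _ _ _ _ _ _ _
    (is_deriveD (is_deriveX 2 d1) (is_deriveX 2 d2))).
  by rewrite /GRing.scale/=; ring.
have dV := is_deriveV N0 dN.
rewrite -exprVn expr2; split.
  under eq_fun do rewrite ReV.
  apply: (@is_derive_eq _ _ _ _ _ _ _ _ (is_deriveM d1 dV)).
  move: N0; rewrite !(ReM, ImM, ReV, ImV, ReN, ImN) /N /GRing.scale/= => N0.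
  field. exact: N0.
under eq_fun do rewrite ImV.
apply: (@is_derive_eq _ _ _ _ _ _ _ _ (is_deriveM (is_deriveN d2) dV)).
move: N0; rewrite !(ReM, ImM, ReV, ImV, ReN, ImN) /N /GRing.scale/= => N0.
rewrite (_ : (- _) x = - complex.Im (F x))//; field.
exact: N0.
Qed.

Lemma cFTC F (f : R -> C R) a b : a <= b ->
  (forall x, a <= x <= b -> is_cderive F x (f x)) ->
  {within `[a, b], continuous f} ->
  cint mu `[a, b] f = F b - F a.
Proof.
move=> ab dF cf; apply: complexP; rewrite ?ReD ?ImD ?ReN ?ImN /= /Rintegral.
  suff -> : (\int[mu]_(x in `[a, b]) (complex.Re (f x))%:E)%E =
    (complex.Re (F b) - complex.Re (F a))%:E by [].
  apply: (@FTC_is_derive R _ (fun x => complex.Re (F x))) => //.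
    by move=> x /dF[].
  exact: within_continuous_Re.
suff -> : (\int[mu]_(x in `[a, b]) (complex.Im (f x))%:E)%E =
  (complex.Im (F b) - complex.Im (F a))%:E by [].
apply: (@FTC_is_derive R _ (fun x => complex.Im (F x))) => //.
  by move=> x /dF[].
exact: within_continuous_Im.
Qed.

Lemma within_continuous_section1 (T : topologicalType) (F : R * R -> T) a b c d y :
  {within `[a, b] `*` `[c, d], continuous F} -> c <= y <= d ->
  {within `[a, b], continuous (fun x => F (x, y))}.
Proof.
move=> cF yI; apply: (within_continuous_comp_within (g := fun x => (x, y))) cF.
  by move=> x; split=> //=; rewrite in_itv.
exact/continuous_subspaceT/continuous_pairl.
Qed.

Lemma within_continuous_section2 (T : topologicalType) (F : R * R -> T) a b c d x :
  {within `[a, b] `*` `[c, d], continuous F} -> a <= x <= b ->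
  {within `[c, d], continuous (fun y => F (x, y))}.
Proof.
move=> cF xI; apply: (within_continuous_comp_within (g := fun y => (x, y))) cF.
  by move=> y; split=> //=; rewrite in_itv.
exact/continuous_subspaceT/continuous_pairr.
Qed.

Let continuous_fin_num (f : R -> R) a b : {within `[a, b], continuous f} ->
  (\int[mu]_(x in `[a, b]) (f x)%:E)%E \is a fin_num.
Proof.
move=> cf; apply: integrable_fin_num => //; apply: continuous_compact_integrable => //.
exact: segment_compact.
Qed.

Let fubini_rect (f : R * R -> R) a b c d :
  {within `[a, b] `*` `[c, d], continuous f} ->
  mu2.-integrable (`[a, b] `*` `[c, d]) (EFin \o f) ->
  \int[mu2]_(q in `[a, b] `*` `[c, d]) f q =
    \int[mu]_(y in `[c, d]) \int[mu]_(x in `[a, b]) f (x, y) /\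
  \int[mu2]_(q in `[a, b] `*` `[c, d]) f q =
    \int[mu]_(x in `[a, b]) \int[mu]_(y in `[c, d]) f (x, y).
Proof.
move=> cf i_f; have mr := measurable_rect a b c d.
pose g := (EFin \o f) \_ (`[a, b] `*` `[c, d]).
have i_g : mu2.-integrable setT g by rewrite /g -integrable_mkcond.
have gE x y : g (x, y) = if (x \in `[a, b]) && (y \in `[c, d]) then (f (x, y))%:E else 0%E.
  rewrite /g patchE; congr (if _ then _ else _).
  by apply/idP/andP; rewrite inE.
split; congr fine; rewrite integral_mkcond -/g.
  rewrite -(integral21_prod_meas1 i_g) [RHS]integral_mkcond.
  apply: eq_integral => y _; rewrite patchE mem_setE.
  case: ifPn => yI; last first.
    by rewrite /fubini_G integral0_eq// => x _; rewrite gE (negbTE yI) andbF.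
  rewrite /Rintegral fineK; last first.
    by apply: continuous_fin_num; apply: within_continuous_section1 cf _;
      rewrite in_itv in yI.
  rewrite /fubini_G [RHS]integral_mkcond; apply: eq_integral => x _.
  by rewrite gE yI andbT patchE mem_setE.
rewrite -(integral12_prod_meas1 i_g) [RHS]integral_mkcond.
apply: eq_integral => x _; rewrite patchE mem_setE.
case: ifPn => xI; last first.
  by rewrite /fubini_F integral0_eq// => y _; rewrite gE (negbTE xI).
rewrite /Rintegral fineK; last first.
  by apply: continuous_fin_num; apply: within_continuous_section2 cf _;
    rewrite in_itv in xI.
rewrite /fubini_F [RHS]integral_mkcond; apply: eq_integral => y _.
by rewrite gE xI/= patchE mem_setE.
Qed.

Lemma cint_rect_iter1 (F : R * R -> C R) a b c d :
  {within `[a, b] `*` `[c, d], continuous F} ->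
  cint mu2 (`[a, b] `*` `[c, d]) F =
  cint mu `[c, d] (fun y => cint mu `[a, b] (fun x => F (x, y))).
Proof.
move=> cF; have [F1 F2] := continuous_cintegrable_rect cF.
apply: complexP => /=.
  by have [-> _] := fubini_rect (within_continuous_Re cF) F1.
by have [-> _] := fubini_rect (within_continuous_Im cF) F2.
Qed.

Lemma cint_rect_iter2 (F : R * R -> C R) a b c d :
  {within `[a, b] `*` `[c, d], continuous F} ->
  cint mu2 (`[a, b] `*` `[c, d]) F =
  cint mu `[a, b] (fun x => cint mu `[c, d] (fun y => F (x, y))).
Proof.
move=> cF; have [F1 F2] := continuous_cintegrable_rect cF.
apply: complexP => /=.
  by have [_ ->] := fubini_rect (within_continuous_Re cF) F1.
by have [_ ->] := fubini_rect (within_continuous_Im cF) F2.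
Qed.

End complex_calculus.

Section green.
Context (R : realType).
Implicit Types (F G : R * R -> C R) (a b c d : R).
Notation mu := (@lebesgue_measure R).
Notation mu2 := (mu \x mu)%E.

Lemma within_continuousD (T : topologicalType) (A : set T) (F G : T -> C R) :
  {within A, continuous F} -> {within A, continuous G} ->
  {within A, continuous (fun x => F x + G x)}.
Proof. by move=> cF cG x; apply: cvgD; [exact: cF|exact: cG]. Qed.

Lemma within_continuousB (T : topologicalType) (A : set T) (F G : T -> C R) :
  {within A, continuous F} -> {within A, continuous G} ->
  {within A, continuous (fun x => F x - G x)}.
Proof. by move=> cF cG x; apply: cvgB; [exact: cF|exact: cG]. Qed.

Lemma within_continuousM (T : topologicalType) (A : set T) (F G : T -> C R) :
  {within A, continuous F} -> {within A, continuous G} ->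
  {within A, continuous (fun x => F x * G x)}.
Proof. by move=> cF cG x; apply: cvgM; [exact: cF|exact: cG]. Qed.

Lemma within_continuous_cst (T : topologicalType) (A : set T) (k : C R) :
  {within A, continuous (fun=> k)}.
Proof. by move=> x; exact: cvg_cst. Qed.

Lemma within_continuousV (T : topologicalType) (A : set T) (F : T -> C R) :
  (forall x, A x -> F x != 0) -> {within A, continuous F} ->
  {within A, continuous (fun x => (F x)^-1)}.
Proof.
move=> F0 /subspace_continuousP cF; apply/subspace_continuousP => x Ax.
by apply: cvgV; [exact: F0|exact: cF].
Qed.

Lemma realC_neq0 (x : R) : 0 < x -> x%:C != 0 :> C R.
Proof. by move=> x0; rewrite eq_complex/= eqxx andbT gt_eqF. Qed.

(* The integral of [F dtau / tau] along the boundary of the polar rectangle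
   [a <= rho <= b], [c <= t <= d]: dtau / tau = drho / rho + i dt. *)
Definition bdry a b c d F : C R :=
  cint mu `[a, b] (fun x => F (x, c) / x%:C) +
  imag R * cint mu `[c, d] (fun y => F (b, y)) -
  cint mu `[a, b] (fun x => F (x, d) / x%:C) -
  imag R * cint mu `[c, d] (fun y => F (a, y)).

Lemma green F Fr Ft a b c d : 0 < a -> a <= b -> c <= d ->
  let S := `[a, b] `*` `[c, d] in
  {within S, continuous F} -> {within S, continuous Fr} ->
  {within S, continuous Ft} ->
  (forall x y, a <= x <= b -> c <= y <= d ->
     is_cderive (fun x => F (x, y)) x (Fr (x, y)) /\
     is_cderive (fun y => F (x, y)) y (Ft (x, y))) ->
  bdry a b c d F = cint mu2 S (fun q => imag R * Fr q - Ft q / (q.1)%:C).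
Proof.
move=> a0 ab cd S cF cFr cFt dF; have mS : measurable S := measurable_rect a b c d.
have cr : {within S, continuous (fun q => (q.1%:C : C R)^-1)}.
  apply: within_continuousV.
    move=> q [/=]; rewrite in_itv/= => /andP[aq _] _.
    by apply: realC_neq0; exact: lt_le_trans aq.
  apply: continuous_subspaceT => q; apply: cvg_real_complex; exact: cvg_fst.
have cab : {within `[a, b], continuous (fun x => (x%:C : C R)^-1)}.
  apply: within_continuousV.
    move=> x /=; rewrite in_itv/= => /andP[ax _].
    by apply: realC_neq0; exact: lt_le_trans ax.
  by apply: continuous_subspaceT => x; apply: cvg_real_complex; exact: cvg_id.
have cFtr : {within S, continuous (fun q => Ft q / (q.1)%:C)}.
  exact: (within_continuousM cFt cr).
have aab : a <= a <= b by rewrite lexx.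
have bab : a <= b <= b by rewrite lexx ab.
have ccd : c <= c <= d by rewrite lexx.
have dcd : c <= d <= d by rewrite lexx cd.
rewrite cintB//; last 2 first.
- by apply: cintegrableZl; [exact: mS|exact: (continuous_cintegrable_rect cFr)].
- exact: (continuous_cintegrable_rect cFtr).
rewrite cintZl//; last exact: (continuous_cintegrable_rect cFr).
rewrite (cint_rect_iter1 cFr) (cint_rect_iter2 cFtr).
have -> : cint mu `[c, d] (fun y => cint mu `[a, b] (fun x => Fr (x, y))) =
    cint mu `[c, d] (fun y => F (b, y)) - cint mu `[c, d] (fun y => F (a, y)).
  rewrite -cintB//; last 2 first.
  - exact: continuous_cintegrable (within_continuous_section2 cF bab).
  - exact: continuous_cintegrable (within_continuous_section2 cF aab).
  apply: eq_cint => y; rewrite inE/= in_itv/= => yI.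
  apply: (cFTC (F := fun x => F (x, y)) ab) => [x xI|].
    by case: (dF x y xI yI).
  exact: within_continuous_section1 cFr yI.
have -> : cint mu `[a, b] (fun x => cint mu `[c, d]
      (fun y => Ft (x, y) / ((x, y).1)%:C)) =
    cint mu `[a, b] (fun x => F (x, d) / x%:C) -
    cint mu `[a, b] (fun x => F (x, c) / x%:C).
  rewrite -cintB//; last 2 first.
  - exact: continuous_cintegrable
      (within_continuousM (within_continuous_section1 cF dcd) cab).
  - exact: continuous_cintegrable
      (within_continuousM (within_continuous_section1 cF ccd) cab).
  apply: eq_cint => x; rewrite inE/= in_itv/= => xI.
  transitivity (x%:C^-1 * cint mu `[c, d] (fun y => Ft (x, y))).
    rewrite -cintZl//; first by apply: eq_cint => y _; rewrite mulrC.
    exact: continuous_cintegrable (within_continuous_section2 cFt xI).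
  rewrite (cFTC (F := fun y => F (x, y)) cd) => [|y yI|]; first by ring.
    by case: (dF x y xI yI).
  exact: within_continuous_section2 cFt xI.
rewrite /bdry; ring.
Qed.

End green.

Section chain_rule.
Context (R : realType).

Lemma MVT_ball (f f' : R -> R) (x0 e x : R) :
  (forall y, `|y - x0| < e -> is_derive y 1 f (f' y)) -> `|x - x0| < e ->
  exists2 y, `|y - x0| <= `|x - x0| & f x - f x0 = f' y * (x - x0).
Proof.
move=> df xe.
have cf a b : (forall y, a <= y <= b -> `|y - x0| < e) -> {within `[a, b], continuous f}.
  move=> H; apply: continuous_in_subspaceT => y; rewrite inE/= in_itv/= => yab.
  apply/differentiable_continuous/derivable1_diffP.
  have yd := df y (H _ yab); exact: ex_derive.
have [x0x|xx0] := leP x0 x.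
  have H y : x0 <= y <= x -> `|y - x0| < e.
    by move=> /andP[h1 h2]; apply: le_lt_trans xe; rewrite !ger0_norm ?lerD2r; lra.
  have dd y : y \in `]x0, x[ -> is_derive y 1 f (f' y).
    by rewrite in_itv/= => /andP[h1 h2]; apply: df; apply: H; rewrite !ltW.
  have [y yI E] := MVT_segment x0x dd (cf _ _ H).
  exists y => //; move: yI; rewrite in_itv/= => /andP[h1 h2].
  by rewrite !ger0_norm ?lerD2r ?subr_ge0.
have H y : x <= y <= x0 -> `|y - x0| < e.
  by move=> /andP[h1 h2]; apply: le_lt_trans xe; rewrite !ler0_norm; lra.
have dd y : y \in `]x, x0[ -> is_derive y 1 f (f' y).
  by rewrite in_itv/= => /andP[h1 h2]; apply: df; apply: H; rewrite !ltW.
have [y yI E] := MVT_segment (ltW xx0) dd (cf _ _ H).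
exists y; last by rewrite -opprB E; ring.
by move: yI; rewrite in_itv/= => /andP[h1 h2]; rewrite !ler0_norm; lra.
Qed.

Lemma is_deriveP (f : R -> R) (x l : R) : is_derive x 1 f l <->
  h^-1 *: (f (h *: 1 + x) - f x) @[h --> 0^'] --> l.
Proof.
split=> [[df <-]|dl]; first exact: df.
by apply: DeriveDef; [apply/cvg_ex; exists l|exact: cvg_lim dl].
Qed.

Lemma is_derive_comp2 (U Ux Uy : R * R -> R) (p : R * R) (g h : R -> R)
    (s g' h' : R) :
  nbhs p [set q : R * R | is_derive q.1 1 (fun x => U (x, q.2)) (Ux q) /\
                          is_derive q.2 1 (fun y => U (q.1, y)) (Uy q)] ->
  {for p, continuous Ux} -> {for p, continuous Uy} ->
  (g s, h s) = p -> is_derive s 1 g g' -> is_derive s 1 h h' ->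
  is_derive s 1 (fun x => U (g x, h x)) (Ux p * g' + Uy p * h').
Proof.
move=> /nbhs_ballP[e /= e0 dU] cUx cUy pE dg dh.
have gp : g s = p.1 by rewrite -pE.
have hp : h s = p.2 by rewrite -pE.
have cg : {for s, continuous g}.
  by apply/differentiable_continuous/derivable1_diffP; exact: ex_derive.
have ch : {for s, continuous h}.
  by apply/differentiable_continuous/derivable1_diffP; exact: ex_derive.
have ballE (q : R * R) e' : `|q.1 - p.1| < e' -> `|q.2 - p.2| < e' -> ball p e' q.
  by move=> h1 h2; split; rewrite /ball/= distrC.
pose A x := if g x == p.1 then Ux p
  else (U (g x, h x) - U (p.1, h x)) / (g x - p.1).
pose B x := if h x == p.2 then Uy p
  else (U (p.1, h x) - U p) / (h x - p.2).
have AE x : U (g x, h x) - U (p.1, h x) = A x * (g x - p.1).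
  rewrite /A; case: eqVneq => [->|gx]; first by rewrite !subrr mulr0.
  by rewrite divfK// subr_eq0.
have BE x : U (p.1, h x) - U p = B x * (h x - p.2).
  rewrite /B; case: eqVneq => [->|gx]; last by rewrite divfK// subr_eq0.
  by rewrite -surjective_pairing !subrr mulr0.
have near_g e1 : 0 < e1 -> \forall x \near s, `|g x - g s| < e1.
  move=> e10; near=> x; rewrite distrC; near: x.
  by move/cvgrPdist_lt : cg; apply.
have near_h e1 : 0 < e1 -> \forall x \near s, `|h x - h s| < e1.
  move=> e10; near=> x; rewrite distrC; near: x.
  by move/cvgrPdist_lt : ch; apply.
have A_cvg : A x @[x --> s] --> Ux p.
  apply/cvgrPdist_lt => e1 e10.
  have /nbhs_ballP[e2 /= e20 He2] : nbhs p [set q | `|Ux p - Ux q| < e1].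
    by move/cvgrPdist_lt : cUx; apply.
  pose e3 := Num.min e e2; have e30 : 0 < e3 by rewrite lt_min e0.
  near=> x; rewrite /A; case: eqVneq => [_|gx]; first by rewrite subrr normr0.
  have gx3 : `|g x - p.1| < e3.
    by near: x; rewrite -gp; exact: near_g.
  have hx3 : `|h x - p.2| < e3.
    by near: x; rewrite -hp; exact: near_h.
  have d1 y : `|y - p.1| < e3 -> is_derive y 1 (fun z => U (z, h x)) (Ux (y, h x)).
    move=> ye; have [] // := dU (y, h x); apply: ballE => /=.
      by apply: lt_le_trans ye _; rewrite ge_min lexx.
    by apply: lt_le_trans hx3 _; rewrite ge_min lexx.
  have [y ye ->] := MVT_ball d1 gx3.
  rewrite mulfK ?subr_eq0//; apply: He2; apply: ballE => /=.
    by apply: le_lt_trans ye _; apply: lt_le_trans gx3 _; rewrite ge_min lexx orbT.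
  by apply: lt_le_trans hx3 _; rewrite ge_min lexx orbT.
have B_cvg : B x @[x --> s] --> Uy p.
  apply/cvgrPdist_lt => e1 e10.
  have /nbhs_ballP[e2 /= e20 He2] : nbhs p [set q | `|Uy p - Uy q| < e1].
    by move/cvgrPdist_lt : cUy; apply.
  pose e3 := Num.min e e2; have e30 : 0 < e3 by rewrite lt_min e0.
  near=> x; rewrite /B; case: eqVneq => [_|gx]; first by rewrite subrr normr0.
  have hx3 : `|h x - p.2| < e3.
    by near: x; rewrite -hp; exact: near_h.
  have d1 y : `|y - p.2| < e3 -> is_derive y 1 (fun z => U (p.1, z)) (Uy (p.1, y)).
    move=> ye; have [] // := dU (p.1, y); apply: ballE => /=.
      by rewrite subrr normr0.
    by apply: lt_le_trans ye _; rewrite ge_min lexx.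
  have := MVT_ball d1 hx3; rewrite -surjective_pairing => -[y ye ->].
  rewrite mulfK ?subr_eq0//; apply: He2; apply: ballE => /=.
    by rewrite subrr normr0.
  by apply: le_lt_trans ye _; apply: lt_le_trans hx3 _; rewrite ge_min lexx orbT.
apply/is_deriveP.
have shift : (k *: 1 + s : R) @[k --> 0^'] --> s.
  apply/cvgrPdist_lt => e1 e10; near=> k.
  rewrite /GRing.scale/= mulr1 opprD addrCA subrr addr0 normrN.
  by near: k; exact: dnbhs0_lt.
rewrite (_ : (fun k => _) = (fun k => A (k *: 1 + s) * (k^-1 *: (g (k *: 1 + s) - g s))
   + B (k *: 1 + s) * (k^-1 *: (h (k *: 1 + s) - h s)))); last first.
  apply/funext => k; rewrite gp hp -surjective_pairing.
  have -> : U (g (k *: 1 + s), h (k *: 1 + s)) - U p =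
    (U (g (k *: 1 + s), h (k *: 1 + s)) - U (p.1, h (k *: 1 + s))) +
    (U (p.1, h (k *: 1 + s)) - U p) by rewrite addrA subrK.
  by rewrite AE BE /GRing.scale/=; ring.
apply: cvgD; apply: cvgM.
- exact: cvg_comp shift A_cvg.
- exact/is_deriveP.
- exact: cvg_comp shift B_cvg.
- exact/is_deriveP.
Unshelve. all: by end_near. Qed.

Lemma is_derive_translate (f : R -> R) (x l : R) :
  is_derive (0 : R) 1 (fun t : R => f (x + t)) l -> is_derive x 1 f l.
Proof.
move=> df; rewrite (_ : f = (fun t => f (x + t)) \o (fun y => y - x)); last first.
  by apply/funext => y /=; rewrite addrC subrK.
apply: is_derive_eq; last exact: mulr1.
apply: is_derive1_comp; first by rewrite subrr.
by apply: is_derive_eq; rewrite subr0.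
Qed.

Lemma near_sector (r1 r2 t1 t2 : R) (p : R * R) : 0 <= r1 -> 0 <= t1 ->
  sector_ring r1 r2 t1 t2 (p.1 +i* p.2) ->
  nbhs p [set q : R * R | sector_ring r1 r2 t1 t2 (q.1 +i* q.2)].
Proof.
move=> r10 t10 [/andP[mr1 mr2] /andP[at1 at2]].
pose m (q : R * R) := Num.sqrt (q.1 ^+ 2 + q.2 ^+ 2).
have cm : {for p, continuous m}.
  rewrite /m; apply: (continuous_comp (f := fun q : R * R => q.1 ^+ 2 + q.2 ^+ 2)).
    apply: cvgD; rewrite !expr2.
      by apply: cvgM; exact: cvg_fst.
    by apply: cvgM; exact: cvg_snd.
  exact: sqrt_continuous.
have m0 : 0 < m p by exact: le_lt_trans mr1.
have slit (q : R * R) : m q - q.1 != 0 ->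
    q.1 +i* q.2 != 0 :> C R /\ (q.2 == 0) && (0 <= q.1) = false.
  move=> mq; split.
    by apply: contra mq; rewrite eq_complex/= => /andP[/eqP q1 /eqP q2];
      rewrite /m q1 q2 expr0n/= addr0 sqrtr0 subr0.
  apply: contraNF mq => /andP[/eqP q2 q1].
  by rewrite /m q2 expr0n/= addr0 sqrtr_sqr ger0_norm ?subrr.
have pslit : m p - p.1 != 0.
  have p0 : p.1 +i* p.2 != 0 :> C R by rewrite -cmod_eq0 gt_eqF.
  move: at1; rewrite (carg_atan p0)/=; case: ifPn => [_|]; first by rewrite ltNge t10.
  move=> h _; apply: contra h; rewrite subr_eq0 => /eqP mp.
  have : m p ^+ 2 = p.1 ^+ 2 + p.2 ^+ 2 by rewrite sqr_sqrtr// addr_ge0// sqr_ge0.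
  rewrite mp -[X in X = _]addr0 => /addrI/esym/eqP; rewrite sqrf_eq0 => ->.
  by rewrite -mp ltW.
have cmp : {for p, continuous (fun q : R * R => m q - q.1)}.
  by apply: cvgB => //; exact: cvg_fst.
pose arg (q : R * R) := pi - 2 * atan (q.2 / (m q - q.1)).
have carg_p : {for p, continuous arg}.
  apply: cvgB; first exact: cvg_cst.
  apply: cvgM; first exact: cvg_cst.
  apply: (continuous_comp (f := fun q : R * R => q.2 / (m q - q.1))).
    by apply: cvgM; [exact: cvg_snd|exact: cvgV].
  exact: continuous_atan.
have argE (q : R * R) : m q - q.1 != 0 -> carg (q.1 +i* q.2) = arg q.
  by move=> /slit[q0 q1]; rewrite (carg_atan q0)/= q1.
rewrite argE// in at1 at2.
near=> q.
have hq : m q - q.1 != 0.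
  by near: q; exact: (@cvgr_neq0 R R^o _ (nbhs p) _ (fun q => m q - q.1) _ cmp pslit).
split; rewrite ?argE//; apply/andP; split; near: q.
- exact: (@cvgr_gt R _ (nbhs p) _ m _ cm).
- exact: (@cvgr_lt R _ (nbhs p) _ m _ cm).
- exact: (@cvgr_gt R _ (nbhs p) _ arg _ carg_p).
- exact: (@cvgr_lt R _ (nbhs p) _ arg _ carg_p).
Unshelve. all: by end_near. Qed.

Variables (D : set (C R)) (w : C R -> C R).
Hypotheses (w_C1 : C1_on D w).
Hypothesis (D_open : forall p : R * R, D (p.1 +i* p.2) ->
  nbhs p [set q : R * R | D (q.1 +i* q.2)]).

Let continuous_cart : continuous (fun q : R * R => (q.1 +i* q.2 : C R)).
Proof. by move=> q; apply: cvg_pair_complex; [exact: cvg_fst|exact: cvg_snd]. Qed.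

Let is_derive_cart (f : C R -> R) (q : R * R) (line := fun v (t : R) =>
    f ((q.1 +i* q.2) + t%:C * v)) :
  derivable (line 1) 0 1 -> derivable (line (0 +i* 1)) 0 1 ->
  is_derive q.1 1 (fun x => f (x +i* q.2)) (derive1 (line 1) 0) /\
  is_derive q.2 1 (fun y => f (q.1 +i* y)) (derive1 (line (0 +i* 1)) 0).
Proof.
move=> d1 d2; split; apply: is_derive_translate.
  rewrite (_ : (fun _ => _) = line 1); first by rewrite derive1E; exact: DeriveDef.
  apply/funext => t; congr f.
  by apply: complexP; rewrite ?ReD ?ImD ?ReM ?ImM/=; ring.
rewrite (_ : (fun _ => _) = line (0 +i* 1)).
  by rewrite derive1E; exact: DeriveDef.
apply/funext => t; congr f.
by apply: complexP; rewrite ?ReD ?ImD ?ReM ?ImM/=; ring.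
Qed.

Lemma is_cderive_path (g h : R -> R) (s g' h' : R) :
  D (g s +i* h s) -> is_derive s 1 g g' -> is_derive s 1 h h' ->
  is_cderive (fun x => w (g x +i* h x)) s
    (dx w (g s +i* h s) * g'%:C + dy w (g s +i* h s) * h'%:C).
Proof.
move=> Ds dg dh; have nD := @D_open (g s, h s) Ds.
have [_ _ cdx cdy] := w_C1 Ds.
have cdx' : {for (g s, h s), continuous (fun q : R * R => dx w (q.1 +i* q.2))}.
  apply: (@continuous_comp _ _ _ (fun q : R * R => q.1 +i* q.2 : C R) (dx w)).
    exact: continuous_cart.
  exact: cdx.
have cdy' : {for (g s, h s), continuous (fun q : R * R => dy w (q.1 +i* q.2))}.
  apply: (@continuous_comp _ _ _ (fun q : R * R => q.1 +i* q.2 : C R) (dy w)).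
    exact: continuous_cart.
  exact: cdy.
have [cx1 cx2] := (iffLR (cvg_complexP _ _ _) cdx').
have [cy1 cy2] := (iffLR (cvg_complexP _ _ _) cdy').
split; rewrite ?ReD ?ImD !(ReM, ImM)/= !(mulr0, subr0, add0r).
- apply: (@is_derive_comp2 (fun q => complex.Re (w (q.1 +i* q.2)))
    (fun q => complex.Re (dx w (q.1 +i* q.2)))
    (fun q => complex.Re (dy w (q.1 +i* q.2))) (g s, h s)) => //.
  apply: filterS nD => q /= Dq; have [[d1 _] [d2 _] _ _] := w_C1 Dq.
  exact: (is_derive_cart (f := fun z => complex.Re (w z)) d1 d2).
- apply: (@is_derive_comp2 (fun q => complex.Im (w (q.1 +i* q.2)))
    (fun q => complex.Im (dx w (q.1 +i* q.2)))
    (fun q => complex.Im (dy w (q.1 +i* q.2))) (g s, h s)) => //.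
  apply: filterS nD => q /= Dq; have [[_ d1] [_ d2] _ _] := w_C1 Dq.
  exact: (is_derive_cart (f := fun z => complex.Im (w z)) d1 d2).
Qed.

Lemma is_cderive_polar_rho (rho t : R) : D (polar rho t) ->
  is_cderive (fun x => w (polar x t)) rho
    (dx w (polar rho t) * (cos t)%:C + dy w (polar rho t) * (sin t)%:C).
Proof.
move=> Dz; apply: (is_cderive_path (g := fun x => x * cos t)
  (h := fun x => x * sin t)) => //.
  by apply: is_derive_eq; rewrite /GRing.scale/=; ring.
by apply: is_derive_eq; rewrite /GRing.scale/=; ring.
Qed.

Lemma is_cderive_polar_t (rho t : R) : D (polar rho t) ->
  is_cderive (fun y => w (polar rho y)) t
    (dx w (polar rho t) * (- (rho * sin t))%:C +
     dy w (polar rho t) * (rho * cos t)%:C).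
Proof.
move=> Dz; apply: (is_cderive_path (g := fun y => rho * cos y)
  (h := fun y => rho * sin y)) => //.
  by apply: is_derive_eq; rewrite /GRing.scale/=; ring.
Qed.

End chain_rule.

Section dbar_pairs.
Context (R : realType).
Implicit Types (F G W g k : R * R -> C R) (a b c d : R) (O : set (R * R)).
Notation mu := (@lebesgue_measure R).
Notation mu2 := (mu \x mu)%E.

Lemma continuous_atD (T : topologicalType) (x : T) (f h : T -> C R) :
  {for x, continuous f} -> {for x, continuous h} ->
  {for x, continuous (fun y => f y + h y)}.
Proof. by move=> cf ch; apply: cvgD; [exact: cf|exact: ch]. Qed.

Lemma continuous_atM (T : topologicalType) (x : T) (f h : T -> C R) :
  {for x, continuous f} -> {for x, continuous h} ->
  {for x, continuous (fun y => f y * h y)}.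
Proof. by move=> cf ch; apply: cvgM; [exact: cf|exact: ch]. Qed.

(* In the coordinates (rho, t), [W] is C^1 on [O] and
   e^(it) d W / d conj(tau) = g, where tau = rho e^(it). *)
Definition dbar_pair O W g := exists Wr Wt : R * R -> C R, forall q, O q ->
  [/\ {for q, continuous W}, {for q, continuous g},
      {for q, continuous Wr} & {for q, continuous Wt}] /\
  [/\ is_cderive (fun x => W (x, q.2)) q.1 (Wr q),
      is_cderive (fun y => W (q.1, y)) q.2 (Wt q) &
      imag R * Wr q - Wt q / (q.1)%:C = 2 * imag R * g q].

Lemma dbar_pairS O O' W g : O' `<=` O -> dbar_pair O W g -> dbar_pair O' W g.
Proof. by move=> O'O [Wr [Wt H]]; exists Wr, Wt => q /O'O/H. Qed.

Lemma dbar_pair_cst O (z : C R) : dbar_pair O (fun=> z) (fun=> 0).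
Proof.
exists (fun=> 0), (fun=> 0) => q _; split.
  by split; exact: cvg_cst.
split; [exact: is_cderive_cst|exact: is_cderive_cst|by rewrite !mulr0 mul0r subr0].
Qed.

Lemma dbar_pairM O W g k : dbar_pair O W g -> dbar_pair O k (fun=> 0) ->
  dbar_pair O (fun q => W q * k q) (fun q => k q * g q).
Proof.
move=> [Wr [Wt HW]] [kr [kt Hk]].
exists (fun q => Wr q * k q + W q * kr q), (fun q => Wt q * k q + W q * kt q).
move=> q Oq; have [[cW cg cWr cWt] [dWr dWt Wg]] := HW q Oq.
have [[ck _ ckr ckt] [dkr dkt k0]] := Hk q Oq.
split; split.
- exact: continuous_atM cW ck.
- exact: continuous_atM ck cg.
- exact: continuous_atD (continuous_atM cWr ck) (continuous_atM cW ckr).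
- exact: continuous_atD (continuous_atM cWt ck) (continuous_atM cW ckt).
- by apply: (is_cderive_eq (is_cderiveM dWr dkr)); rewrite -surjective_pairing.
- by apply: (is_cderive_eq (is_cderiveM dWt dkt)); rewrite -surjective_pairing.
- transitivity ((imag R * Wr q - Wt q / q.1%:C) * k q +
    W q * (imag R * kr q - kt q / q.1%:C)); first by ring.
  by rewrite Wg k0; ring.
Qed.

Lemma dbar_pairB_cst O W g z : dbar_pair O W g -> dbar_pair O (fun q => W q - z) g.
Proof.
move=> [Wr [Wt HW]]; exists Wr, Wt => q Oq.
have [[cW cg cWr cWt] [dWr dWt Wg]] := HW q Oq.
have cz : {for q, continuous (fun=> - z : C R)} by exact: cvg_cst.
split; split; [exact: continuous_atD cW cz|exact: cg|exact: cWr|exact: cWt| | |].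
- exact: is_cderive_eq (is_cderiveD dWr (is_cderive_cst (- z) _)) (addr0 _).
- exact: is_cderive_eq (is_cderiveD dWt (is_cderive_cst (- z) _)) (addr0 _).
- exact: Wg.
Qed.

Lemma continuous_at_within (T U : topologicalType) (A : set T) (f : T -> U) :
  (forall x, A x -> {for x, continuous f}) -> {within A, continuous f}.
Proof. by move=> H; apply: continuous_in_subspaceT => x; rewrite inE; exact: H. Qed.

Lemma bdry_dbar F G a b c d : 0 < a -> a <= b -> c <= d ->
  dbar_pair (`[a, b] `*` `[c, d]) F G ->
  bdry a b c d F = 2 * imag R * cint mu2 (`[a, b] `*` `[c, d]) G.
Proof.
move=> a0 ab cd [Fr [Ft H]].
have cc (K : R * R -> C R) : (forall q, (`[a, b] `*` `[c, d]) q -> {for q, continuous K}) ->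
    {within `[a, b] `*` `[c, d], continuous K} by exact: continuous_at_within.
have inS x y : a <= x <= b -> c <= y <= d -> (`[a, b] `*` `[c, d]) (x, y).
  by move=> xI yI; split; rewrite /= in_itv.
have cF : {within `[a, b] `*` `[c, d], continuous F}.
  by apply: cc => q /H[[h _ _ _] _]; exact: h.
have cG : {within `[a, b] `*` `[c, d], continuous G}.
  by apply: cc => q /H[[_ h _ _] _]; exact: h.
have cFr : {within `[a, b] `*` `[c, d], continuous Fr}.
  by apply: cc => q /H[[_ _ h _] _]; exact: h.
have cFt : {within `[a, b] `*` `[c, d], continuous Ft}.
  by apply: cc => q /H[[_ _ _ h] _]; exact: h.
rewrite (green a0 ab cd cF cFr cFt); last first.
  by move=> x y xI yI; have [_ [h1 h2 _]] := H _ (inS x y xI yI); split; [exact: h1|exact: h2].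
rewrite -cintZl; [|exact: measurable_rect|exact: continuous_cintegrable_rect cG].
by apply: eq_cint => q; rewrite inE => /H[_ [_ _ h]]; exact: h.
Qed.

Definition defect a b c d F G : C R :=
  bdry a b c d F - 2 * imag R * cint mu2 (`[a, b] `*` `[c, d]) G.

Lemma defect0 F G a b c d : 0 < a -> a <= b -> c <= d ->
  dbar_pair (`[a, b] `*` `[c, d]) F G -> defect a b c d F G = 0.
Proof. by move=> a0 ab cd H; rewrite /defect (bdry_dbar a0 ab cd H) subrr. Qed.

Lemma cint_itv_split (F : R -> C R) a m b : a <= m <= b ->
  cintegrable mu `[a, b] F ->
  cint mu `[a, b] F = cint mu `[a, m] F + cint mu `[m, b] F.
Proof.
move=> /andP[am mb] [F1 F2].
have key f : mu.-integrable `[a, b] (EFin \o f) ->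
    \int[mu]_(x in `[a, b]) f x =
    \int[mu]_(x in `[a, m]) f x + \int[mu]_(x in `[m, b]) f x.
  move=> i_f; rewrite -(@Rintegral_itv_obnd_cbnd _ m); last first.
    apply: integrableS i_f => //; apply: subset_itvr; rewrite bnd_simp//.
  by rewrite -(Rintegral_itvB i_f) ?bnd_simp// addrC subrK.
by apply: complexP => /=; exact: key.
Qed.

Lemma rect_splitr a m b c d : a <= m <= b ->
  `[a, b] `*` `[c, d] = (`[a, m] `*` `[c, d]) `|` (`]m, b] `*` `[c, d]) :> set (R * R).
Proof.
move=> /andP[am mb]; apply/seteqP; split=> [q [/=]|q [] [/=]];
  rewrite !in_itv/= => /andP[q1 q2] q3.
- by have [qm|mq] := leP q.1 m; [left|right]; split; rewrite //= ?in_itv/= ?q1 ?q2 ?mq ?qm.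
- by split; rewrite //= ?in_itv/= q1 (le_trans q2 mb).
- by split; rewrite //= ?in_itv/= q2 (le_trans am (ltW q1)).
Qed.

Lemma rect_splitt a b c m d : c <= m <= d ->
  `[a, b] `*` `[c, d] = (`[a, b] `*` `[c, m]) `|` (`[a, b] `*` `]m, d]) :> set (R * R).
Proof.
move=> /andP[am mb]; apply/seteqP; split=> [q [/=]|q [] [/=]];
  rewrite !in_itv/= => q3 /andP[q1 q2].
- by have [qm|mq] := leP q.2 m; [left|right]; split; rewrite //= ?in_itv/= ?q1 ?q2 ?mq ?qm.
- by split; rewrite //= ?in_itv/= q1 (le_trans q2 mb).
- by split; rewrite //= ?in_itv/= q2 (le_trans am (ltW q1)).
Qed.

Lemma cint_rect_splitr G a m b c d : a <= m <= b ->
  cintegrable mu2 (`[a, b] `*` `[c, d]) G ->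
  cint mu2 (`[a, b] `*` `[c, d]) G =
  cint mu2 (`[a, m] `*` `[c, d]) G + cint mu2 (`[m, b] `*` `[c, d]) G.
Proof.
move=> amb iG; have m1 : measurable (`[a, m] `*` `[c, d] : set (R * R)).
  exact: measurable_rect.
have m2 : measurable (`]m, b] `*` `[c, d] : set (R * R)).
  by apply: measurableX; exact: measurable_itv.
have S2 : `[m, b] `*` `[c, d] `<=` `[a, b] `*` `[c, d].
  move=> q [/=]; rewrite !in_itv/= => /andP[q1 q2] q3; split; rewrite //= ?in_itv/=.
  by rewrite q2 andbT; case/andP: amb => /le_trans -> .
rewrite {1}(rect_splitr c d amb) cint_setU//; last 2 first.
- by rewrite -(rect_splitr c d amb).
- rewrite disj_set2E; apply/eqP; rewrite -subset0 => q [[/=]].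
  by rewrite /= !in_itv/= => /andP[_ q1] _ [/andP[]]; rewrite ltNge q1.
congr (_ + _); apply: cint_rect_boundary => //.
- move=> q [/=]; rewrite !in_itv/= => /andP[q1 q2] /andP[q3 q4].
  by split; rewrite /= ?in_itv/= ?q1 ?(ltW q2)// ?(ltW q3) ?(ltW q4).
- move=> q [/=]; rewrite !in_itv/= => /andP[q1 q2] q3.
  by split; rewrite /= ?in_itv//= (ltW q1).
- by apply: cintegrableS iG => //; exact: measurable_rect.
Qed.

Lemma cint_rect_splitt G a b c m d : c <= m <= d ->
  cintegrable mu2 (`[a, b] `*` `[c, d]) G ->
  cint mu2 (`[a, b] `*` `[c, d]) G =
  cint mu2 (`[a, b] `*` `[c, m]) G + cint mu2 (`[a, b] `*` `[m, d]) G.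
Proof.
move=> amb iG; have m1 : measurable (`[a, b] `*` `[c, m] : set (R * R)).
  exact: measurable_rect.
have m2 : measurable (`[a, b] `*` `]m, d] : set (R * R)).
  by apply: measurableX; exact: measurable_itv.
have S2 : `[a, b] `*` `[m, d] `<=` `[a, b] `*` `[c, d].
  move=> q [/=]; rewrite !in_itv/= => q3 /andP[q1 q2]; split; rewrite //= ?in_itv/=.
  by rewrite q2 andbT; case/andP: amb => /le_trans -> .
rewrite {1}(rect_splitt a b amb) cint_setU//; last 2 first.
- by rewrite -(rect_splitt a b amb).
- rewrite disj_set2E; apply/eqP; rewrite -subset0 => q [[/=]].
  by rewrite /= !in_itv/= => _ /andP[_ q1] [_ /andP[]]; rewrite ltNge q1.
congr (_ + _); apply: cint_rect_boundary => //.
- move=> q [/=]; rewrite !in_itv/= => /andP[q3 q4] /andP[q1 q2].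
  by split; rewrite /= ?in_itv/= ?q1 ?(ltW q2)// ?(ltW q3) ?(ltW q4).
- move=> q [/=]; rewrite !in_itv/= => q3 /andP[q1 q2].
  by split; rewrite /= ?in_itv//= (ltW q1).
- by apply: cintegrableS iG => //; exact: measurable_rect.
Qed.

End dbar_pairs.

Section hole.
Context (R : realType).
Implicit Types (F G : R * R -> C R) (a b c d : R).
Notation mu := (@lebesgue_measure R).
Notation mu2 := (mu \x mu)%E.

Lemma defect_splitt F G a b c m d : c <= m <= d ->
  cintegrable mu `[c, d] (fun y => F (a, y)) ->
  cintegrable mu `[c, d] (fun y => F (b, y)) ->
  cintegrable mu2 (`[a, b] `*` `[c, d]) G ->
  defect a b c d F G = defect a b c m F G + defect a b m d F G.
Proof.
move=> cmd iFa iFb iG; rewrite /defect /bdry (cint_rect_splitt cmd iG).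
by rewrite (cint_itv_split cmd iFa) (cint_itv_split cmd iFb); ring.
Qed.

Lemma defect_splitr F G a m b c d : a <= m <= b ->
  cintegrable mu `[a, b] (fun x => F (x, c) / x%:C) ->
  cintegrable mu `[a, b] (fun x => F (x, d) / x%:C) ->
  cintegrable mu2 (`[a, b] `*` `[c, d]) G ->
  defect a b c d F G = defect a m c d F G + defect m b c d F G.
Proof.
move=> amb iFc iFd iG; rewrite /defect /bdry (cint_rect_splitr amb iG).
by rewrite (cint_itv_split amb iFc) (cint_itv_split amb iFd); ring.
Qed.

Lemma cintegrable_vertical F a b x : a <= b ->
  (forall y, a <= y <= b -> {for (x, y), continuous F}) ->
  cintegrable mu `[a, b] (fun y => F (x, y)).
Proof.
move=> ab cF; apply: continuous_cintegrable; apply: continuous_at_within => y.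
rewrite /= in_itv/= => /cF cFy.
apply: (@continuous_comp _ _ _ (fun y : R => (x, y)) F) cFy.
exact: continuous_pairr.
Qed.

Lemma cintegrable_horizontal F a b y : 0 < a -> a <= b ->
  (forall x, a <= x <= b -> {for (x, y), continuous F}) ->
  cintegrable mu `[a, b] (fun x => F (x, y) / x%:C).
Proof.
move=> a0 ab cF; apply: continuous_cintegrable; apply: continuous_at_within => x.
rewrite /= in_itv/= => xab; apply: continuous_atM.
  apply: (@continuous_comp _ _ _ (fun x : R => (x, y)) F _ _ (cF x xab)).
  exact: continuous_pairl.
apply: cvgV; last by apply: cvg_real_complex; exact: cvg_id.
by apply: realC_neq0; case/andP: xab => ax _; exact: lt_le_trans ax.
Qed.

Lemma defect_hole F G a b c d (q0 : R * R) x1 x2 y1 y2 : 0 < a ->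
  a <= x1 -> x1 < q0.1 -> q0.1 < x2 -> x2 <= b ->
  c <= y1 -> y1 < q0.2 -> q0.2 < y2 -> y2 <= d ->
  dbar_pair (`[a, b] `*` `[c, d] `\ q0) F G ->
  cintegrable mu2 (`[a, b] `*` `[c, d]) G ->
  defect a b c d F G = defect x1 x2 y1 y2 F G.
Proof.
case: q0 => x0 y0 /= a0 ax1 x10 x02 x2b cy1 y10 y02 y2d HF iG.
have cF x y : a <= x <= b -> c <= y <= d -> (x != x0) || (y != y0) ->
    {for (x, y), continuous F}.
  move=> xI yI xy; case: HF => [Fr [Ft H]].
  have Sxy : (`[a, b] `*` `[c, d] `\ (x0, y0)) (x, y).
    split; first by split; rewrite /= ?in_itv.
    by move=> /= [ex ey]; move: xy; rewrite ex ey !eqxx.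
  by have [[h _ _ _] _] := H (x, y) Sxy; exact: h.
have vert x c' d' : a <= x <= b -> x != x0 -> c <= c' -> c' <= d' -> d' <= d ->
    cintegrable mu `[c', d'] (fun y => F (x, y)).
  move=> xI xx0 cc' cd' dd'; apply: cintegrable_vertical => // y /andP[h1 h2].
  by apply: cF; rewrite ?xx0//; apply/andP; split; lra.
have hor y a' b' : c <= y <= d -> y != y0 -> a <= a' -> a' <= b' -> b' <= b ->
    cintegrable mu `[a', b'] (fun x => F (x, y) / x%:C).
  move=> yI yy0 aa' ab' bb'; apply: cintegrable_horizontal => //; first by lra.
  move=> x /andP[h1 h2].
  by apply: cF; rewrite ?yy0 ?orbT//; apply/andP; split; lra.
have iG' a' b' c' d' : a <= a' -> b' <= b -> c <= c' -> d' <= d ->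
    cintegrable mu2 (`[a', b'] `*` `[c', d']) G.
  move=> ha hb hc hd; apply: cintegrableS iG; try exact: measurable_rect.
  move=> q [/=]; rewrite !in_itv/= => /andP[h1 h2] /andP[h3 h4].
  by split; rewrite /= ?in_itv/=; apply/andP; split; lra.
have D0 a' b' c' d' : a <= a' -> a' <= b' -> b' <= b -> c <= c' -> c' <= d' ->
    d' <= d -> (x0 < a') || (b' < x0) || (y0 < c') || (d' < y0) ->
    defect a' b' c' d' F G = 0.
  move=> h1 h2 h3 h4 h5 h6 out; apply: defect0 => //; first by lra.
  apply: dbar_pairS HF => q [/=]; rewrite !in_itv/= => /andP[g1 g2] /andP[g3 g4].
  split; first by split; rewrite /= ?in_itv/=; apply/andP; split; lra.
  by move=> /= qe; move: g1 g2 g3 g4; rewrite qe/=; lra.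
rewrite (@defect_splitt _ _ a b c y1 d); first last.
- exact: iG.
- by apply: vert; rewrite ?lexx//; [lra|rewrite gt_eqF//; lra|lra].
- by apply: vert; rewrite ?lexx//; [lra|rewrite lt_eqF//; lra|lra].
- by apply/andP; split; lra.
have -> : defect a b c y1 F G = 0 by apply: D0; lra.
rewrite add0r.
rewrite (@defect_splitt _ _ a b y1 y2 d); first last.
- by apply: iG'; lra.
- by apply: vert; rewrite ?lexx//; [lra|rewrite gt_eqF//; lra|lra].
- by apply: vert; rewrite ?lexx//; [lra|rewrite lt_eqF//; lra|lra].
- by apply/andP; split; lra.
have -> : defect a b y2 d F G = 0 by apply: D0; lra.
rewrite addr0.
rewrite (@defect_splitr _ _ a x1 b y1 y2); first last.
- by apply: iG'; lra.
- by apply: hor; rewrite ?lexx//; [lra|rewrite gt_eqF//; lra|lra].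
- by apply: hor; rewrite ?lexx//; [lra|rewrite lt_eqF//; lra|lra].
- by apply/andP; split; lra.
have -> : defect a x1 y1 y2 F G = 0 by apply: D0; lra.
rewrite add0r.
rewrite (@defect_splitr _ _ x1 x2 b y1 y2); first last.
- by apply: iG'; lra.
- by apply: hor; rewrite ?lexx//; [lra|rewrite gt_eqF//; lra|lra].
- by apply: hor; rewrite ?lexx//; [lra|rewrite lt_eqF//; lra|lra].
- by apply/andP; split; lra.
have -> : defect x2 b y1 y2 F G = 0 by apply: D0; lra.
by rewrite addr0.
Qed.

End hole.

Section disc_integral.
Context (R : realType).
Notation mu := (@lebesgue_measure R).
Notation mu2 := (mu \x mu)%E.

Definition dist2 (q q0 : R * R) : R :=
  Num.sqrt ((q.1 - q0.1) ^+ 2 + (q.2 - q0.2) ^+ 2).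

Local Open Scope ereal_scope.

Lemma ge0_integral_reflect2 (q0 : R * R) (G : R * R -> \bar R) :
  measurable_fun setT G -> (forall q, 0 <= G q) ->
  \int[mu2]_q G q = \int[mu2]_q G (q0.1 - q.1, q0.2 - q.2)%R.
Proof.
move=> mG G0.
have mG' : measurable_fun setT (fun q : R * R => G (q0.1 - q.1, q0.2 - q.2)%R).
  apply: (measurableT_comp mG); apply: measurable_fun_pair; exact: measurable_funB.
rewrite (fubini_tonelli1 (m1 := mu) (m2 := mu) G)//.
rewrite (fubini_tonelli1 (m1 := mu) (m2 := mu) _ mG')//.
rewrite (ge0_integral_reflect q0.1); last 2 first.
- exact: (measurable_fun_fubini_tonelli_F (m2 := mu) G).
- by move=> x; apply: integral_ge0.
apply: eq_integral => x _; rewrite /fubini_F (ge0_integral_reflect q0.2)//.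
exact: measurableT_comp.
Qed.

Lemma integral_disc (q0 : R * R) (e : R) : (0 < e)%R ->
  \int[mu2]_(q in [set q | (dist2 q q0 < e)%R]) ((dist2 q q0)^-1)%:E =
  (e * (2 * pi))%:E.
Proof.
move=> e0; have pi2 := pi_gt0 R.
pose N (q : R * R) := Num.sqrt (q.1 ^+ 2 + q.2 ^+ 2).
have mN : measurable_fun setT N.
  apply: (@measurableT_comp _ _ _ _ _ _ (@Num.sqrt R : R -> R) _
    (fun p : R * R => p.1 ^+ 2 + p.2 ^+ 2)%R).
    by apply: continuous_measurable_fun; exact: sqrt_continuous.
  by apply: measurable_funD; exact: measurable_funX.
pose H (q : R * R) := ((N q)^-1 * (N q < e)%R%:R)%:E : \bar R.
have mH : measurable_fun setT H.
  apply/measurable_EFinP; apply: measurable_funM.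
    apply: (@measurableT_comp _ _ _ _ _ _ (@GRing.inv R : R -> R) _ N) => //.
    exact: measurable_inv.
  rewrite (_ : (fun q => _) = (fun q => if (N q < e)%R then 1%R else 0%R)).
    by apply: measurable_fun_ifT => //; exact: measurable_fun_ltr.
  by apply/funext => q; case: ifPn.
have H0 q : 0 <= H q by rewrite lee_fin mulr_ge0// invr_ge0 sqrtr_ge0.
transitivity (\int[mu2]_q H q).
  rewrite (ge0_integral_reflect2 q0 mH)// integral_mkcond.
  apply: eq_integral => q _; rewrite patchE /H.
  have -> : N (q0.1 - q.1, q0.2 - q.2)%R = dist2 q q0.
    by rewrite /N /dist2/= -(sqrrN (q0.1 - q.1)) -(sqrrN (q0.2 - q.2)) !opprB.
  case: ifPn; rewrite ?inE ?notin_setE/= => qe; first by rewrite qe mulr1.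
  by move/negP/negbTE : qe => ->; rewrite mulr0.
rewrite (polar_integral mH H0).
transitivity (\int[mu2]_(q in `]0%R, e[ `*` `]0%R, (2 * pi)%R[) (cst 1 q)).
  rewrite integral_mkcond [RHS]integral_mkcond; apply: eq_integral => q _.
  rewrite !patchE; case: ifPn; rewrite ?inE ?notin_setE.
    move=> [/=]; rewrite !in_itv/= andbT => q1 q2.
    have NE : N (q.1 * cos q.2, q.1 * sin q.2)%R = q.1.
      by rewrite /N/= !exprMn -mulrDr cos2Dsin2 mulr1 sqrtr_sqr gtr0_norm.
    rewrite /H NE; have [qe|eq] := ltP q.1 e.
      rewrite mem_set/=; last by split; rewrite /= ?in_itv/= ?q1.
      by rewrite mulr1 -EFinM mulVf// gt_eqF.
    rewrite mulr0 mul0e memNset//= => -[/=].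
    by rewrite !in_itv/= q1/= ltNge eq.
  move=> qn; rewrite memNset// => -[/=]; rewrite !in_itv/= => /andP[q1 _] q2.
  by apply: qn; split; rewrite /= ?in_itv/= ?q1.
rewrite integral_cst ?mul1e; last by apply: measurableX; exact: measurable_itv.
transitivity (mu `]0%R, e[ * mu `]0%R, (2 * pi)%R[).
  by apply: product_measure1E; exact: measurable_itv.
rewrite !lebesgue_measure_itv/= !lte_fin e0 mulr_gt0// -!EFinB !subr0.
by rewrite EFinM.
Qed.

End disc_integral.

Section kernel.
Context (R : realType).
Notation mu := (@lebesgue_measure R).
Notation mu2 := (mu \x mu)%E.

Lemma dbar_pairV O (W : R * R -> C R) : (forall q, O q -> W q != 0) ->
  dbar_pair O W (fun=> 0) -> dbar_pair O (fun q => (W q)^-1) (fun=> 0).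
Proof.
move=> W0 [Wr [Wt HW]].
exists (fun q => - Wr q / W q ^+ 2), (fun q => - Wt q / W q ^+ 2) => q Oq.
have [[cW cg cWr cWt] [dWr dWt Wg]] := HW q Oq.
have cV : {for q, continuous (fun q => (W q)^-1)} by apply: cvgV; [exact: W0|exact: cW].
have cN1 : {for q, continuous (fun=> - 1 : C R)} by exact: cvg_cst.
have cV2 : {for q, continuous (fun q => (W q ^+ 2)^-1)}.
  rewrite (_ : (fun q => _) = (fun q => (W q)^-1 * (W q)^-1)).
    exact: (continuous_atM cV cV).
  by apply/funext => p; rewrite expr2 invfM.
have cN (K : R * R -> C R) : {for q, continuous K} ->
    {for q, continuous (fun q => - K q / W q ^+ 2)}.
  move=> cK; rewrite (_ : (fun q => _) = (fun q => - 1 * K q * (W q ^+ 2)^-1)).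
    exact: continuous_atM (continuous_atM cN1 cK) cV2.
  by apply/funext => p; rewrite mulN1r.
split; split; [exact: cV|exact: cg|exact: cN|exact: cN| | |].
- apply: is_cderive_eq (is_cderiveV _ dWr) _; rewrite -surjective_pairing//.
  exact: W0.
- apply: is_cderive_eq (is_cderiveV _ dWt) _; rewrite -surjective_pairing//.
  exact: W0.
- transitivity (- (imag R * Wr q - Wt q / q.1%:C) / W q ^+ 2); first by ring.
  by rewrite Wg !mulr0 oppr0 mul0r.
Qed.

Variable alpha : R.

Definition vpow (q : R * R) : C R := ppow alpha q.1 q.2.

Lemma cmod_vpow q : cmod (vpow q) = q.1 `^ alpha.
Proof. by rewrite cmod_polar// powR_ge0. Qed.

Lemma continuous_powR (x : R) : 0 < x -> {for x, continuous (fun y : R => y `^ alpha)}.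
Proof.
move=> x0; apply/differentiable_continuous/derivable1_diffP.
exact: (@ex_derive _ _ _ _ _ _ _ (is_derive1_powR alpha x0)).
Qed.

Lemma continuous_vpow (q : R * R) : 0 < q.1 -> {for q, continuous vpow}.
Proof.
move=> q1; apply: cvg_pair_complex; apply: cvgM.
- apply: (@continuous_comp _ _ _ (fst : R * R -> R) (fun y => y `^ alpha)).
    exact: cvg_fst.
  exact: continuous_powR.
- apply: (@continuous_comp _ _ _ (fun q : R * R => alpha * q.2) cos).
    by apply: cvgM; [exact: cvg_cst|exact: cvg_snd].
  exact: continuous_cos.
- apply: (@continuous_comp _ _ _ (fst : R * R -> R) (fun y => y `^ alpha)).
    exact: cvg_fst.
  exact: continuous_powR.
- apply: (@continuous_comp _ _ _ (fun q : R * R => alpha * q.2) sin).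
    by apply: cvgM; [exact: cvg_cst|exact: cvg_snd].
  exact: continuous_sin.
Qed.

Lemma is_cderive_ppow_rho (rho t : R) : 0 < rho ->
  is_cderive (fun x => ppow alpha x t) rho ((alpha / rho)%:C * ppow alpha rho t).
Proof.
move=> rho0; have d := is_derive1_powR alpha rho0.
have powE : rho `^ (alpha - 1) = rho `^ alpha / rho.
  rewrite powRD; last by rewrite (gt_eqF rho0) implybT.
  by rewrite powRN powRr1// ltW.
split; apply: is_derive_eq; rewrite ?ReM ?ImM/= /GRing.scale/= powE; ring.
Qed.

Lemma is_cderive_ppow_t (rho t : R) :
  is_cderive (fun y => ppow alpha rho y) t
    (imag R * alpha%:C * ppow alpha rho t).
Proof.
have dc (f f' : R -> R) : (forall y : R, is_derive y 1 f (f' y)) ->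
    is_derive t 1 (fun y => f (alpha * y)) (f' (alpha * t) * alpha).
  move=> df; apply: (@is_derive1_comp R f (fun y => alpha * y)).
  by apply: is_derive_eq; rewrite /GRing.scale/=; ring.
have dcos := dc _ _ (@is_derive_cos R); have dsin := dc _ _ (@is_derive_sin R).
split; apply: is_derive_eq; rewrite ?ReM ?ImM/= /GRing.scale/=; ring.
Qed.

Lemma vpow_holomorphic : dbar_pair [set q | 0 < q.1] vpow (fun=> 0).
Proof.
exists (fun q => (alpha / q.1)%:C * vpow q), (fun q => imag R * alpha%:C * vpow q).
move=> q /= q1; have cv := continuous_vpow q1.
have c0 : {for q, continuous (fun=> 0 : C R)} by exact: cvg_cst.
have cr : {for q, continuous (fun q : R * R => (alpha / q.1)%:C : C R)}.
  apply: cvg_real_complex; apply: cvgM; first exact: cvg_cst.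
  by apply: cvgV; [rewrite gt_eqF|exact: cvg_fst].
have ci : {for q, continuous (fun=> imag R * alpha%:C : C R)} by exact: cvg_cst.
split; split; [exact: cv|exact: c0|exact: continuous_atM cr cv|
  exact: continuous_atM ci cv| | |].
- exact: is_cderive_ppow_rho.
- exact: is_cderive_ppow_t.
- have q0 : q.1%:C != 0 :> C R by exact: realC_neq0.
  rewrite (_ : (alpha / q.1)%:C = alpha%:C / q.1%:C) ?rmorphM ?fmorphV//.
  by rewrite mulr0; ring.
Qed.

Definition kap (p : C R) (q : R * R) : C R := vpow q / (vpow q - p).

Lemma kap_holomorphic (p : C R) (O : set (R * R)) :
  (forall q, O q -> 0 < q.1 /\ vpow q != p) -> dbar_pair O (kap p) (fun=> 0).
Proof.
move=> HO; have hv : dbar_pair O vpow (fun=> 0).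
  by apply: dbar_pairS vpow_holomorphic => q /HO[].
have hV : dbar_pair O (fun q => (vpow q - p)^-1) (fun=> 0).
  apply: dbar_pairV; first by move=> q /HO[_]; rewrite subr_eq0.
  exact: dbar_pairB_cst.
have := dbar_pairM hv hV; rewrite (_ : (fun q => _ * 0) = (fun=> 0))//.
by apply/funext => q; rewrite mulr0.
Qed.

Lemma atan_inv (x : R) : 0 < x -> atan x + atan x^-1 = pi / 2.
Proof.
move=> x0; suff -> : atan x^-1 = pi / 2 - atan x by rewrite addrC subrK.
have ax : 0 < atan x by rewrite -atan0; exact: lt_atan.
have ax2 := atan_ltpi2 x.
rewrite -(tanK (x := pi / 2 - atan x)); last by rewrite in_itv/=; lra.
congr atan; rewrite -[in LHS](atanK x) /tan sinB cosB sin_pihalf cos_pihalf.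
by rewrite !mul0r !mul1r subr0 add0r invf_div.
Qed.

(* A branch of the logarithm off the imaginary axis. *)
Definition clog (z : C R) : C R :=
  (2^-1 * ln (complex.Re z ^+ 2 + complex.Im z ^+ 2)) +i*
  atan (complex.Im z / complex.Re z).

Lemma is_cderive_clog (xi : R -> C R) (x : R) (l : C R) :
  complex.Re (xi x) != 0 -> is_cderive xi x l ->
  is_cderive (fun y => clog (xi y)) x (l / xi x).
Proof.
move=> x0 [d1 d2].
set X := fun y => complex.Re (xi y); set Y := fun y => complex.Im (xi y).
have N0 : 0 < X x ^+ 2 + Y x ^+ 2.
  by rewrite ltr_pwDl ?sqr_ge0// lt_neqAle sqr_ge0 eq_sym sqrf_eq0 x0.
have ReV (z : C R) : complex.Re z^-1 =
    complex.Re z * (complex.Re z ^+ 2 + complex.Im z ^+ 2)^-1 by case: z.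
have ImV (z : C R) : complex.Im z^-1 =
    - complex.Im z * (complex.Re z ^+ 2 + complex.Im z ^+ 2)^-1.
  by case: z => p q /=; rewrite mulNr.
have dN : is_derive x 1 (fun y => X y ^+ 2 + Y y ^+ 2)
    (2 * X x * complex.Re l + 2 * Y x * complex.Im l).
  apply: (@is_derive_eq _ _ _ _ _ _ _ _
    (is_deriveD (is_deriveX 2 d1) (is_deriveX 2 d2))).
  by rewrite /GRing.scale/=; ring.
have N0' : X x ^+ 2 + Y x ^+ 2 != 0 by rewrite gt_eqF.
have dV := is_deriveV x0 d1.
split; rewrite ?ReM ?ImM ReV ImV -/(X x) -/(Y x) /=.
  have dl := @is_derive1_comp R (@ln R) (fun y => X y ^+ 2 + Y y ^+ 2) x _ _
    (is_derive1_ln N0) dN.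
  apply: (@is_derive_eq _ _ _ _ _ _ _ _ (is_deriveZ 2^-1 dl)).
  by rewrite /GRing.scale/=; field.
have da := @is_derive1_comp R atan (fun y => Y y * (X y)^-1) x _ _
  (is_derive1_atan _) (is_deriveM d2 dV).
apply: (@is_derive_eq _ _ _ _ _ _ _ _ da).
rewrite /GRing.scale/= -/(X x) -/(Y x); field.
by rewrite x0 N0'.
Qed.

Lemma cint_log_Re (xi xi' : R -> C R) (a b : R) : a <= b ->
  (forall x, a <= x <= b -> is_cderive xi x (xi' x)) ->
  {within `[a, b], continuous xi'} ->
  (forall x, a <= x <= b -> complex.Re (xi x) != 0) ->
  cint mu `[a, b] (fun x => xi' x / xi x) = clog (xi b) - clog (xi a).
Proof.
move=> ab dxi cxi' xi0; have xi0' x : a <= x <= b -> xi x != 0.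
  by move=> /xi0; apply: contra => /eqP ->.
apply: (@cFTC R (fun x => clog (xi x)) _ _ _ ab).
  by move=> x xI; apply: is_cderive_clog; [exact: xi0|exact: dxi].
have cxi : {within `[a, b], continuous xi}.
  apply: continuous_at_within => x; rewrite /= in_itv/= => xI.
  exact: is_cderive_continuous (dxi x xI).
have cV : {within `[a, b], continuous (fun x => (xi x)^-1)}.
  apply: within_continuousV cxi => x; rewrite /= in_itv/=; exact: xi0'.
exact: (within_continuousM cxi' cV).
Qed.

Lemma cint_log_Im (xi xi' : R -> C R) (a b : R) : a <= b ->
  (forall x, a <= x <= b -> is_cderive xi x (xi' x)) ->
  {within `[a, b], continuous xi'} ->
  (forall x, a <= x <= b -> complex.Im (xi x) != 0) ->
  cint mu `[a, b] (fun x => xi' x / xi x) =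
    clog (- imag R * xi b) - clog (- imag R * xi a).
Proof.
move=> ab dxi cxi' xi0.
have i0 : - imag R != 0 by rewrite oppr_eq0 eq_complex/= negb_and oner_eq0 orbT.
transitivity (cint mu `[a, b] (fun x => (- imag R * xi' x) / (- imag R * xi x))).
  apply: eq_cint => x; rewrite inE/= in_itv/= => xI.
  by rewrite invfM mulrACA divff// mul1r.
have cI : {within `[a, b], continuous (fun=> - imag R)} by exact: within_continuous_cst.
apply: (@cint_log_Re (fun x => - imag R * xi x) _ _ _ ab).
- move=> x xI; apply: is_cderive_eq (is_cderiveM (is_cderive_cst (- imag R) x) (dxi x xI)) _.
  by rewrite mul0r add0r.
- exact: (within_continuousM cI cxi').
- by move=> x /xi0; rewrite ReM /= oppr0 mul0r sub0r mulN1r opprK.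
Qed.

End kernel.

Section winding.
Context (R : realType).
Notation mu := (@lebesgue_measure R).
Notation mu2 := (mu \x mu)%E.

Lemma polarM (r1 t1 r2 t2 : R) :
  polar r1 t1 * polar r2 t2 = polar (r1 * r2) (t1 + t2) :> C R.
Proof. by apply: complexP; rewrite ?ReM ?ImM/= ?cosD ?sinD; ring. Qed.

Lemma mulNi (z : C R) : - imag R * z = complex.Im z +i* (- complex.Re z).
Proof. by apply: complexP; rewrite ?ReM ?ImM ?ReN ?ImN/=; ring. Qed.

Lemma clog_corner (z : C R) : complex.Re z * complex.Im z != 0 ->
  clog z - clog (- imag R * z) =
  (Num.sg (complex.Re z * complex.Im z) * (pi / 2))%:C * imag R.
Proof.
rewrite mulNi; case: z => x y /=; set p := y / x.
rewrite mulf_eq0 negb_or => /andP[x0 y0].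
have pE : x * y = x ^+ 2 * p by rewrite /p; field.
have sgE : Num.sg (x * y) = Num.sg p.
  by rewrite pE sgrM gtr0_sg ?mul1r// lt_neqAle sqr_ge0 eq_sym sqrf_eq0 x0.
apply: complexP; rewrite ?ReD ?ImD ?ReN ?ImN ?ReM ?ImM/= sgE.
  by rewrite sqrrN [y ^+ 2 + _]addrC subrr !mulr0 mul0r subr0.
rewrite !mulr1 !mul0r !addr0 mulNr atanN opprK -/p -[x / y]invf_div -/p.
have [p0|p0|p0] := ltgtP 0 p.
- by rewrite gtr0_sg// mul1r atan_inv.
- rewrite ltr0_sg// mulN1r -(@atan_inv _ (- p)) ?oppr_gt0//.
  by rewrite invrN !atanN -opprD opprK.
- by move: p0; rewrite /p => /esym/eqP; rewrite mulf_eq0 invr_eq0 (negbTE x0) (negbTE y0).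
Qed.

Lemma clog_corner_pos (z : C R) : 0 < complex.Re z * complex.Im z ->
  clog z - clog (- imag R * z) = (pi / 2)%:C * imag R.
Proof. by move=> h; rewrite clog_corner ?gt_eqF// gtr0_sg// mul1r. Qed.

Lemma clog_corner_neg (z : C R) : complex.Re z * complex.Im z < 0 ->
  clog z - clog (- imag R * z) = - ((pi / 2)%:C * imag R).
Proof.
by move=> h; rewrite clog_corner ?lt_eqF// ltr0_sg// mulN1r rmorphN mulNr.
Qed.

Variables (alpha : R) (alpha0 : 0 < alpha) (q0 : R * R) (q0_gt0 : 0 < q0.1).
Let u := vpow alpha q0.

Lemma vpow_neq0 q : 0 < q.1 -> vpow alpha q != 0.
Proof. by move=> q1; rewrite -cmod_eq0 cmod_vpow gt_eqF// powR_gt0. Qed.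

Definition xi (q : R * R) : C R := vpow alpha q / u - 1.

Lemma xiE q : 0 < q.1 ->
  xi q = polar ((q.1 / q0.1) `^ alpha) (alpha * (q.2 - q0.2)) - 1.
Proof.
move=> q1; have u0 := vpow_neq0 q0_gt0; congr (_ - 1); apply: (mulIf u0).
rewrite divfK// polarM -powRM ?divfK ?gt_eqF//; [|by rewrite divr_ge0// ltW|exact: ltW].
by congr polar; ring.
Qed.

Lemma Re_xi q : 0 < q.1 -> complex.Re (xi q) =
  (q.1 / q0.1) `^ alpha * cos (alpha * (q.2 - q0.2)) - 1.
Proof. by move=> q1; rewrite xiE// ReD ReN. Qed.

Lemma Im_xi q : 0 < q.1 -> complex.Im (xi q) =
  (q.1 / q0.1) `^ alpha * sin (alpha * (q.2 - q0.2)).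
Proof. by move=> q1; rewrite xiE// ImD ImN/= subr0. Qed.

Lemma kap_xi q : kap alpha u q = (xi q + 1) / xi q.
Proof.
have u0 := vpow_neq0 q0_gt0; rewrite /kap /xi subrK.
have [e|ne] := eqVneq (vpow alpha q) u.
  by rewrite e subrr invr0 !mulr0 divff// subrr invr0 mulr0.
have vu : vpow alpha q - u != 0 by rewrite subr_eq0.
have -> : vpow alpha q / u - 1 = (vpow alpha q - u) / u by rewrite mulrBl divff.
by rewrite invf_div mulrA divfK.
Qed.

Lemma is_cderive_xi_rho x y : 0 < x ->
  is_cderive (fun x => xi (x, y)) x ((alpha / x)%:C * (xi (x, y) + 1)).
Proof.
move=> x0; apply: is_cderive_eq (is_cderiveD (is_cderiveM
  (is_cderive_ppow_rho alpha y x0) (is_cderive_cst u^-1 x)) (is_cderive_cst (- 1) x)) _.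
by rewrite mulr0 !addr0 subrK mulrA.
Qed.

Lemma is_cderive_xi_t x y :
  is_cderive (fun y => xi (x, y)) y (imag R * alpha%:C * (xi (x, y) + 1)).
Proof.
apply: is_cderive_eq (is_cderiveD (is_cderiveM
  (is_cderive_ppow_t alpha x y) (is_cderive_cst u^-1 y)) (is_cderive_cst (- 1) y)) _.
by rewrite mulr0 !addr0 subrK mulrA.
Qed.

Let a0 : alpha%:C != 0 :> C R. Proof. exact: realC_neq0. Qed.

Let side_rho (y x1 x2 : R) : 0 < x1 -> x1 <= x2 ->
  (forall x, x1 <= x <= x2 -> complex.Im (xi (x, y)) != 0) ->
  cint mu `[x1, x2] (fun x => kap alpha u (x, y) / x%:C) =
  (alpha%:C)^-1 * (clog (- imag R * xi (x2, y)) - clog (- imag R * xi (x1, y))).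
Proof.
move=> x10 x12 I0; have xp x : x1 <= x <= x2 -> 0 < x.
  by case/andP => h _; exact: lt_le_trans h.
have d x : x1 <= x <= x2 -> is_cderive (fun x => xi (x, y)) x
    ((alpha / x)%:C * (xi (x, y) + 1)).
  by move=> /xp xgt0; exact: is_cderive_xi_rho.
have c : {within `[x1, x2], continuous (fun x : R => (alpha / x)%:C * (xi (x, y) + 1) : C R)}.
  apply: continuous_at_within => x; rewrite /= in_itv/= => xI; apply: continuous_atM.
    apply: cvg_real_complex; apply: cvgM; first exact: cvg_cst.
    by apply: cvgV; [rewrite gt_eqF// xp|exact: cvg_id].
  exact: (continuous_atD (is_cderive_continuous (d x xI)) (cvg_cst (1 : C R))).
rewrite -(cint_log_Im x12 d c I0) -cintZl//; last first.
  apply: continuous_cintegrable; apply: (within_continuousM c).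
  apply: within_continuousV.
    move=> x; rewrite /= in_itv/= => /I0; apply: contra => /eqP -> //.
  apply: continuous_at_within => x; rewrite /= in_itv/= => xI.
  exact: is_cderive_continuous (d x xI).
apply: eq_cint => x; rewrite inE/= in_itv/= => xI; rewrite kap_xi.
have x0 : x%:C != 0 :> C R by apply/realC_neq0/xp.
rewrite (_ : (alpha / x)%:C = alpha%:C / x%:C) ?rmorphM ?fmorphV//.
have xn : xi (x, y) != 0 by apply: contra (I0 x xI) => /eqP ->.
by field; apply/and3P; split.
Qed.

Let side_t (x y1 y2 : R) : 0 < x -> y1 <= y2 ->
  (forall y, y1 <= y <= y2 -> complex.Re (xi (x, y)) != 0) ->
  imag R * cint mu `[y1, y2] (fun y => kap alpha u (x, y)) =
  (alpha%:C)^-1 * (clog (xi (x, y2)) - clog (xi (x, y1))).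
Proof.
move=> x0 y12 I0.
have d y : y1 <= y <= y2 -> is_cderive (fun y => xi (x, y)) y
    (imag R * alpha%:C * (xi (x, y) + 1)).
  by move=> _; exact: is_cderive_xi_t.
have ci : {within `[y1, y2], continuous (fun=> imag R * alpha%:C : C R)}.
  exact: within_continuous_cst.
have cx : {within `[y1, y2], continuous (fun y => xi (x, y))}.
  apply: continuous_at_within => y; rewrite /= in_itv/= => yI.
  exact: is_cderive_continuous (d y yI).
have c1 : {within `[y1, y2], continuous (fun=> 1 : C R)}.
  exact: within_continuous_cst.
have c : {within `[y1, y2],
    continuous (fun y : R => imag R * alpha%:C * (xi (x, y) + 1) : C R)}.
  exact: (within_continuousM ci (within_continuousD cx c1)).
have xi0 y : y1 <= y <= y2 -> xi (x, y) != 0.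
  by move=> /I0; apply: contra => /eqP ->.
have cV : {within `[y1, y2], continuous (fun y => (xi (x, y))^-1)}.
  by apply: within_continuousV cx => y; rewrite /= in_itv/=; exact: xi0.
have i_k : cintegrable mu `[y1, y2] (fun y => imag R * alpha%:C * (xi (x, y) + 1) / xi (x, y)).
  exact: continuous_cintegrable (within_continuousM c cV).
have im0 : imag R != 0 by rewrite eq_complex/= negb_and oner_eq0 orbT.
rewrite -(cint_log_Re y12 d c I0).
have -> : cint mu `[y1, y2] (fun y => kap alpha u (x, y)) =
    (imag R * alpha%:C)^-1 * cint mu `[y1, y2]
      (fun y => imag R * alpha%:C * (xi (x, y) + 1) / xi (x, y)).
  rewrite -cintZl//; apply: eq_cint => y; rewrite inE/= in_itv/= => yI.
  rewrite kap_xi; field; apply/and3P; split=> //; exact: xi0.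
by field; apply/andP; split.
Qed.

Lemma bdry_kap_hole x1 x2 e : 0 < x1 -> x1 < q0.1 -> q0.1 < x2 ->
  0 < e -> alpha * e < pi ->
  (forall s, `|s| <= e -> 1 < (x2 / q0.1) `^ alpha * cos (alpha * s)) ->
  bdry x1 x2 (q0.2 - e) (q0.2 + e) (kap alpha u) = 2 * imag R * (pi / alpha)%:C.
Proof.
move=> x10 x1q x2q e0 aepi Hcos; have q01 := q0_gt0.
have x20 : 0 < x2 by exact: lt_trans x2q.
have pr x : 0 < x -> 0 < (x / q0.1) `^ alpha.
  by move=> x0; rewrite powR_gt0// divr_gt0.
have s0 : 0 < sin (alpha * e) by rewrite sin_gt0_pi// mulr_gt0.
have It x : 0 < x -> 0 < complex.Im (xi (x, q0.2 + e)).
  by move=> x0; rewrite Im_xi//= addrAC subrr add0r mulr_gt0// pr.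
have Ib x : 0 < x -> complex.Im (xi (x, q0.2 - e)) < 0.
  move=> x0; rewrite Im_xi//= addrAC subrr add0r mulrN sinN mulrN oppr_lt0.
  by rewrite mulr_gt0// pr.
have Rr y : q0.2 - e <= y <= q0.2 + e -> 0 < complex.Re (xi (x2, y)).
  by move=> yI; rewrite Re_xi//= subr_gt0; apply: Hcos; rewrite ler_norml; lra.
have Rl y : complex.Re (xi (x1, y)) < 0.
  rewrite Re_xi//= subr_lt0; apply: (@le_lt_trans _ _ ((x1 / q0.1) `^ alpha)).
    by rewrite ler_piMr ?powR_ge0// cos_le1.
  suff : (x1 / q0.1) `^ alpha < 1 `^ alpha by rewrite powR1.
  apply: gt0_ltr_powR; rewrite ?nnegrE ?ler01 ?divr_ge0 ?(ltW x10) ?(ltW q01)//.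
  by rewrite ltr_pdivrMr// mul1r.
have x12 : x1 <= x2 by apply/ltW/(lt_trans x1q).
have y12 : q0.2 - e <= q0.2 + e by lra.
have Nr y : q0.2 - e <= y <= q0.2 + e -> complex.Re (xi (x2, y)) != 0.
  by move=> yI; rewrite gt_eqF// Rr.
have Nl y : q0.2 - e <= y <= q0.2 + e -> complex.Re (xi (x1, y)) != 0.
  by move=> yI; rewrite lt_eqF.
have Nb x : x1 <= x <= x2 -> complex.Im (xi (x, q0.2 - e)) != 0.
  by move=> /andP[hx _]; rewrite lt_eqF// Ib//; exact: lt_le_trans hx.
have Nt x : x1 <= x <= x2 -> complex.Im (xi (x, q0.2 + e)) != 0.
  by move=> /andP[hx _]; rewrite gt_eqF// It//; exact: lt_le_trans hx.
have c22 : clog (xi (x2, q0.2 + e)) - clog (- imag R * xi (x2, q0.2 + e)) =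
    (pi / 2)%:C * imag R.
  by apply: clog_corner_pos; rewrite mulr_gt0 ?It ?Rr// y12 lexx.
have c21 : clog (xi (x2, q0.2 - e)) - clog (- imag R * xi (x2, q0.2 - e)) =
    - ((pi / 2)%:C * imag R).
  by apply: clog_corner_neg; rewrite pmulr_rlt0 ?Ib ?Rr// y12 lexx.
have c12 : clog (xi (x1, q0.2 + e)) - clog (- imag R * xi (x1, q0.2 + e)) =
    - ((pi / 2)%:C * imag R).
  by apply: clog_corner_neg; rewrite pmulr_llt0 ?It.
have c11 : clog (xi (x1, q0.2 - e)) - clog (- imag R * xi (x1, q0.2 - e)) =
    (pi / 2)%:C * imag R.
  by apply: clog_corner_pos; rewrite nmulr_rgt0 ?Ib.
pose Lr y : C R := (alpha%:C)^-1 *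
  (clog (- imag R * xi (x2, y)) - clog (- imag R * xi (x1, y))).
pose Lt x : C R := (alpha%:C)^-1 *
  (clog (xi (x, q0.2 + e)) - clog (xi (x, q0.2 - e))).
transitivity (Lr (q0.2 - e) + Lt x2 - Lr (q0.2 + e) - Lt x1).
  rewrite /bdry; congr (_ + _ - _ - _).
  - exact: side_rho x10 x12 Nb.
  - exact: side_t x20 y12 Nr.
  - exact: side_rho x10 x12 Nt.
  - exact: side_t x10 y12 Nl.
rewrite /Lr /Lt.
transitivity (alpha%:C^-1 * (
   (clog (xi (x2, q0.2 + e)) - clog (- imag R * xi (x2, q0.2 + e))) -
   (clog (xi (x2, q0.2 - e)) - clog (- imag R * xi (x2, q0.2 - e))) -
   (clog (xi (x1, q0.2 + e)) - clog (- imag R * xi (x1, q0.2 + e))) +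
   (clog (xi (x1, q0.2 - e)) - clog (- imag R * xi (x1, q0.2 - e))))).
  by ring.
rewrite c22 c21 c12 c11 !rmorphM !fmorphV/=.
have two0 : 2%:C != 0 :> C R by exact: realC_neq0.
have -> : (2%:C : C R) = 2 by rewrite rmorph_nat.
by field; exact: a0.
Qed.

End winding.

Section pole.
Context (R : realType).
Notation mu := (@lebesgue_measure R).
Notation mu2 := (mu \x mu)%E.

Lemma is_derive_lower_bound (f : R -> R) (x0 l : R) : is_derive x0 1 f l -> l != 0 ->
  exists2 e, 0 < e & forall x, `|x - x0| < e ->
    `|l| / 2 * `|x - x0| <= `|f x - f x0|.
Proof.
move=> /is_deriveP dl l0; have l2 : 0 < `|l| / 2 by rewrite divr_gt0 ?normr_gt0.
have : \forall h \near 0^', `|l - h^-1 *: (f (h *: 1 + x0) - f x0)| < `|l| / 2.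
  by move/cvgrPdist_lt : dl; apply.
move=> /nbhs_ballP[e /= e0 He]; exists e => // x xe.
have [->|xx0] := eqVneq x x0; first by rewrite !subrr normr0 mulr0.
have h0 : x - x0 != 0 by rewrite subr_eq0.
have := He (x - x0); rewrite /ball/= sub0r normrN => /(_ xe h0).
rewrite /GRing.scale/= mulr1 subrK => H.
have : `|l| / 2 < `|(x - x0)^-1 * (f x - f x0)|.
  have := ler_distD ((x - x0)^-1 * (f x - f x0)) l 0; rewrite !subr0 => H1; lra.
by rewrite normrM normfV ltr_pdivlMl ?normr_gt0// mulrC => /ltW.
Qed.

Lemma integrable_cst_itv (a b M : R) : mu.-integrable `[a, b] (EFin \o cst M).
Proof.
apply: measurable_bounded_integrable => //.
  by apply: compact_finite_measure; exact: segment_compact.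
by exists `|M|; split; [exact: num_real|move=> z Mz x _; exact: ltW].
Qed.

Lemma cmod_cint_cst_le (F : R -> C R) (a b M : R) : a <= b ->
  cintegrable mu `[a, b] F -> (forall x, a <= x <= b -> cmod (F x) <= M) ->
  cmod (cint mu `[a, b] F) <= 2 * (M * (b - a)).
Proof.
move=> ab iF FM.
have E : \int[mu]_(x in `[a, b]) (cst M x) = M * (b - a).
  rewrite Rintegral_cst//= lebesgue_measure_itv/= lte_fin.
  case: ltP => [_|ba]; first by rewrite -EFinB.
  have -> : b = a by lra.
  by rewrite subrr.
rewrite -E; apply: (@cmod_cint_le _ _ R mu _ F (cst M) _ iF (integrable_cst_itv a b M)).
  exact: measurable_itv.
by move=> x; rewrite /= in_itv/=; exact: FM.
Qed.

Lemma cmod_imag : cmod (imag R) = 1.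
Proof. by rewrite cmodE/= expr0n/= expr1n add0r sqrtr1. Qed.

Lemma cmod_nat (n : nat) : cmod (n%:R : C R) = n%:R.
Proof.
have -> : (n%:R : C R) = n%:R%:C by rewrite rmorph_nat.
by rewrite cmod_real normr_nat.
Qed.

Lemma cmodB_le (x y : C R) : cmod (x - y) <= cmod x + cmod y.
Proof. by rewrite -(cmodN y); exact: cmodD. Qed.

Definition bdry_integrable a b c d (F : R * R -> C R) :=
  [/\ cintegrable mu `[a, b] (fun x => F (x, c) / x%:C),
      cintegrable mu `[a, b] (fun x => F (x, d) / x%:C),
      cintegrable mu `[c, d] (fun y => F (a, y)) &
      cintegrable mu `[c, d] (fun y => F (b, y))].

Lemma bdryD a b c d (F G : R * R -> C R) :
  bdry_integrable a b c d F -> bdry_integrable a b c d G ->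
  bdry a b c d (fun q => F q + G q) = bdry a b c d F + bdry a b c d G.
Proof.
move=> [F1 F2 F3 F4] [G1 G2 G3 G4]; rewrite /bdry !cintD//.
have E (y : R) : cintegrable mu `[a, b] (fun x => F (x, y) / x%:C) ->
    cintegrable mu `[a, b] (fun x => G (x, y) / x%:C) ->
    cint mu `[a, b] (fun x => (F (x, y) + G (x, y)) / x%:C) =
    cint mu `[a, b] (fun x => F (x, y) / x%:C) + cint mu `[a, b] (fun x => G (x, y) / x%:C).
  move=> H1 H2; rewrite -cintD//.
  by apply: eq_cint => x _; rewrite mulrDl.
rewrite (E c F1 G1) (E d F2 G2); ring.
Qed.

Lemma bdryZl a b c d (k : C R) (F : R * R -> C R) :
  bdry_integrable a b c d F ->
  bdry a b c d (fun q => k * F q) = k * bdry a b c d F.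
Proof.
move=> [F1 F2 F3 F4]; rewrite /bdry !cintZl//.
have E (y : R) : cintegrable mu `[a, b] (fun x => F (x, y) / x%:C) ->
    cint mu `[a, b] (fun x => k * F (x, y) / x%:C) =
    k * cint mu `[a, b] (fun x => F (x, y) / x%:C).
  by move=> H1; rewrite -cintZl//; apply: eq_cint => x _; rewrite mulrA.
rewrite (E c F1) (E d F2); ring.
Qed.

Lemma bdry_integrableZl a b c d (k : C R) (F : R * R -> C R) :
  bdry_integrable a b c d F -> bdry_integrable a b c d (fun q => k * F q).
Proof.
move=> [F1 F2 F3 F4].
have E (y : R) : (fun x => k * F (x, y) / x%:C) = (fun x => k * (F (x, y) / x%:C)).
  by apply/funext => x; rewrite mulrA.
by split; rewrite ?E; exact: cintegrableZl.
Qed.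

Lemma continuous_bdry_integrable a b c d (F : R * R -> C R) (A : set (R * R)) :
  0 < a -> a <= b -> c <= d ->
  (forall q, A q -> {for q, continuous F}) ->
  (forall x y, a <= x <= b -> c <= y <= d -> [|| x == a, x == b, y == c | y == d] ->
    A (x, y)) -> bdry_integrable a b c d F.
Proof.
move=> a0 ab cd cF inA; split.
- apply: (cintegrable_horizontal a0 ab) => x xI; apply: cF; apply: inA => //.
    by rewrite lexx.
  by rewrite eqxx !orbT.
- apply: (cintegrable_horizontal a0 ab) => x xI; apply: cF; apply: inA => //.
    by rewrite lexx andbT.
  by rewrite eqxx !orbT.
- apply: (cintegrable_vertical cd) => y yI; apply: cF; apply: inA => //.
    by rewrite lexx.
  by rewrite eqxx.
- apply: (cintegrable_vertical cd) => y yI; apply: cF; apply: inA => //.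
    by rewrite lexx andbT.
  by rewrite eqxx !orbT.
Qed.

Lemma dist2_le (q q0 : R * R) : dist2 q q0 <= `|q.1 - q0.1| + `|q.2 - q0.2|.
Proof.
rewrite -(ler_pXn2r (n := 2))// ?nnegrE ?sqrtr_ge0 ?addr_ge0//.
rewrite /dist2 sqr_sqrtr ?addr_ge0 ?sqr_ge0// [leRHS]sqrrD !real_normK ?num_real//.
by rewrite -addrA lerD2l lerDr mulrn_wge0// mulr_ge0.
Qed.

Lemma dist2_gt0 (q q0 : R * R) : q != q0 -> 0 < dist2 q q0.
Proof.
move=> qq0; rewrite sqrtr_gt0 lt_neqAle addr_ge0 ?sqr_ge0// andbT eq_sym.
rewrite paddr_eq0 ?sqr_ge0// !sqrf_eq0 !subr_eq0; apply: contra qq0.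
by case: q => x y; case: q0 => x0 y0 /= /andP[/eqP -> /eqP ->].
Qed.

Variables (alpha : R) (alpha0 : 0 < alpha) (q0 : R * R) (q0_gt0 : 0 < q0.1).
Let u := vpow alpha q0.
Variables (a b c d : R).
Hypotheses (a0 : 0 < a) (aq : a < q0.1) (qb : q0.1 < b) (cq : c < q0.2) (qd : q0.2 < d).
Let S : set (R * R) := `[a, b] `*` `[c, d].
Hypothesis v_inj : forall q, S q -> q != q0 -> vpow alpha q != u.

Let S_gt0 q : S q -> 0 < q.1.
Proof. by move=> [/=]; rewrite in_itv/= => /andP[/(lt_le_trans a0)]. Qed.

Let kap_pair : dbar_pair (S `\ q0) (kap alpha u) (fun=> 0).
Proof.
apply: kap_holomorphic => q [Sq /eqP qq0]; split; [exact: S_gt0|exact: v_inj].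
Qed.

Lemma bdry_kap : bdry a b c d (kap alpha u) = 2 * imag R * (pi / alpha)%:C.
Proof.
have i0 : cintegrable mu2 S (fun=> 0 : C R).
  by apply: continuous_cintegrable_rect; exact: within_continuous_cst.
have Z (a' b' c' d' : R) : cint mu2 (`[a', b'] `*` `[c', d']) (fun=> 0 : C R) = 0.
  by apply: complexP; rewrite /= Rintegral_cst ?mul0r//; exact: measurable_rect.
have pi0 := pi_gt0 R.
have xb : 1 < (b / q0.1) `^ alpha.
  suff : 1 `^ alpha < (b / q0.1) `^ alpha by rewrite powR1.
  apply: gt0_ltr_powR; rewrite ?nnegrE ?ler01 ?divr_ge0 ?(ltW q0_gt0)//.
    by apply: ltW; exact: lt_trans qb.
  by rewrite ltr_pdivlMr// mul1r.
have : \forall s \near (0 : R), 1 < (b / q0.1) `^ alpha * cos (alpha * s).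
  have cc : {for (0 : R), continuous (fun s => (b / q0.1) `^ alpha * cos (alpha * s))}.
    apply: (@continuousM _ R (fun=> (b / q0.1) `^ alpha) (fun s : R => cos (alpha * s))).
      exact: cvg_cst.
    apply: (@continuous_comp _ _ _ (fun s : R => alpha * s) cos).
      by apply: (@continuousM _ R (fun=> alpha) id); [exact: cvg_cst|exact: cvg_id].
    exact: continuous_cos.
  apply: (@cvgr_gt R _ (nbhs 0) _ (fun s => (b / q0.1) `^ alpha * cos (alpha * s)) _ cc).
  by rewrite mulr0 cos0 mulr1.
move=> /nbhs_ballP[e1 /= e10 He1].
pose e := Num.min (e1 / 2) (Num.min (q0.2 - c) (Num.min (d - q0.2) (pi / alpha / 2))).
have e0 : 0 < e by rewrite !lt_min !subr_gt0 cq qd !divr_gt0.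
have [ee1 [ec [ed ep]]] : e <= e1 / 2 /\ e <= q0.2 - c /\ e <= d - q0.2 /\
    e <= pi / alpha / 2 by rewrite /e !ge_min !lexx ?orbT.
have h1 : c <= q0.2 - e by lra.
have h2 : q0.2 - e < q0.2 by lra.
have h3 : q0.2 < q0.2 + e by lra.
have h4 : q0.2 + e <= d by lra.
have := defect_hole a0 (lexx a) aq qb (lexx b) h1 h2 h3 h4 kap_pair i0.
rewrite /defect !Z !mulr0 !subr0 => ->.
apply: bdry_kap_hole => //.
  have : alpha * e <= pi / 2.
    apply: (le_trans (ler_wpM2l (ltW alpha0) ep)).
    by rewrite mulrA mulrCA divff ?mulr1 ?gt_eqF.
  by lra.
move=> s se; apply: He1; rewrite /ball/= sub0r normrN.
by apply: le_lt_trans se _; lra.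
Qed.

Let kap_bound_near : exists2 e, 0 < e & exists2 K, 0 <= K &
  forall q, `|q.1 - q0.1| < e -> `|q.2 - q0.2| < e ->
    cmod (kap alpha u q) * dist2 q q0 <= K.
Proof.
have p0 : 0 < q0.1 `^ alpha by rewrite powR_gt0.
have d1 := is_derive1_powR alpha q0_gt0.
have l1 : alpha * q0.1 `^ (alpha - 1) != 0.
  by rewrite mulf_neq0 ?gt_eqF// powR_gt0.
have [e1 e10 H1] := is_derive_lower_bound d1 l1.
have d2 : is_derive q0.2 1 (fun t => sin (alpha * (t - q0.2))) alpha.
  have din : is_derive q0.2 1 (fun t => alpha * (t - q0.2)) alpha.
    by apply: is_derive_eq; rewrite /GRing.scale/=; ring.
  apply: is_derive_eq (@is_derive1_comp R sin (fun t => alpha * (t - q0.2))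
    q0.2 _ _ (is_derive_sin _) din) _.
  by rewrite subrr mulr0 cos0 mul1r.
have [e2 e20 H2] := is_derive_lower_bound d2 (lt0r_neq0 alpha0).
have [e3 e30 H3] : exists2 e, 0 < e & forall x, `|x - q0.1| < e ->
    q0.1 `^ alpha / 2 < x `^ alpha < 2 * q0.1 `^ alpha /\ 0 < x.
  have cp := @continuous_powR R alpha _ q0_gt0.
  have : \forall x \near q0.1, (q0.1 `^ alpha / 2 < x `^ alpha < 2 * q0.1 `^ alpha) &&
      (0 < x).
    near=> x; apply/andP; split; [apply/andP; split|]; near: x.
    - apply: (@cvgr_gt R _ (nbhs q0.1) _ (fun x => x `^ alpha) _ cp).
      by rewrite ltr_pdivrMr// ltr_pMr// ltr1n.
    - apply: (@cvgr_lt R _ (nbhs q0.1) _ (fun x => x `^ alpha) _ cp).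
      by rewrite ltr_pMl// ltr1n.
    - by apply: (@cvgr_gt R _ (nbhs q0.1) _ id _ cvg_id).
  move=> /nbhs_ballP[e /= e0 He]; exists e => // x xe.
  by have := He x; rewrite /ball/= distrC => /(_ xe)/andP.
set l := alpha * _ in l1 H1.
pose m := Num.min (`|l| / 2) (q0.1 `^ alpha / 2 * (alpha / 2)).
have m0 : 0 < m by rewrite lt_min !mulr_gt0 ?normr_gt0// invr_gt0.
have [ml ms] : m <= `|l| / 2 /\ m <= q0.1 `^ alpha / 2 * (alpha / 2).
  by rewrite /m !ge_min !lexx orbT.
exists (Num.min e1 (Num.min e2 e3)); first by rewrite !lt_min e10 e20.
exists (2 * q0.1 `^ alpha * (2 / m)).
  by rewrite !mulr_ge0// ?invr_ge0 ?powR_ge0// ltW.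
move=> q; rewrite !lt_min => /and3P[q1 _ q3] /and3P[_ q2 _].
have [/andP[v1 v2] qgt0] := H3 _ q3.
have [qe|vu] := eqVneq (vpow alpha q) u.
  by rewrite /kap qe subrr invr0 mulr0 cmod_real normr0 mul0r !mulr_ge0// ?invr_ge0 ?powR_ge0// ltW.
have vu0 : 0 < cmod (vpow alpha q - u) by apply: cmod_gt0; rewrite subr_eq0.
have b1 : m * `|q.1 - q0.1| <= cmod (vpow alpha q - u).
  apply: (@le_trans _ _ (`|l| / 2 * `|q.1 - q0.1|)).
    by rewrite ler_wpM2r.
  apply: le_trans (H1 _ q1) _; rewrite -!cmod_vpow ler_norml; apply/andP; split.
    by rewrite lerNl opprB cmodB cmod_subl.
  exact: cmod_subl.
have b2 : m * `|q.2 - q0.2| <= cmod (vpow alpha q - u).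
  have -> : vpow alpha q - u = u * xi alpha q0 q.
    by rewrite /xi mulrBr mulr1 mulrC divfK// vpow_neq0.
  rewrite cmodM cmod_vpow.
  apply: (@le_trans _ _ (q0.1 `^ alpha * `|complex.Im (xi alpha q0 q)|)); last first.
    by rewrite ler_wpM2l ?Im_le_cmod// ltW.
  rewrite Im_xi// normrM ger0_norm ?powR_ge0// mulrA -powRM ?(ltW q0_gt0)//; last first.
    by rewrite divr_ge0// ltW.
  rewrite [q0.1 * _]mulrC divfK ?gt_eqF//.
  have := H2 _ q2; rewrite subrr mulr0 sin0 subr0 (gtr0_norm alpha0) => Hs.
  apply: (@le_trans _ _ (q0.1 `^ alpha / 2 * (alpha / 2) * `|q.2 - q0.2|)).
    by rewrite ler_wpM2r.
  by rewrite -mulrA ler_pM// ?mulr_ge0// ?invr_ge0 ?powR_ge0 ?ltW.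
have b3 : dist2 q q0 <= 2 / m * cmod (vpow alpha q - u).
  apply: le_trans (dist2_le q q0) _.
  rewrite -mulrA mulrCA ler_pdivlMl// mulrDr; lra.
rewrite /kap cmodM cmodV cmod_vpow -mulrA.
apply: ler_pM; rewrite ?powR_ge0 ?(ltW v2)//.
  by rewrite mulr_ge0 ?sqrtr_ge0// invr_ge0 cmod_ge0.
by rewrite mulrC ler_pdivrMr.
Unshelve. all: by end_near. Qed.

Lemma kap_bound : exists2 K, 0 <= K & forall q, S q ->
  cmod (kap alpha u q) * dist2 q q0 <= K.
Proof.
have [e e0 [K1 K10 HK1]] := kap_bound_near.
pose far : set (R * R) := [set q | e <= `|q.1 - q0.1|] `|` [set q | e <= `|q.2 - q0.2|].
have cfar : closed far.
  have cn (f : R * R -> R) (z : R) : continuous f -> continuous (fun q => `|f q - z|).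
    move=> cf q; apply: cvg_norm; apply: cvgB; [exact: cf|exact: cvg_cst].
  apply: closedU.
    apply: (@closed_comp _ _ (fun q : R * R => `|q.1 - q0.1|) [set x | e <= x]).
      by move=> q _; apply: cn => p; exact: cvg_fst.
    exact: closed_ge.
  apply: (@closed_comp _ _ (fun q : R * R => `|q.2 - q0.2|) [set x | e <= x]).
    by move=> q _; apply: cn => p; exact: cvg_snd.
  exact: closed_ge.
have cSf : compact (S `&` far) by apply: compact_closedI => //; exact: rect_compact.
have [|M HM] := @compact_bounded_cmod R _ (S `&` far) (kap alpha u) cSf.
  apply: continuous_at_within => q [Sq fq].
  have [Wr [Wt H]] := kap_pair; have [] := H q; last by move=> [h _ _ _] _; exact: h.
  split=> //= qq0; move: fq; rewrite qq0 => -[]/=; rewrite subrr normr0 leNgt e0//.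
exists (Num.max K1 (`|M| * ((b - a) + (d - c)))); first by rewrite le_max K10.
move=> q Sq; rewrite le_max.
have [fq|nfq] := pselect (far q); last first.
  apply/orP; left; apply: HK1; rewrite ltNge; apply/negP => h; apply: nfq; [by left|by right].
apply/orP; right; apply: ler_pM; rewrite ?cmod_ge0 ?sqrtr_ge0//.
  by apply: le_trans (HM q _) (ler_norm _).
apply: le_trans (dist2_le q q0) _; move: Sq => [/=]; rewrite !in_itv/=.
by move=> /andP[h1 h2] /andP[h3 h4]; apply: lerD; rewrite ler_norml; have := aq; have := qb; have := cq; have := qd; lra.
Qed.

Lemma measurable_dist2 : measurable_fun setT (fun q => dist2 q q0).
Proof.
apply: (@measurableT_comp _ _ _ _ _ _ (@Num.sqrt R : R -> R) _
    (fun q : R * R => (q.1 - q0.1) ^+ 2 + (q.2 - q0.2) ^+ 2)).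
  by apply: continuous_measurable_fun; exact: sqrt_continuous.
by apply: measurable_funD; apply: measurable_funX; exact: measurable_funB.
Qed.

Let disc e : set (R * R) := [set q | dist2 q q0 < e].

Let measurable_disc e : measurable (disc e).
Proof.
rewrite (_ : disc e = (fun q => dist2 q q0) @^-1` `]-oo, e[).
  rewrite -[_ @^-1` _]setTI; apply: measurable_dist2 => //.
by apply/seteqP; split=> q /=; rewrite in_itv.
Qed.

Let integrable_disc e : 0 < e ->
  mu2.-integrable (disc e) (EFin \o (fun q => (dist2 q q0)^-1)).
Proof.
move=> e0; apply/integrableP; split.
  apply/measurable_EFinP; apply: measurable_funTS.
  apply: (@measurableT_comp _ _ _ _ _ _ (@GRing.inv R : R -> R) _
    (fun q : R * R => dist2 q q0)); [exact: measurable_inv|exact: measurable_dist2].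
under eq_integral => q _ do
  rewrite /= ger0_norm ?invr_ge0 ?sqrtr_ge0//.
by rewrite integral_disc// ltry.
Qed.

Let Rintegral_disc e (A : set (R * R)) : 0 < e -> measurable A -> A `<=` disc e ->
  \int[mu2]_(q in A) (dist2 q q0)^-1 <= e * (2 * pi).
Proof.
move=> e0 mA Ae; rewrite -[leRHS]/(fine (e * (2 * pi))%:E) -(integral_disc q0 e0).
rewrite fine_le//.
- apply: integrable_fin_num => //; apply: integrableS (integrable_disc e0) => //.
  exact: measurable_disc.
- by apply: integrable_fin_num; [exact: measurable_disc|exact: integrable_disc].
- apply: ge0_subset_integral => //; first exact: measurable_disc.
    by have /integrableP[] := integrable_disc e0.
  by move=> q _; rewrite lee_fin invr_ge0 sqrtr_ge0.
Qed.

Let S_disc : S `<=` disc ((b - a) + (d - c) + 1).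
Proof.
move=> q [/=]; rewrite !in_itv/= => /andP[h1 h2] /andP[h3 h4].
apply: le_lt_trans (dist2_le q q0) _; rewrite ltr_pwDr//.
have := aq; have := qb; have := cq; have := qd => *.
by apply: lerD; rewrite ler_norml; lra.
Qed.

Let mS : measurable S. Proof. exact: measurable_rect. Qed.

Let r0 : 0 < (b - a) + (d - c) + 1.
Proof. by have := aq; have := qb; have := cq; have := qd; lra. Qed.

Section pole_lemma.
Variables (W g : R * R -> C R) (O : set (R * R)).
Hypotheses (SO : S `<=` O) (HW : dbar_pair O W g).

Let kg q := kap alpha u q * g q.

Let kg_bound : exists2 M, 0 <= M & forall q, S q -> cmod (kg q) <= M * (dist2 q q0)^-1.
Proof.
have [K K0 HK] := kap_bound.
have [|G HG] := @compact_bounded_cmod R _ S g (@rect_compact R a b c d).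
  apply: continuous_at_within => q /SO Oq; have [Wr [Wt H]] := HW.
  by have [[_ h _ _] _] := H q Oq; exact: h.
exists (K * `|G|); first by rewrite mulr_ge0.
move=> q Sq; rewrite /kg cmodM.
have [->|qq0] := eqVneq q q0.
  rewrite /kap /u subrr invr0 mulr0 cmod_real normr0 mul0r.
  by rewrite mulr_ge0// ?invr_ge0 ?sqrtr_ge0// mulr_ge0.
rewrite mulrAC ler_pM ?cmod_ge0//; last by apply: le_trans (HG q Sq) (ler_norm _).
by rewrite ler_pdivlMr ?dist2_gt0// HK.
Qed.

Lemma cintegrable_pole : cintegrable mu2 S kg.
Proof.
have [M M0 HM] := kg_bound.
have m1 := measurable_set1_plane q0.
have mSq : measurable (S `\` [set q0]) by exact: measurableD.
have c1 : cmeasurable (S `\` [set q0]) kg.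
  apply: continuous_cmeasurable_plane => //; apply: continuous_at_within => q Sq.
  have [Wr [Wt H]] := kap_pair; have [[h _ _ _] _] := H q Sq.
  have [Wr' [Wt' H']] := HW; have [[_ h' _ _] _] := H' q (SO Sq.1).
  exact: continuous_atM h h'.
apply: (@cintegrable_dominated _ _ R mu2 S kg (fun q : R * R => M * (dist2 q q0)^-1)) => //.
  exact: (cmeasurable_punctured mS c1).
have iS : mu2.-integrable S (EFin \o (fun q : R * R => (dist2 q q0)^-1)).
  by apply: integrableS (integrable_disc r0); [exact: measurable_disc|exact: mS|exact: S_disc].
rewrite (_ : EFin \o _ =
  (fun q : R * R => M%:E * ((dist2 q q0)^-1)%R%:E)%E)//.
by apply: integrableZl; [exact: mS|exact: iS].
Qed.

Let F1 q := (W q - W q0) * kap alpha u q.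

Let F1_pair : dbar_pair (S `\ q0) F1 kg.
Proof.
apply: (dbar_pairM (W := fun q => W q - W q0) (g := g)) kap_pair.
by apply: dbar_pairB_cst; apply: dbar_pairS HW => q [/SO].
Qed.

Let F1_small : exists2 M, 0 <= M & forall eta, 0 < eta ->
  cmod (defect a b c d F1 kg) <= M * eta.
Proof.
have [K K0 HK] := kap_bound.
have [M M0 HM] := kg_bound.
have pi0 := pi_gt0 R.
exists (8 * K / a + 8 * K + 4 * M * (3 * (2 * pi))).
  by rewrite !addr_ge0// ?mulr_ge0// ?invr_ge0 ltW.
move=> eta eta0.
have [Wr [Wt HWq]] := HW.
have q0S : S q0.
  by split; rewrite /= in_itv/=; have := aq; have := qb; have := cq; have := qd;
    move=> *; apply/andP; split; exact: ltW.
have [[cW _ _ _] _] := HWq _ (SO q0S).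
have /nbhs_ballP[e1 e10' He1] : nbhs q0 [set q | cmod (W q0 - W q) < eta].
  by move/cvg_cmodP : cW; apply.
have e10 : 0 < e1 by [].
pose e := Num.min (Num.min (e1 / 2) eta) (Num.min (Num.min (q0.1 - a) (b - q0.1))
  (Num.min (q0.2 - c) (d - q0.2))).
have e0 : 0 < e.
  by rewrite !lt_min !subr_gt0 aq qb cq qd eta0 divr_gt0.
have [ee1 [eeta [ea [eb [ec ed]]]]] : e <= e1 / 2 /\ e <= eta /\ e <= q0.1 - a /\
    e <= b - q0.1 /\ e <= q0.2 - c /\ e <= d - q0.2.
  by rewrite /e !ge_min !lexx ?orbT.
have h1 : a <= q0.1 - e by lra.
have h2 : q0.1 - e < q0.1 by lra.
have h3 : q0.1 < q0.1 + e by lra.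
have h4 : q0.1 + e <= b by lra.
have h5 : c <= q0.2 - e by lra.
have h6 : q0.2 - e < q0.2 by lra.
have h7 : q0.2 < q0.2 + e by lra.
have h8 : q0.2 + e <= d by lra.
have -> : defect a b c d F1 kg = defect (q0.1 - e) (q0.1 + e) (q0.2 - e) (q0.2 + e) F1 kg.
  by apply: defect_hole a0 h1 h2 h3 h4 h5 h6 h7 h8 F1_pair cintegrable_pole.
have e3 : 0 < 3 * e by lra.
have e3eta : 3 * e * (2 * pi) <= 3 * eta * (2 * pi).
  by apply: ler_wpM2r; [rewrite mulr_ge0// ltW|lra].
have arith1 x y : x <= 2 * y -> y <= M * (3 * eta * (2 * pi)) ->
    2 * x <= 4 * M * (3 * (2 * pi)) * eta by move=> *; lra.
have arith2 x x1 x2 x3 x4 y z1 z2 z3 : x <= z3 + y -> z3 <= z2 + x4 -> z2 <= z1 + x3 ->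
    z1 <= x1 + x2 -> y <= 4 * M * (3 * (2 * pi)) * eta ->
    x4 <= 4 * K * eta -> x2 <= 4 * K * eta -> x3 <= 4 * K / a * eta ->
    x1 <= 4 * K / a * eta -> x <= (8 * K / a + 8 * K + 4 * M * (3 * (2 * pi))) * eta.
  by move=> *; lra.
set H : set (R * R) := `[q0.1 - e, q0.1 + e] `*` `[q0.2 - e, q0.2 + e].
have HS : H `<=` S.
  move=> q [/=]; rewrite !in_itv/= => /andP[g1 g2] /andP[g3 g4].
  by split; rewrite /= ?in_itv/=; apply/andP; split; lra.
have mH : measurable H by exact: measurable_rect.
have Hdisc : H `<=` disc (3 * e).
  move=> q [/=]; rewrite !in_itv/= => /andP[g1 g2] /andP[g3 g4].
  apply: le_lt_trans (dist2_le q q0) _; apply: (@le_lt_trans _ _ (e + e)); last by lra.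
  by apply: lerD; rewrite ler_norml; lra.
have cF x y : H (x, y) -> (x != q0.1) || (y != q0.2) -> {for (x, y), continuous F1}.
  move=> Hxy xy; have [Fr [Ft HF]] := F1_pair.
  have Sxy : (S `\ q0) (x, y).
    split; first exact: HS.
    by move=> /= qe; move: xy; rewrite -qe/= !eqxx.
  by have [[h _ _ _] _] := HF _ Sxy; exact: h.
have bF x y : H (x, y) -> (e <= `|x - q0.1|) || (e <= `|y - q0.2|) ->
    cmod (F1 (x, y)) <= eta * K / e.
  move=> Hxy xy; rewrite /F1 cmodM -mulrA; apply: ler_pM; rewrite ?cmod_ge0//.
    rewrite cmodB; apply/ltW/He1; move: Hxy => [/=].
    rewrite !in_itv/= => /andP[g1 g2] /andP[g3 g4].
    by split; rewrite /ball/= ltr_norml; lra.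
  have de : e <= dist2 (x, y) q0.
    rewrite -(ler_pXn2r (n := 2))// ?nnegrE ?sqrtr_ge0 ?(ltW e0)//.
    rewrite /dist2 sqr_sqrtr ?addr_ge0 ?sqr_ge0//=.
    case/orP: xy => h.
      apply: (@le_trans _ _ ((x - q0.1) ^+ 2)); last by rewrite lerDl sqr_ge0.
      by rewrite -[leRHS]real_normK ?num_real// ler_pXn2r ?nnegrE// ltW.
    apply: (@le_trans _ _ ((y - q0.2) ^+ 2)); last by rewrite lerDr sqr_ge0.
    by rewrite -[leRHS]real_normK ?num_real// ler_pXn2r ?nnegrE// ltW.
  rewrite ler_pdivlMr//; apply: le_trans (HK _ (HS _ Hxy)).
  by rewrite ler_wpM2l ?cmod_ge0.
have inH x y : q0.1 - e <= x <= q0.1 + e -> q0.2 - e <= y <= q0.2 + e -> H (x, y).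
  by move=> xI yI; split; rewrite /= ?in_itv.
have e2x : q0.1 - e <= q0.1 + e by lra.
have e2y : q0.2 - e <= q0.2 + e by lra.
have side_y x : q0.1 - e <= x <= q0.1 + e -> e <= `|x - q0.1| ->
    cmod (imag R * cint mu `[q0.2 - e, q0.2 + e] (fun y => F1 (x, y))) <= 4 * K * eta.
  move=> xI xe; rewrite cmodM cmod_imag mul1r.
  have i_f : cintegrable mu `[q0.2 - e, q0.2 + e] (fun y => F1 (x, y)).
    apply: (@cintegrable_vertical R F1 _ _ x e2y) => y yI.
    have xq : (x != q0.1) || (y != q0.2).
      by apply/orP; left; apply/eqP => xq; move: xe; rewrite xq subrr normr0; lra.
    exact: (cF x y (inH x y xI yI) xq).
  apply: le_trans (cmod_cint_cst_le e2y i_f (M := eta * K / e) _) _.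
    by move=> y yI; apply: bF; rewrite ?xe//; exact: inH.
  by rewrite le_eqVlt; apply/orP; left; apply/eqP; field; rewrite gt_eqF.
have side_x y : q0.2 - e <= y <= q0.2 + e -> e <= `|y - q0.2| ->
    cmod (cint mu `[q0.1 - e, q0.1 + e] (fun x => F1 (x, y) / x%:C)) <= 4 * K / a * eta.
  move=> yI ye; have a0_ := a0.
  have i_f : cintegrable mu `[q0.1 - e, q0.1 + e] (fun x => F1 (x, y) / x%:C).
    have qe0 : 0 < q0.1 - e by have := a0; lra.
    apply: (@cintegrable_horizontal R F1 _ _ y qe0 e2x) => x xI.
    have xq : (x != q0.1) || (y != q0.2).
      by apply/orP; right; apply/eqP => xq; move: ye; rewrite xq subrr normr0; lra.
    exact: (cF x y (inH x y xI yI) xq).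
  apply: le_trans (cmod_cint_cst_le e2x i_f (M := eta * K / e / a) _) _.
    move=> x xI; have x0 : a <= x by case/andP: xI => + _; lra.
    rewrite cmodM cmodV cmod_real ger0_norm; last by lra.
    apply: ler_pM; rewrite ?cmod_ge0// ?invr_ge0; first lra.
      by apply: bF; rewrite ?ye ?orbT//; exact: inH.
    by rewrite lef_pV2// posrE; lra.
  by rewrite le_eqVlt; apply/orP; left; apply/eqP; field; rewrite !gt_eqF.
have area : cmod (2 * imag R * cint mu2 H kg) <= 4 * M * (3 * (2 * pi)) * eta.
  have iH : cintegrable mu2 H kg by apply: cintegrableS cintegrable_pole.
  have iD : mu2.-integrable H (EFin \o (fun q : R * R => (dist2 q q0)^-1)).
    by apply: integrableS (integrable_disc e3); [exact: measurable_disc|exact: mH|exact: Hdisc].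
  rewrite cmodM.
  have -> : cmod (2 * imag R) = 2.
    by rewrite cmodM cmod_imag cmod_nat mulr1.
  have B : cmod (cint mu2 H kg) <= 2 * \int[mu2]_(q in H) (M * (dist2 q q0)^-1).
    apply: (@cmod_cint_le _ _ R mu2 H kg (fun q : R * R => M * (dist2 q q0)^-1) mH iH).
      rewrite (_ : EFin \o _ = (fun q : R * R => M%:E * ((dist2 q q0)^-1)%R%:E)%E)//.
      by apply: integrableZl; [exact: mH|exact: iD].
    by move=> q Hq; exact/HM/HS.
  have E : \int[mu2]_(q in H) (M * (dist2 q q0)^-1) = M * \int[mu2]_(q in H) ((dist2 q q0)^-1).
    by apply: RintegralZl; [exact: mH|exact: iD].
  have B2 := Rintegral_disc e3 mH Hdisc.
  have B3 : M * \int[mu2]_(q in H) ((dist2 q q0)^-1) <= M * (3 * eta * (2 * pi)).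
    by rewrite ler_wpM2l//; exact: le_trans B2 e3eta.
  by move: B; rewrite E => B; exact: arith1 B B3.
have l1 : q0.1 - e <= q0.1 - e <= q0.1 + e by rewrite lexx.
have l2 : q0.1 - e <= q0.1 + e <= q0.1 + e by rewrite lexx andbT.
have l3 : q0.2 - e <= q0.2 - e <= q0.2 + e by rewrite lexx.
have l4 : q0.2 - e <= q0.2 + e <= q0.2 + e by rewrite lexx andbT.
have n1 z : e <= `|z - e - z| by rewrite addrAC subrr add0r normrN ger0_norm// ltW.
have n2 z : e <= `|z + e - z| by rewrite addrAC subrr add0r ger0_norm// ltW.
have s1 := side_x _ l3 (n1 _); have s3 := side_x _ l4 (n2 _).
have s4 := side_y _ l1 (n1 _); have s2 := side_y _ l2 (n2 _).
exact: (arith2 _ _ _ _ _ _ _ _ _ (cmodB_le _ _) (cmodB_le _ _) (cmodB_le _ _)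
  (cmodD _ _) area s4 s2 s3 s1).
Qed.

Lemma pole : bdry a b c d (fun q => W q * kap alpha u q) =
  2 * imag R * cint mu2 S kg + 2 * imag R * (pi / alpha)%:C * W q0.
Proof.
have D0 : defect a b c d F1 kg = 0.
  have [M M0 HM] := F1_small; apply/eqP; rewrite -cmod_eq0 eq_le cmod_ge0 andbT.
  apply/ler_addgt0Pl => eta eta0; rewrite addr0.
  have := HM (eta / (M + 1)); rewrite divr_gt0 ?ltr_wpDl// => /(_ isT) H.
  apply: le_trans H _; rewrite mulrCA ger_pMr// ler_pdivrMr ?ltr_wpDl//; lra.
have ab : a <= b by have := aq; have := qb; lra.
have cd : c <= d by have := cq; have := qd; lra.
have inA x y : a <= x <= b -> c <= y <= d -> [|| x == a, x == b, y == c | y == d] ->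
    (S `\ q0) (x, y).
  move=> xI yI xy; split; first by split; rewrite /= in_itv.
  move=> /= qe; move: xy; have := aq; have := qb; have := cq; have := qd; rewrite -qe/=.
  move=> h1 h2 h3 h4 /or4P[] /eqP E; rewrite E ltxx in h1 h2 h3 h4; by [].
have iF1 : bdry_integrable a b c d F1.
  apply: (continuous_bdry_integrable a0 ab cd _ inA) => q Sq.
  by have [Fr [Ft HF]] := F1_pair; have [[h _ _ _] _] := HF q Sq; exact: h.
have ik : bdry_integrable a b c d (kap alpha u).
  apply: (continuous_bdry_integrable a0 ab cd _ inA) => q Sq.
  by have [Fr [Ft HF]] := kap_pair; have [[h _ _ _] _] := HF q Sq; exact: h.
have -> : (fun q => W q * kap alpha u q) = (fun q => F1 q + W q0 * kap alpha u q).
  by apply/funext => q; rewrite /F1; ring.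
rewrite (bdryD iF1 (bdry_integrableZl (W q0) ik)) (bdryZl (W q0) ik) bdry_kap.
move: D0; rewrite /defect => /eqP; rewrite subr_eq0 => /eqP ->; ring.
Qed.

End pole_lemma.

End pole.

Section geometric_domination.
Context (R : realType).

Lemma cmod_sum_le (s : nat -> C R) m n :
  cmod (\sum_(m <= i < n) s i) <= \sum_(m <= i < n) cmod (s i).
Proof.
elim/big_ind2: _ => [|x1 x2 y1 y2 h1 h2|//]; first by rewrite cmod_real normr0.
by apply: le_trans (cmodD _ _) _; exact: lerD.
Qed.

Lemma sum_geometric_le (B Q : R) m n : 0 <= B -> 0 <= Q -> Q < 1 ->
  \sum_(m <= i < n) B * Q ^+ i <= B / (1 - Q) * Q ^+ m.
Proof.
move=> B0 Q0 Q1; have Q1' : 0 < 1 - Q by rewrite subr_gt0.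
have [mn|/ltnW nm] := leqP m n; last first.
  by rewrite big_geq// mulr_ge0 ?divr_ge0 ?exprn_ge0// ltW.
suff -> : \sum_(m <= i < n) B * Q ^+ i = B / (1 - Q) * (Q ^+ m - Q ^+ n).
  by rewrite ler_wpM2l ?divr_ge0 ?(ltW Q1')// gerBl exprn_ge0.
rewrite -(subnKC mn); elim: (n - m)%N => [|k IH].
  by rewrite addn0 big_geq// subrr mulr0.
rewrite addnS big_nat_recr ?leq_addr//= IH exprS; field.
by rewrite gt_eqF.
Qed.

Lemma cseries_geometric (s : nat -> C R) (B Q : R) : 0 <= Q -> Q < 1 ->
  (forall n, (0 < n)%N -> cmod (s n) <= B * Q ^+ n) ->
  exists l : C R, (\sum_(1 <= i < n) s i @[n --> \oo] --> l) /\
    forall n, (0 < n)%N -> cmod (l - \sum_(1 <= i < n) s i) <= B / (1 - Q) * Q ^+ n.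
Proof.
move=> Q0 Q1 sB; have Q1' : 0 < 1 - Q by rewrite subr_gt0.
have [Q00|Q00] := eqVneq Q 0.
  have s0 n : (0 < n)%N -> s n = 0.
    move=> n0; apply/eqP; rewrite -cmod_eq0 eq_le cmod_ge0 andbT.
    by have := sB n n0; rewrite Q00 expr0n gtn_eqF// mulr0.
  have S0 n : \sum_(1 <= i < n) s i = 0.
    by rewrite big_nat; apply: big1 => i /andP[i0 _]; exact: s0.
  exists 0; split; first by rewrite (eq_cvg _ _ S0); exact: cvg_cst.
  by move=> n n0; rewrite S0 subrr cmod_real normr0 Q00 expr0n gtn_eqF// mulr0.
have Qgt0 : 0 < Q by rewrite lt_neqAle eq_sym Q00.
have B0 : 0 <= B.
  have := le_trans (cmod_ge0 _) (sB 1%N isT); rewrite expr1.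
  by rewrite pmulr_lge0.
have key (f : C R -> R) : (forall z, `|f z| <= cmod z) -> (forall x y, f (x + y) = f x + f y) ->
    f 0 = 0 -> exists l : R, f (\sum_(1 <= i < n) s i) @[n --> \oo] --> l.
  move=> fm fD f0.
  pose t n := if (0 < n)%N then f (s n) else 0.
  have ct : cvgn (series t).
    apply: normed_cvg; apply: (@series_le_cvg _ _ (geometric B Q)).
    - by move=> n; exact: normr_ge0.
    - by move=> n; apply: mulr_ge0 => //; exact: exprn_ge0.
    - move=> n; rewrite /t; case: n => [|n] /=; first by rewrite normr0 mulr_ge0.
      by apply: le_trans (fm _) (sB _ _).
    - by apply: is_cvg_geometric_series; rewrite ger0_norm.
  exists (limn (series t)).
  rewrite (_ : (fun n => _) = series t)//; apply/funext => n.
  rewrite /series/=; case: n => [|n]; first by rewrite !big_geq.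
  rewrite [RHS]big_nat_recl// [t 0%N]/(0 : R) add0r big_add1.
  rewrite /t/=.
  by elim/big_ind2: _ => // x1 x2 y1 y2 <- <-.
have [l1 H1] := key (@complex.Re R) (@Re_le_cmod R) (@ReD R) erefl.
have [l2 H2] := key (@complex.Im R) (@Im_le_cmod R) (@ImD R) erefl.
have cl : \sum_(1 <= i < n) s i @[n --> \oo] --> (l1 +i* l2 : C R) by apply/cvg_complexP.
exists (l1 +i* l2); split => // n n0.
apply/ler_addgt0Pl => e e0.
move/cvg_cmodP : (cl) => /(_ e e0)[N _ HN].
have := HN (maxn N n) (leq_maxl _ _); set M := maxn N n => /= hM.
rewrite (_ : _ - _ = (l1 +i* l2 - \sum_(1 <= i < M) s i) + \sum_(n <= i < M) s i); last first.
  by rewrite (big_cat_nat (n := n) (p := M))//= ?leq_maxr//; ring.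
apply: le_trans (cmodD _ _) _; apply: lerD; first exact: ltW.
apply: le_trans (cmod_sum_le _ _ _) _.
apply: le_trans (sum_geometric_le _ _ _ Q0 Q1) => //.
by rewrite !big_nat; apply: ler_sum => i /andP[ni _]; apply: sB; exact: leq_trans ni.
Qed.

End geometric_domination.

Section kernel_terms.
Context (R : realType).
Variables (a Q : R).
Hypotheses (a0 : 0 < a) (a1 : a < 1) (Qa : Q = a ^+ 2).
Implicit Types p v : C R.

Let Q0 : 0 < Q. Proof. by rewrite Qa exprn_gt0. Qed.
Let Q1 : Q < a. Proof. by rewrite Qa expr2 gtr_pMr. Qed.

Definition kv p v : C R := v / (v - p).

Lemma kv_subr1 p v : v != p -> kv p v - 1 = p / (v - p).
Proof. by move=> vp; rewrite /kv; field; rewrite subr_eq0. Qed.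

Definition kterm n p v : C R :=
  kv (p / (Q ^+ n)%:C) v + (kv ((Q ^+ n)%:C * p) v - 1) +
  (kv ((Q ^+ n)%:C / p) v - 1) + kv (1 / ((Q ^+ n)%:C * p)) v.

Lemma cmod_div_le (x y : C R) (X Y : R) : cmod x <= X -> 0 < Y -> Y <= cmod y ->
  cmod (x / y) <= X / Y.
Proof.
move=> xX Y0 Yy; rewrite cmodM cmodV ler_pM ?cmod_ge0 ?invr_ge0 ?cmod_ge0//.
by rewrite lef_pV2// posrE (lt_le_trans Y0).
Qed.

Definition kbound p : R := (cmod p - Q)^-1 + (a - Q)^-1 + (a * cmod p - Q)^-1 + (1 - Q)^-1.

Lemma kterm_bounds n p v : (0 < n)%N -> a < cmod p < 1 -> a <= cmod v <= 1 ->
  [/\ cmod (kv (p / (Q ^+ n)%:C) v) <= (cmod p - Q)^-1 * Q ^+ n,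
      cmod (kv ((Q ^+ n)%:C * p) v - 1) <= (a - Q)^-1 * Q ^+ n,
      cmod (kv ((Q ^+ n)%:C / p) v - 1) <= (a * cmod p - Q)^-1 * Q ^+ n &
      cmod (kv (1 / ((Q ^+ n)%:C * p)) v) <= (1 - Q)^-1 * Q ^+ n].
Proof.
move=> n0 /andP[ap p1] /andP[av v1]; set q := Q ^+ n.
have Qa1 := Q1; have a1' := a1; have a0' := a0.
have aap : Q < a * cmod p by rewrite Qa expr2 ltr_pM2l.
have q0 : 0 < q by rewrite exprn_gt0.
have qQ : q <= Q.
  by rewrite /q -[leRHS]expr1 ler_wiXn2l// ltW//; lra.
have p0 : 0 < cmod p by lra.
have pn0 : p != 0 by rewrite -cmod_eq0 gt_eqF.
have qn0 : (q%:C : C R) != 0 by rewrite -cmod_eq0 cmod_real gtr0_norm// gt_eqF.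
have mq : cmod (q%:C) = q by rewrite cmod_real gtr0_norm.
have far p' (Y : R) : 0 < Y -> Y <= cmod (v - p') -> v != p'.
  by move=> Y0; apply: contraTneq => ->; rewrite subrr cmod_real normr0 -ltNge.
have B1 : cmod (kv (p / q%:C) v) <= (cmod p - Q)^-1 * q.
  have -> : (cmod p - Q)^-1 * q = 1 / ((cmod p - Q) / q).
    by rewrite invf_div mul1r mulrC.
  apply: cmod_div_le => //; first by rewrite divr_gt0//; lra.
  rewrite cmodB; apply: le_trans (cmod_subl _ _); rewrite cmodM cmodV mq.
  by rewrite mulrBl lerB// ler_pdivlMr//; nra.
have B2 : cmod (kv (q%:C * p) v - 1) <= (a - Q)^-1 * q.
  have Y0 : 0 < a - Q by lra.
  have Yv : a - Q <= cmod (v - q%:C * p).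
    by apply: le_trans (cmod_subl _ _); rewrite cmodM mq; nra.
  rewrite kv_subr1; last exact: far Yv.
  by rewrite [leRHS]mulrC; apply: cmod_div_le => //; rewrite cmodM mq; nra.
have B3 : cmod (kv (q%:C / p) v - 1) <= (a * cmod p - Q)^-1 * q.
  have Y0 : 0 < (a * cmod p - Q) / cmod p by rewrite divr_gt0// subr_gt0.
  have Yv : (a * cmod p - Q) / cmod p <= cmod (v - q%:C / p).
    apply: le_trans (cmod_subl _ _); rewrite cmodM cmodV mq mulrBl mulfK ?gt_eqF//.
    by rewrite lerB// ler_pM2r// invr_gt0.
  rewrite kv_subr1; last exact: far Yv.
  have -> : (a * cmod p - Q)^-1 * q = (q / cmod p) / ((a * cmod p - Q) / cmod p).
    by field; rewrite !gt_eqF// subr_gt0.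
  by apply: cmod_div_le => //; rewrite cmodM cmodV mq.
have B4 : cmod (kv (1 / (q%:C * p)) v) <= (1 - Q)^-1 * q.
  have -> : (1 - Q)^-1 * q = 1 / ((1 - Q) / q) by rewrite invf_div mul1r mulrC.
  apply: cmod_div_le => //; first by rewrite divr_gt0//; lra.
  rewrite cmodB; apply: le_trans (cmod_subl _ _); rewrite cmodM cmodV cmodM mq.
  rewrite mulrBl lerB//; last by rewrite ler_pdivlMr//; nra.
  rewrite cmod_real normr1 !mul1r lef_pV2 ?posrE ?mulr_gt0//; nra.
by split.
Qed.

Lemma kterm_bound n p v : (0 < n)%N -> a < cmod p < 1 -> a <= cmod v <= 1 ->
  cmod (kterm n p v) <= kbound p * Q ^+ n.
Proof.
move=> n0 pI vI; have [B1 B2 B3 B4] := kterm_bounds n0 pI vI.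
rewrite /kterm /kbound !mulrDl.
by do 3 (apply: le_trans (cmodD _ _) _; apply: lerD => //).
Qed.

End kernel_terms.

Ltac nonzero := repeat (apply/andP; split); match goal with
  | d : is_true (~~ (@eq_op _ ?e _)) |- is_true (~~ (@eq_op _ ?f _)) => first
    [ exact: d | (have -> : f = e by ring); exact: d
    | (have -> : f = - e by ring); rewrite oppr_eq0; exact: d ] end.

Section kernel_algebra.
Context (K : fieldType).
Implicit Types p q v : K.

Let kv p v := v / (v - p).
Let kt q p v := kv (p / q) v + (kv (q * p) v - 1) + (kv (q / p) v - 1) + kv (1 / (q * p)) v.

Variables (p q v : K).
Hypotheses (p0 : p != 0) (q0 : q != 0) (v0 : v != 0).

Section terms.
Hypotheses (d1 : q * v - p != 0) (d2 : v - q * p != 0) (d3 : p * v - q != 0)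
  (d4 : q * p * v - 1 != 0).

Lemma H2_term_algebra :
  q * (1 / (q * v - p) - p / (v * (q * p - v)) - 1 / (v * (q - p * v)) + p / (q * p * v - 1))
  = v^-1 * kt q p v.
Proof.
rewrite /kt /kv; field; nonzero.
Qed.

Lemma kt_inv : kt q p v^-1 = - kt q p v.
Proof.
rewrite /kt /kv; field; nonzero.
Qed.

Lemma H1_term_unit :
  q * (v / (q * v - p) - p / (q * p - v) - v^-1 / (q * v^-1 - p) + p / (q * p - v^-1)) =
  kt q p v.
Proof.
rewrite /kt /kv; field; nonzero.
Qed.

Variable Q : K.
Hypotheses (e1 : q * p * v - Q != 0) (e2 : p * v - Q * q != 0).

Lemma H1_term_inner :
  q * (v / (q * v - p) - p / (q * p - v) - (Q / v) / (q * (Q / v) - p) + p / (q * p - Q / v)) =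
  kt q p v + ((kv (Q * q / p) v - 1 - kv (1 / (q * p)) v) -
    (kv (q / p) v - 1 - kv (Q / (q * p)) v)).
Proof.
rewrite /kt /kv; field; nonzero.
Qed.

Hypotheses (e3 : q * v - Q * p != 0) (e4 : v - Q * q * p != 0).

Lemma kt_inner : kt q p v + kt q p (Q / v) =
  (kv (p / q) v + kv (1 / (q * p)) v - ((kv (Q * q * p) v - 1) + (kv (Q * q / p) v - 1))) -
  (kv (Q * p / q) v + kv (Q / (q * p)) v - ((kv (q * p) v - 1) + (kv (q / p) v - 1))).
Proof.
rewrite /kt /kv; field; nonzero.
Qed.

End terms.

Hypotheses (c1 : v - p != 0) (c2 : p * v - 1 != 0).

Lemma H1_head_unit : (v + p) / (v - p) - (v^-1 + p) / (v^-1 - p) =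
  2 * (kv p v + kv (1 / p) v - 1).
Proof.
rewrite /kv; field; nonzero.
Qed.

Lemma kv_inv : kv p v^-1 + kv (1 / p) v^-1 = 2 - (kv p v + kv (1 / p) v).
Proof.
rewrite /kv; field; nonzero.
Qed.

Section heads.
Variable Q : K.
Hypotheses (c3 : p * v - Q != 0) (c4 : v - Q * p != 0).

Lemma H1_head_inner : (v + p) / (v - p) - (Q / v + p) / (Q / v - p) =
  2 * (kv p v + (kv (Q / p) v - 1)).
Proof.
rewrite /kv; field; nonzero.
Qed.

Lemma kv_inner : kv p (Q / v) + kv (1 / p) (Q / v) =
  - ((kv (Q * p) v - 1) + (kv (Q / p) v - 1)).
Proof.
rewrite /kv; field; nonzero.
Qed.

End heads.

End kernel_algebra.

Section kernels.
Context (R : realType).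
Variables (alpha r : R).
Hypotheses (alpha0 : 0 < alpha) (r0 : 0 < r) (r1 : r < 1).
Implicit Types p v : C R.

Let a := r `^ alpha.
Let Q := a ^+ 2.

Let a0 : 0 < a. Proof. exact: powR_gt0. Qed.

Let a1 : a < 1.
Proof.
suff : r `^ alpha < 1 `^ alpha by rewrite powR1.
by apply: gt0_ltr_powR; rewrite ?nnegrE ?(ltW r0) ?ler01.
Qed.

Let Q0 : 0 < Q. Proof. by rewrite exprn_gt0. Qed.
Let Qa : Q < a. Proof. by rewrite /Q expr2 gtr_pMr. Qed.
Let Q1 : Q < 1. Proof. exact: lt_trans Qa a1. Qed.

Lemma powR_nome (n : nat) : r `^ (2 * alpha * n%:R) = Q ^+ n.
Proof.
rewrite powRrM powR_mulrn ?powR_ge0//; congr (_ ^+ _).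
by rewrite /Q /a mulrC powRrM powR_mulrn// powR_ge0.
Qed.

Lemma sub_neq0_lt (x y : C R) : cmod x < cmod y -> x - y != 0.
Proof. by move=> xy; rewrite subr_eq0; apply: contraTneq xy => ->; rewrite ltxx. Qed.

Lemma sub_neq0_gt (x y : C R) : cmod y < cmod x -> x - y != 0.
Proof. by move=> xy; rewrite subr_eq0; apply: contraTneq xy => ->; rewrite ltxx. Qed.

Let cmodQ (n : nat) : cmod ((Q ^+ n)%:C : C R) = Q ^+ n.
Proof. by rewrite cmod_real ger0_norm// exprn_ge0// ltW. Qed.

Let Qn_neq0 (n : nat) : ((Q ^+ n)%:C : C R) != 0.
Proof. by rewrite -cmod_eq0 cmodQ gt_eqF// exprn_gt0. Qed.

Let QnQ (n : nat) : (0 < n)%N -> Q ^+ n <= Q.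
Proof.
by move=> n0; rewrite -[leRHS]expr1; apply: ler_wiXn2l => //; exact: ltW.
Qed.

Lemma kernel_denominators n p v : (0 < n)%N -> a < cmod p < 1 -> a <= cmod v <= 1 ->
  [/\ v != 0, p != 0, (Q ^+ n)%:C * v - p != 0 & v - (Q ^+ n)%:C * p != 0] /\
  [/\ p * v - (Q ^+ n)%:C != 0, (Q ^+ n)%:C * p * v - 1 != 0 & p * v - 1 != 0].
Proof.
move=> n0 /andP[ap p1] /andP[av v1]; have qQ := QnQ n0.
have q0 : 0 < Q ^+ n by rewrite exprn_gt0.
have h1 := Qa; have h2 := Q1; have h3 := a0; have h4 := a1.
have qv : Q ^+ n * cmod v <= Q by apply: le_trans qQ; rewrite ler_piMr// ltW.
have qp : Q ^+ n * cmod p <= Q by apply: le_trans qQ; rewrite ler_piMr// ltW.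
have pv : Q < cmod p * cmod v.
  apply: (@lt_le_trans _ _ (cmod p * a)); first by rewrite /Q expr2 ltr_pM2r.
  by rewrite ler_wpM2l ?cmod_ge0.
have pv1 : cmod p * cmod v < 1.
  by apply: le_lt_trans p1; rewrite ler_piMr ?cmod_ge0.
have qpv : Q ^+ n * cmod p * cmod v <= Q.
  by apply: le_trans qp; rewrite ler_piMr// mulr_ge0 ?cmod_ge0// ltW.
do 2 split.
- by rewrite -cmod_eq0 gt_eqF//; lra.
- by rewrite -cmod_eq0 gt_eqF//; lra.
- by apply: sub_neq0_lt; rewrite cmodM cmodQ; lra.
- by apply: sub_neq0_gt; rewrite cmodM cmodQ; lra.
- by apply: sub_neq0_gt; rewrite cmodM cmodQ; lra.
- by apply: sub_neq0_lt; rewrite !cmodM cmodQ cmod_real normr1; lra.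
- by apply: sub_neq0_lt; rewrite !cmodM cmod_real normr1.
Qed.

Definition kpart n p v : C R :=
  kv p v + kv (1 / p) v + \sum_(1 <= i < n) kterm Q i p v.

Lemma complex_hausdorff : hausdorff_space (C R).
Proof. exact: (@norm_hausdorff _ (C R)^o). Qed.

Lemma cvg_uniqC (F : set_system nat) (FF : ProperFilter F) (f : nat -> C R) (l1 l2 : C R) :
  f @ F --> l1 -> f @ F --> l2 -> l1 = l2.
Proof. by move=> h1 h2; apply: (cvg_unique complex_hausdorff h1 h2). Qed.

Let pv_bound p v := a < cmod p < 1 /\ a <= cmod v <= 1.

Lemma kernel_series p v : pv_bound p v ->
  kpart n p v @[n --> \oo] --> v * H2 alpha r p v /\
  forall n, (0 < n)%N ->
    cmod (v * H2 alpha r p v - kpart n p v) <= kbound a Q p / (1 - Q) * Q ^+ n.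
Proof.
move=> [pI vI].
have [l [cl bl]] := cseries_geometric (ltW Q0) Q1
  (fun n n0 => kterm_bound a0 a1 erefl n0 pI vI).
have [[v0 p0 _ _] [_ _ d5]] := kernel_denominators (isT : 0 < 1)%N pI vI.
suff E : v * H2 alpha r p v = kv p v + kv (1 / p) v + l.
  rewrite E; split; first by apply: cvgD; [exact: cvg_cst|exact: cl].
  move=> n n0; rewrite /kpart opprD addrACA subrr add0r; exact: bl.
have ct : \sum_(1 <= n < m) ((Q ^+ n)%:C * (1 / ((Q ^+ n)%:C * v - p) -
    p / (v * ((Q ^+ n)%:C * p - v)) - 1 / (v * ((Q ^+ n)%:C - p * v)) +
    p / ((Q ^+ n)%:C * p * v - 1))) @[m --> \oo] --> v^-1 * l.
  rewrite (_ : (fun m => _) = (fun m => v^-1 * \sum_(1 <= i < m) kterm Q i p v)).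
    by apply: cvgM; [exact: cvg_cst|exact: cl].
  apply/funext => m; rewrite mulr_sumr; apply: eq_big_nat => n /andP[n0 _].
  have [[_ _ d1 d2] [d3 d4 _]] := kernel_denominators n0 pI vI.
  exact: (H2_term_algebra p0 (Qn_neq0 n) v0 d1 d2 d3 d4).
rewrite /H2.
under eq_fun do (under eq_bigr do rewrite powR_nome).
rewrite (cvg_lim complex_hausdorff ct) mulrDr mulVKf//; congr (_ + _).
rewrite mulrBr [v * (1 / _)]mulrA mulr1 /kv; congr (_ + _).
by field; nonzero.
Qed.

Let Q_neq0 : (Q%:C : C R) != 0.
Proof. by have := Qn_neq0 1; rewrite expr1. Qed.

Let QnS n : ((Q ^+ n.+1)%:C : C R) = Q%:C * (Q ^+ n)%:C.
Proof. by rewrite exprS rmorphM. Qed.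

Lemma kpart_unit n p v : pv_bound p v -> cmod v = 1 ->
  kpart n p v^-1 = 2 - kpart n p v.
Proof.
move=> [pI vI] v1.
have [[v0 p0 _ _] [_ _ d5]] := kernel_denominators (isT : 0 < 1)%N pI vI.
have c1 : v - p != 0 by apply: sub_neq0_gt; rewrite v1; case/andP: pI.
rewrite /kpart (kv_inv p0 v0 c1 d5) [in RHS]opprD addrA; congr (_ + _).
rewrite -sumrN; apply: eq_big_nat => i /andP[i0 _].
have [[_ _ e1 e2] [e3 e4 _]] := kernel_denominators i0 pI vI.
exact: (kt_inv p0 (Qn_neq0 i) v0 e1 e2 e3 e4).
Qed.

Let cvg_Qn (B : R) : B * Q ^+ n @[n --> \oo] --> 0.
Proof.
rewrite -(mulr0 B); apply: cvgM; first exact: cvg_cst.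
by apply: cvg_expr; rewrite ger0_norm ?ltW// Q1.
Qed.

Let cvg_squeeze (f : nat -> C R) (B : R) :
  (forall n, (0 < n)%N -> cmod (f n) <= B * Q ^+ n) -> f n @[n --> \oo] --> (0 : C R).
Proof.
move=> fB; apply/cvg_cmodP => e e0.
have /cvgrPdist_lt/(_ e e0)[N _ HN] := cvg_Qn B.
exists N.+1 => // n /= Nn; rewrite sub0r cmodN.
apply: le_lt_trans (fB n (leq_ltn_trans (leq0n _) Nn)) _.
by have := HN n (ltnW Nn); rewrite sub0r normrN; apply: le_lt_trans; exact: ler_norm.
Qed.

Let tail_inner n p v :=
  kv (p * Q%:C / (Q ^+ n)%:C) v + kv (Q%:C / ((Q ^+ n)%:C * p)) v -
  ((kv ((Q ^+ n)%:C * p) v - 1) + (kv ((Q ^+ n)%:C / p) v - 1)).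

Let tail_innerS n p v : (0 < n)%N -> tail_inner n.+1 p v =
  kv (p / (Q ^+ n)%:C) v + kv (1 / ((Q ^+ n)%:C * p)) v -
  ((kv ((Q ^+ n.+1)%:C * p) v - 1) + (kv ((Q ^+ n.+1)%:C / p) v - 1)).
Proof.
have E1 (x y z : C R) : z != 0 -> x * z / (z * y) = x / y.
  by move=> z0; rewrite [z * y]mulrC invfM mulrACA mulfV// mulr1.
have E2 (x y z : C R) : z != 0 -> z / (z * y * x) = 1 / (y * x).
  by move=> z0; rewrite -mulrA invfM mulrA mulfV.
by move=> n0; rewrite /tail_inner !QnS E1// E2.
Qed.

Lemma kpart_inner n p v : (0 < n)%N -> pv_bound p v -> cmod v = a ->
  kpart n p v + kpart n p (Q%:C / v) = tail_inner n p v.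
Proof.
move=> n0 [pI vI] va; have [ap p1] := andP pI.
have [[v0 p0 _ d6] [d7 _ d5]] := kernel_denominators (isT : 0 < 1)%N pI vI.
rewrite expr1 in d6 d7.
have c1 : v - p != 0 by apply: sub_neq0_lt; rewrite va.
rewrite /kpart (kv_inner p0 v0 d7 d6) addrACA -big_split/=.
have E i : (1 <= i < n)%N -> kterm Q i p v + kterm Q i p (Q%:C / v) =
    tail_inner i.+1 p v - tail_inner i p v.
  move=> /andP[i0 _]; rewrite tail_innerS// !QnS /tail_inner.
  have [[_ _ e1 e2] [e3 e4 _]] := kernel_denominators i0 pI vI.
  have [[_ _ _ f2] [f3 _ _]] := kernel_denominators (isT : 0 < i.+1)%N pI vI.
  rewrite QnS in f2 f3.
  have qQ := QnQ i0; have q0 : 0 < Q ^+ i by rewrite exprn_gt0.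
  have cQ : cmod (Q%:C : C R) = Q by rewrite cmod_real ger0_norm// ltW.
  have g1 : (Q ^+ i)%:C * p * v - Q%:C != 0.
    apply: sub_neq0_lt; rewrite !cmodM cmodQ cQ va.
    apply: (@le_lt_trans _ _ (Q * (cmod p * a))).
      by rewrite -mulrA ler_wpM2r// mulr_ge0 ?cmod_ge0// ltW.
    by rewrite gtr_pMr// mulr_ilt1 ?cmod_ge0// ltW.
  have g3 : (Q ^+ i)%:C * v - Q%:C * p != 0.
    apply: sub_neq0_lt; rewrite !cmodM cmodQ cQ va.
    apply: (@le_lt_trans _ _ (Q * a)); first by rewrite ler_wpM2r// ltW.
    by rewrite ltr_pM2l.
  rewrite /kterm (kt_inner p0 (Qn_neq0 i) v0 e1 e2 e3 e4 g1 f3 g3 f2).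
  by rewrite (mulrC p (Q%:C)).
rewrite (eq_big_nat _ _ E) telescope_sumr// /tail_inner expr1.
rewrite mulfK//.
have -> : Q%:C / (Q%:C * p) = 1 / p by rewrite invfM mulrA mulfV.
by rewrite /kv; ring.
Qed.

Let tail_inner_cvg p v : pv_bound p v -> tail_inner n p v @[n --> \oo] --> (0 : C R).
Proof.
move=> [pI vI].
pose B := (cmod p - Q)^-1 + (1 - Q)^-1 + ((a - Q)^-1 + (a * cmod p - Q)^-1).
suff H : (fun n => tail_inner n.+1 p v) @ \oo --> (0 : C R) by rewrite -cvg_shiftS.
apply: (cvg_squeeze (B := B)) => n n0; rewrite tail_innerS//.
have [B1 _ _ B4] := kterm_bounds a0 a1 erefl n0 pI vI.
have [_ B2 B3 _] := kterm_bounds a0 a1 erefl (isT : (0 < n.+1)%N) pI vI.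
have qS (k : R) : 0 <= k -> k * Q ^+ n.+1 <= k * Q ^+ n.
  by move=> k0; rewrite ler_wpM2l// exprS ler_piMl ?exprn_ge0// ltW// Q1.
have [ap p1] := andP pI.
have aap : Q < a * cmod p by rewrite /Q expr2 ltr_pM2l.
have {}B2 := le_trans B2 (qS _ _); have {}B3 := le_trans B3 (qS _ _).
rewrite /B !mulrDl; apply: le_trans (cmodB_le _ _) _; apply: lerD.
  by apply: le_trans (cmodD _ _) _; exact: lerD.
apply: le_trans (cmodD _ _) _; apply: lerD.
  by apply: B2; rewrite invr_ge0 subr_ge0 ltW.
by apply: B3; rewrite invr_ge0 subr_ge0 ltW.
Qed.

Let pv_conj p v : pv_bound p v -> pv_bound p (conjc v).
Proof. by move=> [pI vI]; split; rewrite ?cmod_conj. Qed.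

Let conjc_inv (s : R) v : 0 < s -> cmod v ^+ 2 = s -> conjc v = s%:C / v.
Proof.
move=> s0 vs; have v0 : v != 0.
  rewrite -cmod_eq0; apply: contraTneq s0 => v0.
  by rewrite -vs v0 expr0n ltxx.
apply: (mulIf v0); rewrite mulfVK// -vs cmod_sqr.
by apply: complexP; rewrite ?ReM ?ImM ?Re_conjc ?Im_conjc/=; ring.
Qed.

Lemma H2_conj_unit p v : pv_bound p v -> cmod v = 1 ->
  conjc v * H2 alpha r p (conjc v) = 2 - v * H2 alpha r p v.
Proof.
move=> pvb v1; have [h1 _] := kernel_series pvb.
have [h2 _] := kernel_series (pv_conj pvb).
apply: cvg_uniqC h2 _.
rewrite (_ : (fun n => _) = (fun n => 2 - kpart n p v)).
  by apply: cvgB; [exact: cvg_cst|exact: h1].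
apply/funext => n; rewrite (conjc_inv ltr01) ?v1 ?expr1n// mul1r.
exact: kpart_unit.
Qed.

Lemma H2_conj_inner p v : pv_bound p v -> cmod v = a ->
  conjc v * H2 alpha r p (conjc v) = - (v * H2 alpha r p v).
Proof.
move=> pvb va; have [h1 _] := kernel_series pvb.
have [h2 _] := kernel_series (pv_conj pvb).
have h3 := tail_inner_cvg pvb.
apply/eqP; rewrite -addr_eq0 addrC; apply/eqP; apply: cvg_uniqC h3.
have : (kpart n p v + kpart n p (conjc v)) @[n --> \oo] -->
    v * H2 alpha r p v + conjc v * H2 alpha r p (conjc v).
  by apply: cvgD; [exact: h1|exact: h2].
apply: cvg_trans; apply: near_eq_cvg; exists 1%N => // n /= n0.
by rewrite (conjc_inv Q0) ?va// -kpart_inner.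
Qed.

Lemma conj_H2 p v : pv_bound p v ->
  conjc (v * H2 alpha r (conjc p) v) = conjc v * H2 alpha r p (conjc v).
Proof.
move=> pvb; have [h2 _] := kernel_series (pv_conj pvb).
have pvb' : pv_bound (conjc p) v by case: pvb => pI vI; split; rewrite ?cmod_conj.
have [/cvg_conjc h1 _] := kernel_series pvb'.
apply: cvg_uniqC h1 _.
rewrite (_ : (fun n => _) = (fun n => kpart n p (conjc v)))//; apply/funext => n.
have cjD (x y : C R) : conjc (x + y : C R) = (conjc x : C R) + conjc y by exact: (rmorphD (@conjc R)).
have cjB (x y : C R) : conjc (x - y : C R) = (conjc x : C R) - conjc y by exact: (rmorphB (@conjc R)).
have cjM (x y : C R) : conjc (x * y : C R) = (conjc x : C R) * conjc y by exact: (rmorphM (@conjc R)).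
have cjV (x : C R) : conjc (x^-1 : C R) = (conjc x : C R)^-1 by exact: (fmorphV (@conjc R)).
have cj1 : conjc (1 : C R) = 1 by exact: (rmorph1 (@conjc R)).
have cjr (x : R) : conjc (x%:C : C R) = x%:C by rewrite /= oppr0.
have cjM' (x y : R[i]) : conjc (x * y) = conjc x * conjc y by exact: (rmorphM (@conjc R)).
have cjV' (x : R[i]) : conjc x^-1 = (conjc x)^-1 by exact: (fmorphV (@conjc R)).
have cjk (x y : C R) : conjc (kv x y) = kv (conjc x) (conjc y).
  transitivity ((conjc y : C R) * conjc ((y - x)^-1 : C R)); first exact: cjM.
  rewrite /kv; congr (_ * _); transitivity ((conjc (y - x : C R) : C R)^-1).
    exact: cjV.
  by congr (_^-1); exact: cjB.
have cj1p (x : C R) : conjc (1 / x) = 1 / conjc x.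
  transitivity ((conjc (1 : C R) : C R) * conjc (x^-1 : C R)); first exact: cjM.
  by rewrite cj1; congr (_ * _); exact: cjV.
rewrite /kpart !cjD !cjk cj1p conjcK; congr (_ + _).
rewrite (big_morph _ cjD (conjc0 R)); apply: eq_bigr => i _.
have cjN1 : conjc (- 1 : C R) = - 1 by apply: complexP; rewrite /= ?oppr0.
rewrite /kterm !cjD !cjk !cjN1 cj1p.
by rewrite !(cjM, cjM') ?(cjV,cjV') ?cjr !conjcK.
Qed.

Let H1_term (p v v' : C R) n : C R := (Q ^+ n)%:C *
  (v / ((Q ^+ n)%:C * v - p) - p / ((Q ^+ n)%:C * p - v)
   - v' / ((Q ^+ n)%:C * v' - p) + p / ((Q ^+ n)%:C * p - v')).

Let H1E p v (l : C R) : \sum_(1 <= n < m) H1_term p v (conjc v) n @[m --> \oo] --> l ->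
  H1 alpha r p v = (v + p) / (v - p) - (conjc v + p) / (conjc v - p) + 2 * l.
Proof.
move=> hl; rewrite /H1; under eq_fun do (under eq_bigr do rewrite powR_nome).
congr (_ + 2 * _); exact: (cvg_lim complex_hausdorff hl).
Qed.

Let kterm_series p v : pv_bound p v -> \sum_(1 <= i < n) kterm Q i p v @[n --> \oo] -->
  v * H2 alpha r p v - (kv p v + kv (1 / p) v).
Proof.
move=> /kernel_series[h _].
rewrite (_ : (fun n => _) = (fun n => kpart n p v - (kv p v + kv (1 / p) v))).
  by apply: cvgB; [exact: h|exact: cvg_cst].
by apply/funext => n; rewrite /kpart addrAC subrr add0r.
Qed.

Lemma H1_unit p v : pv_bound p v -> cmod v = 1 ->
  H1 alpha r p v = 2 * (v * H2 alpha r p v - 1).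
Proof.
move=> pvb v1; have [pI vI] := pvb.
have [[v0 p0 _ _] [_ _ d5]] := kernel_denominators (isT : 0 < 1)%N pI vI.
have c1 : v - p != 0 by apply: sub_neq0_gt; rewrite v1; case/andP: pI.
have vE : conjc v = v^-1 by rewrite (conjc_inv ltr01) ?v1 ?expr1n// mul1r.
have E : (fun m => \sum_(1 <= n < m) H1_term p v (conjc v) n) =
    (fun m => \sum_(1 <= i < m) kterm Q i p v).
  apply/funext => m; apply: eq_big_nat => n /andP[n0 _]; rewrite /H1_term vE.
  have [[_ _ e1 e2] [e3 e4 _]] := kernel_denominators n0 pI vI.
  exact: (H1_term_unit p0 (Qn_neq0 n) v0 e1 e2 e3 e4).
have := kterm_series pvb; rewrite -E => /H1E ->.
by rewrite vE (H1_head_unit p0 v0 c1 d5) -/(kv _ _) -/(kv _ _); ring.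
Qed.

Lemma H1_inner p v : pv_bound p v -> cmod v = a ->
  H1 alpha r p v = 2 * (v * H2 alpha r p v).
Proof.
move=> pvb va; have [pI vI] := pvb; have [ap p1] := andP pI.
have [[v0 p0 _ _] [d7 _ d5]] := kernel_denominators (isT : 0 < 1)%N pI vI.
rewrite expr1 in d7.
have c1 : v - p != 0 by apply: sub_neq0_lt; rewrite va.
have vE : conjc v = Q%:C / v by rewrite (conjc_inv Q0) ?va.
pose f n := kv ((Q ^+ n)%:C / p) v - 1 - kv (Q%:C / ((Q ^+ n)%:C * p)) v.
have fS n : f n.+1 = kv ((Q ^+ n.+1)%:C / p) v - 1 - kv (1 / ((Q ^+ n)%:C * p)) v.
  by rewrite /f; congr (_ - kv _ _); rewrite QnS -mulrA invfM mulrA mulfV.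
have aap : Q < a * cmod p by rewrite /Q expr2 ltr_pM2l.
have f0 : f n @[n --> \oo] --> (0 : C R).
  suff H : (fun n => f n.+1) @ \oo --> (0 : C R) by rewrite -cvg_shiftS.
  apply: (cvg_squeeze (B := (a * cmod p - Q)^-1 + (1 - Q)^-1)) => n n0; rewrite fS.
  have [_ _ _ B4] := kterm_bounds a0 a1 erefl n0 pI vI.
  have [_ _ B3 _] := kterm_bounds a0 a1 erefl (isT : (0 < n.+1)%N) pI vI.
  rewrite mulrDl; apply: le_trans (cmodB_le _ _) _; apply: lerD B4.
  apply: le_trans B3 _; rewrite ler_wpM2l ?invr_ge0 ?subr_ge0 ?ltW//.
  by rewrite exprS gtr_pMl ?exprn_gt0 ?Q1.
have E : (fun m => \sum_(1 <= n < m) H1_term p v (conjc v) n) =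
    (fun m => \sum_(1 <= i < m) kterm Q i p v + \sum_(1 <= i < m) (f i.+1 - f i)).
  apply/funext => m; rewrite -big_split; apply: eq_big_nat => n /andP[n0 _].
  rewrite /H1_term vE fS /f QnS.
  have [[_ _ e1 e2] [e3 e4 _]] := kernel_denominators n0 pI vI.
  have [_ [f3 _ _]] := kernel_denominators (isT : 0 < n.+1)%N pI vI.
  rewrite QnS in f3.
  have g1 : (Q ^+ n)%:C * p * v - Q%:C != 0.
    have qQ := QnQ n0; have q0 : 0 < Q ^+ n by rewrite exprn_gt0.
    have cQ : cmod (Q%:C : C R) = Q by rewrite cmod_real ger0_norm// ltW.
    apply: sub_neq0_lt; rewrite !cmodM cmodQ cQ va.
    apply: (@le_lt_trans _ _ (Q * (cmod p * a))).
      by rewrite -mulrA ler_wpM2r// mulr_ge0 ?cmod_ge0// ltW.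
    by rewrite gtr_pMr// mulr_ilt1 ?cmod_ge0// ltW.
  exact: (H1_term_inner p0 (Qn_neq0 n) v0 e1 e2 e3 e4 g1 f3).
have cf : \sum_(1 <= i < m) (f i.+1 - f i) @[m --> \oo] --> - f 1%N.
  rewrite -(sub0r (f 1%N)).
  have : f m - f 1%N @[m --> \oo] --> 0 - f 1%N by apply: cvgB; [exact: f0|exact: cvg_cst].
  apply: cvg_trans; apply: near_eq_cvg; exists 1%N => // n /= n0.
  by rewrite telescope_sumr.
have : \sum_(1 <= n < m) H1_term p v (conjc v) n @[m --> \oo] -->
    v * H2 alpha r p v - (kv p v + kv (1 / p) v) + - f 1%N.
  by rewrite E; apply: cvgD; [exact: kterm_series|exact: cf].
move=> /H1E ->; rewrite vE (H1_head_inner p0 v0 c1 d7) /f expr1.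
have -> : Q%:C / (Q%:C * p) = 1 / p by rewrite invfM mulrA mulfV.
by rewrite /kv; ring.
Qed.

End kernels.

Section uniform_limits.
Context (R : realType).
Notation mu := (@lebesgue_measure R).
Notation mu2 := (mu \x mu)%E.

Lemma within_continuous_uniform_limit (T : topologicalType) (A : set T)
    (k : T -> C R) (kn : nat -> T -> C R) :
  (forall n, {within A, continuous (kn n)}) ->
  (forall e, 0 < e -> exists n, forall x, A x -> cmod (k x - kn n x) <= e) ->
  {within A, continuous k}.
Proof.
move=> ckn kkn; apply/subspace_continuousP => x Ax; apply/cvg_cmodP => e e0.
have [n kn_e] := kkn (e / 4) ltac:(by rewrite divr_gt0).
have /subspace_continuousP/(_ x Ax)/cvg_cmodP/(_ (e / 4)) := ckn n.
rewrite divr_gt0// => /(_ isT); rewrite !near_withinE; apply: filterS => y h Ay.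
have h1 := kn_e x Ax; have h2 := kn_e y Ay; have h3 := h Ay.
have h4 := cmodD (k x - kn n x) (kn n x - k y).
have h5 := cmodD (kn n x - kn n y) (kn n y - k y).
rewrite !addrA !subrK in h4 h5; rewrite (cmodB (kn n y)) in h5; lra.
Qed.

Lemma within_bdry_integrable (a b c d : R) (F : R * R -> C R) : 0 < a -> a <= b -> c <= d ->
  {within `[a, b] `*` `[c, d], continuous F} -> bdry_integrable a b c d F.
Proof.
move=> a0 ab cd cF.
have cab : {within `[a, b], continuous (fun x => (x%:C : C R)^-1)}.
  apply: within_continuousV.
    move=> x; rewrite /= in_itv/= => /andP[ax _].
    by apply: realC_neq0; exact: lt_le_trans ax.
  by apply: continuous_subspaceT => x; apply: cvg_real_complex; exact: cvg_id.
have h (y : R) : c <= y <= d -> cintegrable mu `[a, b] (fun x => F (x, y) / x%:C).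
  move=> yI; apply: continuous_cintegrable.
  exact: (within_continuousM (within_continuous_section1 cF yI) cab).
have v (x : R) : a <= x <= b -> cintegrable mu `[c, d] (fun y => F (x, y)).
  by move=> xI; apply: continuous_cintegrable; exact: (within_continuous_section2 cF xI).
by split; [apply: h|apply: h|apply: v|apply: v]; rewrite lexx ?andbT.
Qed.

Lemma cmod_bdry_le (a b c d : R) (F : R * R -> C R) (m : R) : 0 < a -> a <= b -> c <= d ->
  bdry_integrable a b c d F ->
  (forall q, (`[a, b] `*` `[c, d]) q -> cmod (F q) <= m) ->
  cmod (bdry a b c d F) <= 4 * ((b - a) / a + (d - c)) * m.
Proof.
move=> a0 ab cd [F1 F2 F3 F4] Fm.
have inS x y : a <= x <= b -> c <= y <= d -> cmod (F (x, y)) <= m.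
  by move=> xI yI; apply: Fm; split; rewrite /= in_itv.
have h (y : R) : c <= y <= d -> cintegrable mu `[a, b] (fun x => F (x, y) / x%:C) ->
    cmod (cint mu `[a, b] (fun x => F (x, y) / x%:C)) <= 2 * (m / a * (b - a)).
  move=> yI iF; apply: (cmod_cint_cst_le ab iF) => x /[dup] xI /andP[ax _].
  apply: cmod_div_le => //; first exact: inS.
  by rewrite cmod_real (le_trans ax)// ler_norm.
have v (x : R) : a <= x <= b -> cintegrable mu `[c, d] (fun y => F (x, y)) ->
    cmod (imag R * cint mu `[c, d] (fun y => F (x, y))) <= 2 * (m * (d - c)).
  move=> xI iF; rewrite cmodM cmod_imag mul1r.
  by apply: (cmod_cint_cst_le cd iF) => y yI; exact: inS.
have l1 : a <= a <= b by rewrite lexx.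
have l2 : a <= b <= b by rewrite lexx andbT.
have l3 : c <= c <= d by rewrite lexx.
have l4 : c <= d <= d by rewrite lexx andbT.
have arith (x x1 x2 x3 x4 z1 z2 : R) : x <= z2 + x4 -> z2 <= z1 + x3 -> z1 <= x1 + x2 ->
    x1 <= 2 * (m / a * (b - a)) -> x2 <= 2 * (m * (d - c)) ->
    x3 <= 2 * (m / a * (b - a)) -> x4 <= 2 * (m * (d - c)) ->
    x <= 4 * ((b - a) / a + (d - c)) * m by move=> *; lra.
exact: (arith _ _ _ _ _ _ _ (cmodB_le _ _) (cmodB_le _ _) (cmodD _ _)
  (h c l3 F1) (v b l2 F4) (h d l4 F2) (v a l1 F3)).
Qed.

Lemma cmod_cint_rect_le (a b c d : R) (F : R * R -> C R) (m : R) :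
  cintegrable mu2 (`[a, b] `*` `[c, d]) F ->
  (forall q, (`[a, b] `*` `[c, d]) q -> cmod (F q) <= m) ->
  cmod (cint mu2 (`[a, b] `*` `[c, d]) F) <= 2 * fine (mu2 (`[a, b] `*` `[c, d])) * m.
Proof.
move=> iF Fm; have mS := @measurable_rect R a b c d.
have im : mu2.-integrable (`[a, b] `*` `[c, d]) (EFin \o cst m).
  by apply: (@bounded_rect_integrable _ _ _ _ _ _ `|m|) => //.
have := @cmod_cint_le _ _ R mu2 _ F (cst m) mS iF im Fm.
by rewrite Rintegral_cst// [m * _]mulrC mulrA.
Qed.

Lemma within_continuous_defect (a b c d : R) (W g k : R * R -> C R) (kn : nat -> R * R -> C R) :
  0 < a -> a <= b -> c <= d ->
  let S := `[a, b] `*` `[c, d] in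
  {within S, continuous W} -> {within S, continuous g} ->
  (forall n, {within S, continuous (kn n)}) ->
  (forall e, 0 < e -> exists n, forall x, S x -> cmod (k x - kn n x) <= e) ->
  (forall n, bdry a b c d (fun q => W q * kn n q) =
    2 * imag R * cint mu2 S (fun q => kn n q * g q)) ->
  bdry a b c d (fun q => W q * k q) = 2 * imag R * cint mu2 S (fun q => k q * g q).
Proof.
move=> a0 ab cd S cW cg ckn kkn E.
have ck := within_continuous_uniform_limit ckn kkn.
have [MW HW] := compact_bounded_cmod (@rect_compact R a b c d) cW.
have [Mg Hg] := compact_bounded_cmod (@rect_compact R a b c d) cg.
pose A := fine (mu2 S).
have A0 : 0 <= A.
  by apply: fine_ge0; exact: measure_ge0.
pose B := 4 * ((b - a) / a + (d - c)) * `|MW| + 2 * (2 * A * `|Mg|).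
have B0 : 0 <= B.
  have h1 : 0 <= (b - a) / a by rewrite divr_ge0 ?subr_ge0// ltW.
  have h2 : 0 <= d - c by rewrite subr_ge0.
  apply: addr_ge0; last by rewrite !mulr_ge0.
  by apply: mulr_ge0 => //; apply: mulr_ge0 => //; exact: addr_ge0.
have mS : measurable S := @measurable_rect R a b c d.
apply/eqP; rewrite -subr_eq0 -cmod_eq0 eq_le cmod_ge0 andbT.
apply/ler_addgt0Pl => eta eta0; rewrite addr0.
have [|n Hn] := kkn (eta / (B + 1)); first by rewrite divr_gt0// ltr_wpDl.
set e := eta / (B + 1) in Hn.
have e0 : 0 <= e by apply: divr_ge0; [exact: ltW|exact: addr_ge0].
have ckd : {within S, continuous (fun q => k q - kn n q)}.
  exact: (within_continuousB ck (ckn n)).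
have cWd := within_continuousM cW ckd; have cWn := within_continuousM cW (ckn n).
have cdg := within_continuousM ckd cg; have cng := within_continuousM (ckn n) cg.
have -> : (fun q => W q * k q) = (fun q => W q * (k q - kn n q) + W q * kn n q).
  by apply/funext => q; rewrite -mulrDr subrK.
have -> : (fun q => k q * g q) = (fun q => (k q - kn n q) * g q + kn n q * g q).
  by apply/funext => q; rewrite -mulrDl subrK.
have iWd := within_bdry_integrable a0 ab cd cWd.
rewrite (bdryD iWd (within_bdry_integrable a0 ab cd cWn)).
have idg := continuous_cintegrable_rect cdg.
have ing := continuous_cintegrable_rect cng.
have -> : cint mu2 S (fun q => (k q - kn n q) * g q + kn n q * g q) =
    cint mu2 S (fun q => (k q - kn n q) * g q) + cint mu2 S (fun q => kn n q * g q).
  by apply: cintD; [exact: mS|exact: idg|exact: ing].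
rewrite E mulrDr.
rewrite opprD addrACA subrr addr0.
apply: (@le_trans _ _ (B * e)); last first.
  rewrite /e mulrCA ger_pMr// ler_pdivrMr ?ltr_wpDl//; lra.
have H1 : cmod (bdry a b c d (fun q => W q * (k q - kn n q))) <=
    4 * ((b - a) / a + (d - c)) * (`|MW| * e).
  apply: (cmod_bdry_le a0 ab cd iWd) => q Sq; rewrite cmodM ler_pM ?cmod_ge0//; last exact: Hn.
  by apply: le_trans (HW q Sq) (ler_norm _).
have H2 : cmod (cint mu2 S (fun q => (k q - kn n q) * g q)) <= 2 * A * (e * `|Mg|).
  apply: (cmod_cint_rect_le idg) => q Sq; rewrite cmodM ler_pM ?cmod_ge0//; first exact: Hn.
  by apply: le_trans (Hg q Sq) (ler_norm _).
have H3 : cmod (2 * imag R * cint mu2 S (fun q => (k q - kn n q) * g q)) <=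
    2 * (2 * A * (e * `|Mg|)).
  by rewrite !cmodM cmod_imag cmod_nat mulr1 ler_wpM2l.
have arith (x x1 x2 : R) : x <= x1 + x2 -> x1 <= 4 * ((b - a) / a + (d - c)) * (`|MW| * e) ->
    x2 <= 2 * (2 * A * (e * `|Mg|)) -> x <= B * e by rewrite /B => *; lra.
exact: arith (cmodB_le _ _) H1 H3.
Qed.

End uniform_limits.

Section regular_part.
Context (R : realType).
Notation mu := (@lebesgue_measure R).
Notation mu2 := (mu \x mu)%E.
Variables (alpha r : R).
Hypotheses (alpha0 : 0 < alpha) (r0 : 0 < r) (r1 : r < 1).

Let a := r `^ alpha.
Let Q := a ^+ 2.

Definition annular : set (R * R) := [set q | r <= q.1 <= 1].

Definition kernelK (p : C R) (q : R * R) : C R := vpow alpha q * H2 alpha r p (vpow alpha q).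

Definition regK (p : C R) (q : R * R) : C R := kernelK p q - kap alpha p q.

Let regKn (p : C R) n (q : R * R) : C R :=
  kv (1 / p) (vpow alpha q) + \sum_(1 <= i < n) kterm Q i p (vpow alpha q).

Lemma vpow_annular q : annular q -> a <= cmod (vpow alpha q) <= 1.
Proof.
move=> /andP[rq q1]; rewrite cmod_vpow; apply/andP; split.
  by rewrite ge0_ler_powR ?nnegrE ?(ltW alpha0) ?(ltW r0)// (le_trans (ltW r0)).
suff : q.1 `^ alpha <= 1 `^ alpha by rewrite powR1.
by rewrite ge0_ler_powR ?nnegrE ?(ltW alpha0) ?ler01// (le_trans (ltW r0)).
Qed.

Lemma dbar_pairD0 O (W1 W2 : R * R -> C R) : dbar_pair O W1 (fun=> 0) ->
  dbar_pair O W2 (fun=> 0) -> dbar_pair O (fun q => W1 q + W2 q) (fun=> 0).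
Proof.
move=> [Xr [Xt HX]] [Yr [Yt HY]].
exists (fun q => Xr q + Yr q), (fun q => Xt q + Yt q) => q Oq.
have [[c1 c2 c3 c4] [d1 d2 d3]] := HX q Oq.
have [[b1 b2 b3 b4] [e1 e2 e3]] := HY q Oq.
split; split.
- exact: continuous_atD c1 b1.
- exact: c2.
- exact: continuous_atD c3 b3.
- exact: continuous_atD c4 b4.
- exact: is_cderiveD d1 e1.
- exact: is_cderiveD d2 e2.
- by rewrite mulrDr mulrDl opprD addrACA d3 e3 !mulr0 addr0.
Qed.

Section off_pole.
Variables (p : C R) (pI : a < cmod p < 1).

Let kap_annular p' : (forall q, annular q -> vpow alpha q - p' != 0) ->
  dbar_pair annular (kap alpha p') (fun=> 0).
Proof.
move=> H; apply: kap_holomorphic => q Aq; split; last by rewrite -subr_eq0 H.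
by case/andP: Aq => rq _; exact: lt_le_trans rq.
Qed.

Let div_sub_neq0 (x y v : C R) : y != 0 -> y * v - x != 0 -> v - x / y != 0.
Proof.
move=> y0; apply: contra => /eqP vx; have -> : v = x / y by apply/eqP; rewrite -subr_eq0 vx.
by rewrite mulrC mulfVK// subrr.
Qed.

Let regKn_holomorphic n : dbar_pair annular (regKn p n) (fun=> 0).
Proof.
have p0 : p != 0.
  by rewrite -cmod_eq0 gt_eqF//; case/andP: pI => + _; apply: lt_trans; rewrite powR_gt0.
have q0 i : ((Q ^+ i)%:C : C R) != 0.
  by rewrite -cmod_eq0 cmod_real normr_eq0 gt_eqF// !exprn_gt0// powR_gt0.
have den i q := fun i0 (Aq : annular q) =>
  @kernel_denominators R alpha r alpha0 r0 r1 i p (vpow alpha q) i0 pI (vpow_annular Aq).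
have dc (F : R * R -> C R) : dbar_pair annular F (fun=> 0) ->
    dbar_pair annular (fun q => F q - 1) (fun=> 0) by exact: dbar_pairB_cst.
apply: (dbar_pairD0 (W1 := kap alpha (1 / p))).
  apply: kap_annular => q Aq; have [_ [_ _ d5]] := den 1%N q isT Aq.
  exact: div_sub_neq0.
elim: n => [|n IH].
  rewrite (_ : (fun q => _) = (fun=> 0)); first exact: dbar_pair_cst.
  by apply/funext => q; rewrite big_geq.
have [n0|n0] := posnP n.
  rewrite (_ : (fun q => _) = (fun=> 0)); first exact: dbar_pair_cst.
  by apply/funext => q; rewrite n0 big_geq.
rewrite (_ : (fun q => _) = (fun q => \sum_(1 <= i < n) kterm Q i p (vpow alpha q) +
    kterm Q n p (vpow alpha q))); last by apply/funext => q; rewrite big_nat_recr.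
apply: dbar_pairD0 => //; rewrite /kterm.
apply: (dbar_pairD0 (W2 := kap alpha _)); last first.
  apply: kap_annular => q Aq; have [_ [_ d4 _]] := den n q n0 Aq.
  by apply: div_sub_neq0 => //; rewrite mulf_neq0.
apply: dbar_pairD0; last first.
  apply: (dc (kap alpha _)); apply: kap_annular => q Aq.
  by have [_ [d3 _ _]] := den n q n0 Aq; exact: div_sub_neq0.
apply: dbar_pairD0; last first.
  apply: (dc (kap alpha _)); apply: kap_annular => q Aq.
  by have [[_ _ _ d2] _] := den n q n0 Aq.
apply: (kap_annular (p' := p / _)) => q Aq; have [[_ _ d1 _] _] := den n q n0 Aq.
exact: div_sub_neq0.
Qed.

Let regKn_uniform e : 0 < e ->
  exists n, forall q, annular q -> cmod (regK p q - regKn p n q) <= e.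
Proof.
move=> e0; have a0 : 0 < a by exact: powR_gt0.
have Q0 : 0 < Q by rewrite exprn_gt0.
have a1 : a < 1.
  by case/andP: pI; exact: lt_trans.
have Q1 : Q < 1 by rewrite /Q exprn_ilt1 // ltW.
pose B := kbound a Q p / (1 - Q).
have /cvgrPdist_lt/(_ e e0)[N _ HN] : B * Q ^+ n @[n --> \oo] --> 0.
  rewrite -(mulr0 B); apply: cvgM; first exact: cvg_cst.
  by apply: cvg_expr; rewrite ger0_norm// ltW.
exists N.+1 => q Aq.
have [_ /(_ N.+1 isT)] := kernel_series alpha0 r0 r1 (conj pI (vpow_annular Aq)).
rewrite /kpart -/a -/Q -/B => H; have -> : regK p q - regKn p N.+1 q =
    vpow alpha q * H2 alpha r p (vpow alpha q) - (kv p (vpow alpha q) +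
      kv (1 / p) (vpow alpha q) + \sum_(1 <= i < N.+1) kterm Q i p (vpow alpha q)).
  by rewrite /regK /regKn /kernelK /kap /kv; ring.
apply: le_trans H _; have /= := HN N.+1 (leqnSn N); rewrite sub0r normrN => /ltW.
by apply: le_trans; exact: ler_norm.
Qed.

Lemma regK_continuous : {within annular, continuous (regK p)}.
Proof.
apply: within_continuous_uniform_limit regKn_uniform => n.
apply: continuous_at_within => q Aq; have [Wr [Wt H]] := regKn_holomorphic n.
by have [[h _ _ _] _] := H q Aq; exact: h.
Qed.

Lemma bdry_regK x1 x2 y1 y2 (W g : R * R -> C R) :
  x1 <= x2 -> y1 <= y2 -> `[x1, x2] `*` `[y1, y2] `<=` annular ->
  dbar_pair (`[x1, x2] `*` `[y1, y2]) W g ->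
  bdry x1 x2 y1 y2 (fun q => W q * regK p q) =
  2 * imag R * cint mu2 (`[x1, x2] `*` `[y1, y2]) (fun q => regK p q * g q).
Proof.
move=> x12 y12 SA HW; have x10 : 0 < x1.
  have : annular (x1, y1) by apply: SA; split; rewrite /= in_itv/= lexx.
  by move=> /andP[/= rx _]; exact: lt_le_trans rx.
apply: (within_continuous_defect (kn := regKn p) x10 x12 y12).
- apply: continuous_at_within => q Sq; have [Wr [Wt H]] := HW.
  by have [[h _ _ _] _] := H q Sq; exact: h.
- apply: continuous_at_within => q Sq; have [Wr [Wt H]] := HW.
  by have [[_ h _ _] _] := H q Sq; exact: h.
- move=> n; apply: continuous_at_within => q /SA Aq.
  have [Wr [Wt H]] := regKn_holomorphic n.
  by have [[h _ _ _] _] := H q Aq; exact: h.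
- move=> e e0; have [n Hn] := regKn_uniform e0; exists n => q /SA; exact: Hn.
- move=> n; apply: (bdry_dbar x10 x12 y12).
  by apply: dbar_pairM HW _; apply: dbar_pairS (regKn_holomorphic n).
Qed.

End off_pole.

End regular_part.

Section wedge.
Context (R : realType).
Notation mu := (@lebesgue_measure R).
Notation mu2 := (mu \x mu)%E.
Variables (alpha r : R).
Hypotheses (alpha0 : 0 < alpha) (r0 : 0 < r) (r1 : r < 1).
Variable q0 : R * R.
Hypotheses (q0r : r < q0.1 < 1) (q0t : 0 < q0.2 < pi / alpha).

Let a := r `^ alpha.
Let u := vpow alpha q0.
Let T : set (R * R) := `[r, 1] `*` `[0, pi / alpha].

Let q01_gt0 : 0 < q0.1.
Proof. by case/andP: q0r => + _; exact: lt_trans. Qed.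

Lemma wedge_annular : T `<=` annular r.
Proof. by move=> q [/=]; rewrite in_itv. Qed.

Let arg_bound t : 0 <= t <= pi / alpha -> 0 <= alpha * t <= pi.
Proof.
move=> /andP[t0 t1]; rewrite mulr_ge0 ?(ltW alpha0)//=.
by rewrite mulrC -ler_pdivlMr.
Qed.

Lemma vpow_wedge_inj q : T q -> q != q0 -> vpow alpha q != u.
Proof.
move=> [/=]; rewrite !in_itv/= => /andP[rq q1] tq; apply: contra => /eqP vq.
have q10 : 0 < q.1 by exact: lt_le_trans rq.
have m : q.1 `^ alpha = q0.1 `^ alpha by rewrite -!cmod_vpow vq.
have E1 : q.1 = q0.1.
  have /(congr1 (fun x : R => x `^ alpha^-1)) := m.
  by rewrite -!powRrM mulfV ?gt_eqF// !powRr1// ltW.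
have E2 : q.2 = q0.2.
  have := congr1 (@complex.Re R) vq; rewrite /u /= m.
  have p0 : q0.1 `^ alpha != 0 by rewrite gt_eqF// powR_gt0.
  move=> /(mulfI p0)/cos_inj; rewrite !in_itv/= !arg_bound//; last first.
    by case/andP: q0t => /ltW -> /ltW ->.
  by move=> /(_ isT isT); apply: mulfI; rewrite gt_eqF.
by move: E1 E2; case: q {rq q1 tq vq q10 m} => x y /= -> ->; rewrite -surjective_pairing.
Qed.

Lemma cmod_wedge_pole : a < cmod u < 1.
Proof.
rewrite cmod_vpow; have [h1 h2] := andP q0r; apply/andP; split.
  by rewrite gt0_ltr_powR ?nnegrE ?(ltW r0) ?(ltW q01_gt0).
suff : q0.1 `^ alpha < 1 `^ alpha by rewrite powR1.
by rewrite gt0_ltr_powR ?nnegrE ?(ltW q01_gt0) ?ler01.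
Qed.

Lemma cmod_wedge_pole_conj : a < cmod (conjc u) < 1.
Proof. by rewrite cmod_conj cmod_wedge_pole. Qed.

Lemma kap_wedge : dbar_pair (T `\ q0) (kap alpha u) (fun=> 0).
Proof.
apply: kap_holomorphic => q [Tq /eqP qq0]; split; last exact: vpow_wedge_inj.
by have /andP[rq _] := wedge_annular Tq; exact: lt_le_trans rq.
Qed.

Lemma kap_wedge_conj : dbar_pair T (kap alpha (conjc u)) (fun=> 0).
Proof.
apply: kap_holomorphic => q Tq; have /andP[rq _] := wedge_annular Tq.
have q1 : 0 < q.1 by exact: lt_le_trans rq.
split=> //; apply/eqP => /(congr1 (@complex.Im R)); rewrite Im_conjc /u /=.
move: Tq => [_]; rewrite /= in_itv/= => /arg_bound aq E.
have h1 : 0 <= q.1 `^ alpha * sin (alpha * q.2) by rewrite mulr_ge0 ?powR_ge0 ?sin_ge0_pi.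
have h2 : 0 < q0.1 `^ alpha * sin (alpha * q0.2).
  rewrite mulr_gt0 ?powR_gt0// sin_gt0_pi//; case/andP: q0t => t0 t1.
  by rewrite mulr_gt0//= mulrC -ltr_pdivlMr.
by move: h1; rewrite E leNgt oppr_lt0 h2.
Qed.

Lemma kernelK_wedge_conj : {within T, continuous (kernelK alpha r (conjc u))}.
Proof.
have -> : kernelK alpha r (conjc u) =
    (fun q => kap alpha (conjc u) q + regK alpha r (conjc u) q).
  by apply/funext => q; rewrite /regK addrC subrK.
apply: within_continuousD.
  apply: continuous_at_within => q Tq; have [Wr [Wt H]] := kap_wedge_conj.
  by have [[h _ _ _] _] := H q Tq; exact: h.
apply: continuous_subspaceW wedge_annular _.
exact: (regK_continuous alpha0 r0 r1 cmod_wedge_pole_conj).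
Qed.

Lemma kernelK_wedge A : A `<=` T `\ q0 -> {within A, continuous (kernelK alpha r u)}.
Proof.
move=> AT; have -> : kernelK alpha r u = (fun q => kap alpha u q + regK alpha r u q).
  by apply/funext => q; rewrite /regK addrC subrK.
apply: within_continuousD.
  apply: continuous_at_within => q Aq; have [Wr [Wt H]] := kap_wedge.
  by have [[h _ _ _] _] := H q (AT q Aq); exact: h.
apply: (continuous_subspaceW (B := annular r)).
  by move=> q /AT[Tq _]; exact: wedge_annular.
exact: (regK_continuous alpha0 r0 r1 cmod_wedge_pole).
Qed.

Section subrectangle.
Variables (x1 x2 y1 y2 : R).
Hypotheses (rx1 : r <= x1) (x1q : x1 < q0.1) (qx2 : q0.1 < x2) (x21 : x2 <= 1).
Hypotheses (y10 : 0 <= y1) (y1q : y1 < q0.2) (qy2 : q0.2 < y2) (y2t : y2 <= pi / alpha).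
Variables (W g : R * R -> C R) (O : set (R * R)).
Let S : set (R * R) := `[x1, x2] `*` `[y1, y2].
Hypotheses (SO : S `<=` O) (HW : dbar_pair O W g).

Let ST : S `<=` T.
Proof.
move=> q [/=]; rewrite !in_itv/= => /andP[h1 h2] /andP[h3 h4].
by split; rewrite /= in_itv/=; apply/andP; split;
  [exact: le_trans h1|exact: le_trans x21|exact: le_trans h3|exact: le_trans y2t].
Qed.

Let x10 : 0 < x1. Proof. exact: lt_le_trans rx1. Qed.
Let x12 : x1 <= x2. Proof. exact: ltW (lt_trans x1q qx2). Qed.
Let y12 : y1 <= y2. Proof. exact: ltW (lt_trans y1q qy2). Qed.
Let HWS : dbar_pair S W g. Proof. exact: dbar_pairS HW. Qed.

Let cW : {within S, continuous W}.
Proof.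
apply: continuous_at_within => q Sq; have [Wr [Wt H]] := HWS.
by have [[h _ _ _] _] := H q Sq; exact: h.
Qed.

Let cg : {within S, continuous g}.
Proof.
apply: continuous_at_within => q Sq; have [Wr [Wt H]] := HWS.
by have [[_ h _ _] _] := H q Sq; exact: h.
Qed.

Let creg p : a < cmod p < 1 -> {within S, continuous (regK alpha r p)}.
Proof.
move=> pI; apply: (continuous_subspaceW (B := annular r)).
  by move=> q /ST; exact: wedge_annular.
exact: (regK_continuous alpha0 r0 r1 pI).
Qed.

Lemma cintegrable_kernelK : cintegrable mu2 S (fun q => kernelK alpha r u q * g q).
Proof.
have i1 : cintegrable mu2 S (fun q => kap alpha u q * g q).
  apply: (cintegrable_pole alpha0 q01_gt0 x10 x1q qx2 y1q qy2 _ SO HW).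
  by move=> q /ST; exact: vpow_wedge_inj.
have i2 : cintegrable mu2 S (fun q => regK alpha r u q * g q).
  apply: continuous_cintegrable_rect.
  exact: (within_continuousM (creg cmod_wedge_pole) cg).
rewrite (_ : (fun q => _) = (fun q => kap alpha u q * g q + regK alpha r u q * g q)).
  by apply: cintegrableD; [exact: measurable_rect|exact: i1|exact: i2].
by apply/funext => q; rewrite /regK; ring.
Qed.

Lemma cintegrable_kernelK_conj :
  cintegrable mu2 S (fun q => kernelK alpha r (conjc u) q * g q).
Proof.
apply: continuous_cintegrable_rect.
apply: (within_continuousM _ cg).
exact: continuous_subspaceW ST kernelK_wedge_conj.
Qed.

Lemma bdry_kernelK : bdry x1 x2 y1 y2 (fun q => W q * kernelK alpha r u q) =
  2 * imag R * cint mu2 S (fun q => kernelK alpha r u q * g q)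
  + 2 * imag R * (pi / alpha)%:C * W q0.
Proof.
have vinj q : S q -> q != q0 -> vpow alpha q != u.
  by move=> /ST; exact: vpow_wedge_inj.
have i1 := cintegrable_pole alpha0 q01_gt0 x10 x1q qx2 y1q qy2 vinj SO HW.
have i2 : cintegrable mu2 S (fun q => regK alpha r u q * g q).
  apply: continuous_cintegrable_rect.
  exact: (within_continuousM (creg cmod_wedge_pole) cg).
have P := pole alpha0 q01_gt0 x10 x1q qx2 y1q qy2 vinj SO HW.
have E := bdry_regK alpha0 r0 r1 cmod_wedge_pole x12 y12
  (fun q Sq => wedge_annular (ST Sq)) HWS.
have -> : (fun q => W q * kernelK alpha r u q) =
    (fun q => W q * kap alpha u q + W q * regK alpha r u q).
  by apply/funext => q; rewrite /regK; ring.
have -> : (fun q => kernelK alpha r u q * g q) =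
    (fun q => kap alpha u q * g q + regK alpha r u q * g q).
  by apply/funext => q; rewrite /regK; ring.
have j1 : bdry_integrable x1 x2 y1 y2 (fun q => W q * kap alpha u q).
  apply: (@continuous_bdry_integrable _ _ _ _ _ _ (S `\ q0) x10 x12 y12).
    move=> q [Sq qq0]; have [Wr [Wt H]] := HWS; have [[h _ _ _] _] := H q Sq.
    have [kr [kt H']] := kap_wedge.
    have [[h' _ _ _] _] := H' q (conj (ST Sq) qq0).
    exact: continuous_atM h h'.
  move=> x y xI yI xy; split; first by split; rewrite /= in_itv.
  move=> /= qe; move: xy; have := x1q; have := qx2; have := y1q; have := qy2.
  rewrite -qe/= => h1 h2 h3 h4.
  by move=> /or4P[] /eqP E'; rewrite E' ltxx in h1 h2 h3 h4.
have j2 : bdry_integrable x1 x2 y1 y2 (fun q => W q * regK alpha r u q).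
  apply: (within_bdry_integrable x10 x12 y12).
  exact: (within_continuousM cW (creg cmod_wedge_pole)).
rewrite (bdryD j1 j2) P E.
have -> : cint mu2 S (fun q => kap alpha u q * g q + regK alpha r u q * g q) =
    cint mu2 S (fun q => kap alpha u q * g q) + cint mu2 S (fun q => regK alpha r u q * g q).
  by apply: cintD; [exact: measurable_rect|exact: i1|exact: i2].
by rewrite mulrDr addrAC.
Qed.

Lemma bdry_kernelK_conj :
  bdry x1 x2 y1 y2 (fun q => W q * kernelK alpha r (conjc u) q) =
  2 * imag R * cint mu2 S (fun q => kernelK alpha r (conjc u) q * g q).
Proof.
have i1 : cintegrable mu2 S (fun q => kap alpha (conjc u) q * g q).
  apply: continuous_cintegrable_rect; apply: (within_continuousM _ cg).
  apply: continuous_at_within => q Sq; have [Wr [Wt H]] := kap_wedge_conj.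
  by have [[h _ _ _] _] := H q (ST Sq); exact: h.
have i2 : cintegrable mu2 S (fun q => regK alpha r (conjc u) q * g q).
  apply: continuous_cintegrable_rect.
  exact: (within_continuousM (creg cmod_wedge_pole_conj) cg).
have P : bdry x1 x2 y1 y2 (fun q => W q * kap alpha (conjc u) q) =
    2 * imag R * cint mu2 S (fun q => kap alpha (conjc u) q * g q).
  apply: (bdry_dbar x10 x12 y12); apply: dbar_pairM HWS _.
  by apply: dbar_pairS kap_wedge_conj.
have E := bdry_regK alpha0 r0 r1 cmod_wedge_pole_conj x12 y12
  (fun q Sq => wedge_annular (ST Sq)) HWS.
have -> : (fun q => W q * kernelK alpha r (conjc u) q) =
    (fun q => W q * kap alpha (conjc u) q + W q * regK alpha r (conjc u) q).
  by apply/funext => q; rewrite /regK; ring.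
have -> : (fun q => kernelK alpha r (conjc u) q * g q) =
    (fun q => kap alpha (conjc u) q * g q + regK alpha r (conjc u) q * g q).
  by apply/funext => q; rewrite /regK; ring.
have j1 : bdry_integrable x1 x2 y1 y2 (fun q => W q * kap alpha (conjc u) q).
  apply: (within_bdry_integrable x10 x12 y12); apply: (within_continuousM cW).
  apply: continuous_at_within => q Sq; have [Wr [Wt H]] := kap_wedge_conj.
  by have [[h _ _ _] _] := H q (ST Sq); exact: h.
have j2 : bdry_integrable x1 x2 y1 y2 (fun q => W q * regK alpha r (conjc u) q).
  apply: (within_bdry_integrable x10 x12 y12).
  exact: (within_continuousM cW (creg cmod_wedge_pole_conj)).
rewrite (bdryD j1 j2) P E.
have -> : cint mu2 S (fun q => kap alpha (conjc u) q * g q + regK alpha r (conjc u) q * g q) =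
    cint mu2 S (fun q => kap alpha (conjc u) q * g q) +
    cint mu2 S (fun q => regK alpha r (conjc u) q * g q).
  by apply: cintD; [exact: measurable_rect|exact: i1|exact: i2].
by rewrite mulrDr.
Qed.

End subrectangle.

End wedge.

Section shrinking.
Context (R : realType).
Notation mu := (@lebesgue_measure R).
Notation mu2 := (mu \x mu)%E.

Lemma compact_uniform_continuity (N : set (R * R)) (F : R * R -> C R) (eps : R) :
  compact N -> {within N, continuous F} -> 0 < eps ->
  exists2 d, 0 < d & forall p q, N p -> N q -> `|q.1 - p.1| < d -> `|q.2 - p.2| < d ->
    cmod (F p - F q) <= eps.
Proof.
move=> /compact_near_coveringP cN /subspace_continuousP cF eps0.
pose P (d : R) (p : R * R) := N p -> forall q, N q -> `|q.1 - p.1| < d ->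
  `|q.2 - p.2| < d -> cmod (F p - F q) <= eps.
have : \forall d \near (0:R)^'+, N `<=` P d.
  apply: cN => p0 Np0.
  have e2 : 0 < eps / 2 by rewrite divr_gt0.
  have := cF p0 Np0; move=> /cvg_cmodP/(_ _ e2); rewrite near_withinE.
  move=> /nbhs_ballP[d' d0' Hd]; have d0 : 0 < d' by [].
  have dd : 0 < d' / 2 by rewrite divr_gt0.
  exists (ball p0 (d' / 2), [set d | d < d' / 2]).
    split; first exact: nbhsx_ballx.
    by apply: nbhs_right_lt.
  move=> [p d] [/= [p1 p2] dd2] Np q Nq q1 q2.
  rewrite /ball/= in p1 p2.
  have Hp : cmod (F p0 - F p) < eps / 2.
    by apply: Hd => //; split; rewrite /ball/=; lra.
  have Hq : cmod (F p0 - F q) < eps / 2.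
    apply: Hd => //; split; rewrite /ball/=.
      have := ler_distD p.1 p0.1 q.1; rewrite (distrC p.1 q.1); lra.
    have := ler_distD p.2 p0.2 q.2; rewrite (distrC p.2 q.2); lra.
  have := cmodD (F p - F p0) (F p0 - F q); rewrite addrA subrK (cmodB (F p)).
  by move: Hp Hq; lra.
move=> [d d0' Hd]; have d0 : 0 < d by [].
exists (d / 2); first by rewrite divr_gt0.
have d2 : ball (0 : R) d (d / 2).
  rewrite /ball/= sub0r normrN ger0_norm ?divr_ge0 ?ltW//.
  by rewrite ltr_pdivrMr// mulr_natr mulr2n ltrDl.
by move=> p q Np Nq; apply: (Hd _ d2) => //; rewrite divr_gt0.
Qed.

Lemma cintegrable_subitv (a b c d : R) (F : R -> C R) : a <= c -> d <= b ->
  cintegrable mu `[a, b] F -> cintegrable mu `[c, d] F.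
Proof.
move=> ac db iF; apply: cintegrableS iF; [exact: measurable_itv|exact: measurable_itv|].
by move=> x; rewrite /= !in_itv/= => /andP[h1 h2]; apply/andP; split; lra.
Qed.

Lemma cvg_cint_shrink (f : R -> R -> C R) (a b d0 M : R) : a < b -> 0 < d0 ->
  (forall e, 0 <= e < d0 -> cintegrable mu `[a, b] (f e)) ->
  (forall x, a <= x <= b -> cmod (f 0 x) <= M) ->
  (forall eps, 0 < eps -> exists2 d, 0 < d &
    forall e x, 0 < e < d -> a <= x <= b -> cmod (f 0 x - f e x) <= eps) ->
  cint mu `[a + e, b - e] (f e) @[e --> 0^'+] --> cint mu `[a, b] (f 0).
Proof.
move=> ab d00 i_f fM fu; apply/cvg_cmodP => eps eps0.
have M0 : 0 <= M.
  by apply: le_trans (cmod_ge0 _) (fM a _); rewrite lexx ltW.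
pose eta := eps / (4 * (b - a) + 1).
have ba0 : 0 <= 4 * (b - a) by rewrite mulr_ge0// subr_ge0 ltW.
have eta0 : 0 < eta by rewrite divr_gt0// ltr_wpDl.
have [d dd0 Hd] := fu eta eta0.
pose d1 := Num.min (Num.min d d0) (Num.min ((b - a) / 4) (eps / (8 * (M + 1)))).
have d10 : 0 < d1.
  by rewrite !lt_min dd0 d00 !divr_gt0 ?subr_gt0// mulr_gt0// ltr_wpDl.
have etaE : eta * (4 * (b - a)) < eps.
  by rewrite /eta mulrAC ltr_pdivrMr ?ltr_wpDl// ltr_pM2l// ltrDl.
have arith e x x1 x2 x3 x4 : 0 < e -> e * (8 * (M + 1)) < eps -> x <= x4 + x3 ->
    x4 <= x1 + x2 -> x1 <= 2 * (M * (a + e - a)) -> x2 <= 2 * (eta * (b - e - (a + e))) ->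
    x3 <= 2 * (M * (b - (b - e))) -> x < eps.
  move=> e0 ME h1 h2 h3 h4 h5.
  have h : eta * (b - e - (a + e)) <= eta * (b - a) by rewrite ler_pM2l//; lra.
  have h' : 0 <= e * M by rewrite mulr_ge0// ltW.
  clear -etaE e0 ME h1 h2 h3 h4 h5 h h'; lra.
near=> e.
have e0 : 0 < e by near: e; exact: nbhs_right_gt.
have : e < d1 by near: e; exact: nbhs_right_lt.
rewrite !lt_min => /andP[/andP[ed ed0] /andP[eba eM]].
have a1 : a <= a + e <= b by apply/andP; split; lra.
have a2 : a + e <= b - e <= b by apply/andP; split; lra.
have i0 : cintegrable mu `[a, b] (f 0) by apply: i_f; rewrite lexx.
have i1 : cintegrable mu `[a + e, b] (f 0) by apply: cintegrable_subitv i0; lra.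
have i2 : cintegrable mu `[a + e, b - e] (f 0) by apply: cintegrable_subitv i0; lra.
have i3 : cintegrable mu `[a + e, b - e] (f e).
  by apply: (cintegrable_subitv _ _ (i_f e _)); [lra|lra|rewrite (ltW e0)].
have il : cintegrable mu `[a, a + e] (f 0) by apply: cintegrable_subitv i0; lra.
have ir : cintegrable mu `[b - e, b] (f 0) by apply: cintegrable_subitv i0; lra.
rewrite (cint_itv_split a1 i0) (cint_itv_split a2 i1).
have B1 : cmod (cint mu `[a, a + e] (f 0)) <= 2 * (M * (a + e - a)).
  apply: cmod_cint_cst_le il _; first by lra.
  by move=> x /andP[h1 h2]; apply: fM; apply/andP; split; lra.
have B2 : cmod (cint mu `[b - e, b] (f 0)) <= 2 * (M * (b - (b - e))).
  apply: cmod_cint_cst_le ir _; first by lra.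
  by move=> x /andP[h1 h2]; apply: fM; apply/andP; split; lra.
have B3 : cmod (cint mu `[a + e, b - e] (fun x => f 0 x - f e x)) <=
    2 * (eta * (b - e - (a + e))).
  apply: cmod_cint_cst_le; first by lra.
    by apply: cintegrableB; [exact: measurable_itv|exact: i2|exact: i3].
  by move=> x /andP[h1 h2]; apply: Hd; apply/andP; split; lra.
have E : cint mu `[a + e, b - e] (fun x => f 0 x - f e x) =
    cint mu `[a + e, b - e] (f 0) - cint mu `[a + e, b - e] (f e).
  by apply: cintB; [exact: measurable_itv|exact: i2|exact: i3].
rewrite [X in cmod X](_ : _ =
  cint mu `[a, a + e] (f 0) + cint mu `[a + e, b - e] (fun x => f 0 x - f e x)
  + cint mu `[b - e, b] (f 0)); last by rewrite E; ring.
apply: (arith e) (cmodD _ _) (cmodD _ _) B1 B3 B2; first exact: e0.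
by rewrite -ltr_pdivlMr// mulr_gt0// ltr_wpDl.
Unshelve. all: by end_near. Qed.

Variables (a b c d x1 x2 y1 y2 : R).
Hypotheses (a0 : 0 < a) (ax : a < x1) (x12 : x1 <= x2) (xb : x2 < b).
Hypotheses (cy : c < y1) (y12 : y1 <= y2) (yd : y2 < d).

Definition frame : set (R * R) := (`[a, b] `*` `[c, d]) `&`
  ([set q | q.1 <= x1] `|` [set q | x2 <= q.1] `|`
   [set q | q.2 <= y1] `|` [set q | y2 <= q.2]).

Let compact_frame : compact frame.
Proof.
apply: compact_closedI; first exact: rect_compact.
apply: closedU; [apply: closedU; [apply: closedU|]|].
- apply: (@closed_comp _ _ (fst : R * R -> R) [set x | x <= x1]); last exact: closed_le.
  by move=> q _; exact: cvg_fst.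
- apply: (@closed_comp _ _ (fst : R * R -> R) [set x | x2 <= x]); last exact: closed_ge.
  by move=> q _; exact: cvg_fst.
- apply: (@closed_comp _ _ (snd : R * R -> R) [set x | x <= y1]); last exact: closed_le.
  by move=> q _; exact: cvg_snd.
- apply: (@closed_comp _ _ (snd : R * R -> R) [set x | y2 <= x]); last exact: closed_ge.
  by move=> q _; exact: cvg_snd.
Qed.

Variable F : R * R -> C R.
Hypothesis cF : {within frame, continuous F}.

Lemma frame_bdry_integrable : bdry_integrable a b c d F.
Proof.
have ab : a <= b by have := ax; have := x12; have := xb; lra.
have cd : c <= d by have := cy; have := y12; have := yd; lra.
have h y : (forall x, a <= x <= b -> frame (x, y)) ->
    cintegrable mu `[a, b] (fun x => F (x, y) / x%:C).
  move=> inF; apply: continuous_cintegrable; apply: within_continuousM.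
    apply: (within_continuous_comp_within (g := fun x : R => (x, y))) cF.
      by move=> x; rewrite /= in_itv/= => xI; exact: inF.
    exact/continuous_subspaceT/continuous_pairl.
  apply: within_continuousV.
    move=> x; rewrite /= in_itv/= => /andP[ax' _].
    by apply: realC_neq0; exact: lt_le_trans ax'.
  by apply: continuous_subspaceT => x; apply: cvg_real_complex; exact: cvg_id.
have v x : (forall y, c <= y <= d -> frame (x, y)) ->
    cintegrable mu `[c, d] (fun y => F (x, y)).
  move=> inF; apply: continuous_cintegrable.
  apply: (within_continuous_comp_within (g := fun y : R => (x, y))) cF.
    by move=> y; rewrite /= in_itv/= => yI; exact: inF.
  exact/continuous_subspaceT/continuous_pairr.
split; [apply: h => x xI|apply: h => x xI|apply: v => y yI|apply: v => y yI].
- by split; [split; rewrite /= in_itv//= lexx|left; right; exact: ltW].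
- by split; [split; rewrite /= in_itv//= lexx andbT|right; exact: ltW].
- by split; [split; rewrite /= in_itv//= lexx|left; left; left; exact: ltW].
- by split; [split; rewrite /= in_itv//= lexx andbT|left; left; right; exact: ltW].
Qed.

Let d0 := Num.min (Num.min (x1 - a) (b - x2)) (Num.min (y1 - c) (d - y2)).

Let d0_gt0 : 0 < d0.
Proof. by rewrite !lt_min !subr_gt0 ax xb cy yd. Qed.

Let ltd0 e : e < d0 -> [/\ a + e < x1, x2 < b - e, c + e < y1 & y2 < d - e].
Proof.
by rewrite !lt_min => /andP[/andP[h1 h2] /andP[h3 h4]]; split; lra.
Qed.

Let cvg_side_h (s : R -> R) : s 0 = 0 -> (forall e, 0 <= e -> `|s e| = e) ->
  forall y, (forall e x, 0 <= e < d0 -> a <= x <= b -> frame (x, y + s e)) ->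
  cint mu `[a + e, b - e] (fun x => F (x, y + s e) / x%:C) @[e --> 0^'+] -->
  cint mu `[a, b] (fun x => F (x, y) / x%:C).
Proof.
move=> s0 sE y inF.
have ab : a < b by have := ax; have := x12; have := xb; lra.
have [M HM] := compact_bounded_cmod compact_frame cF.
have -> : (fun x => F (x, y) / x%:C) = (fun x => F (x, y + s 0) / x%:C).
  by apply/funext => x; rewrite s0 addr0.
have zI : 0 <= (0 : R) < d0 by rewrite lexx d0_gt0.
apply: (cvg_cint_shrink (f := fun e x => F (x, y + s e) / x%:C) (M := `|M| / a) ab d0_gt0).
- move=> e eI; apply: continuous_cintegrable; apply: within_continuousM.
    apply: (within_continuous_comp_within (g := fun x : R => (x, y + s e))) cF.
      by move=> x; rewrite /= in_itv/= => xI; exact: inF.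
    exact/continuous_subspaceT/continuous_pairl.
  apply: within_continuousV.
    move=> x; rewrite /= in_itv/= => /andP[ax' _].
    by apply: realC_neq0; exact: lt_le_trans ax'.
  by apply: continuous_subspaceT => x; apply: cvg_real_complex; exact: cvg_id.
- move=> x xI; apply: cmod_div_le => //.
    by apply: le_trans (HM _ (inF _ _ zI xI)) (ler_norm _).
  by rewrite cmod_real (le_trans _ (ler_norm _))//; case/andP: xI.
- move=> eps eps0; have epsa : 0 < eps * a by rewrite mulr_gt0.
  have [d' d'0 Hd] := compact_uniform_continuity compact_frame cF epsa.
  exists (Num.min d' d0); first by rewrite lt_min d'0.
  move=> e x; rewrite lt_min => /andP[e0 /andP[ed' ed0]] xI.
  rewrite -mulrBl; have -> : eps = eps * a / a by rewrite mulfK// gt_eqF.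
  apply: cmod_div_le => //; last first.
    by rewrite cmod_real (le_trans _ (ler_norm _))//; case/andP: xI.
  apply: Hd; rewrite /=.
  + exact: inF.
  + by apply: inF; rewrite ?(ltW e0).
  + by rewrite subrr normr0.
  + by rewrite s0 addr0 addrAC subrr add0r sE// ltW.
Qed.

Let cvg_side_v (s : R -> R) : s 0 = 0 -> (forall e, 0 <= e -> `|s e| = e) ->
  forall x, (forall e y, 0 <= e < d0 -> c <= y <= d -> frame (x + s e, y)) ->
  cint mu `[c + e, d - e] (fun y => F (x + s e, y)) @[e --> 0^'+] -->
  cint mu `[c, d] (fun y => F (x, y)).
Proof.
move=> s0 sE x inF.
have cd : c < d by have := cy; have := y12; have := yd; lra.
have [M HM] := compact_bounded_cmod compact_frame cF.
have -> : (fun y => F (x, y)) = (fun y => F (x + s 0, y)).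
  by apply/funext => y; rewrite s0 addr0.
have zI : 0 <= (0 : R) < d0 by rewrite lexx d0_gt0.
apply: (cvg_cint_shrink (f := fun e y => F (x + s e, y)) (M := M) cd d0_gt0).
- move=> e eI; apply: continuous_cintegrable.
  apply: (within_continuous_comp_within (g := fun y : R => (x + s e, y))) cF.
    by move=> y; rewrite /= in_itv/= => yI; exact: inF.
  exact/continuous_subspaceT/continuous_pairr.
- by move=> y yI; exact: HM _ (inF _ _ zI yI).
- move=> eps eps0.
  have [d' d'0 Hd] := compact_uniform_continuity compact_frame cF eps0.
  exists (Num.min d' d0); first by rewrite lt_min d'0.
  move=> e y; rewrite lt_min => /andP[e0 /andP[ed' ed0]] yI.
  apply: Hd; rewrite /=.
  + exact: inF.
  + by apply: inF; rewrite ?(ltW e0).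
  + by rewrite s0 addr0 addrAC subrr add0r sE// ltW.
  + by rewrite subrr normr0.
Qed.

Lemma cvg_bdry : bdry (a + e) (b - e) (c + e) (d - e) F @[e --> 0^'+] --> bdry a b c d F.
Proof.
have idE (e : R) : 0 <= e -> `|e| = e by move=> e0; rewrite ger0_norm.
have opE (e : R) : 0 <= e -> `|- e| = e by move=> e0; rewrite normrN ger0_norm.
have h1 : cint mu `[a + e, b - e] (fun x => F (x, c + e) / x%:C) @[e --> 0^'+] -->
    cint mu `[a, b] (fun x => F (x, c) / x%:C).
  apply: (cvg_side_h (s := id)) => // e x /andP[e0 /ltd0[g1 g2 g3 g4]] xI.
  split; first by split; rewrite /= in_itv//=; have := y12; have := yd; lra.
  by left; right; exact: ltW.
have h2 : cint mu `[a + e, b - e] (fun x => F (x, d - e) / x%:C) @[e --> 0^'+] -->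
    cint mu `[a, b] (fun x => F (x, d) / x%:C).
  apply: (cvg_side_h (s := -%R)) => //; first by rewrite oppr0.
  move=> e x /andP[e0 /ltd0[g1 g2 g3 g4]] xI.
  split; first by split; rewrite /= in_itv//=; have := y12; have := cy; lra.
  by right; exact: ltW.
have h3 : cint mu `[c + e, d - e] (fun y => F (a + e, y)) @[e --> 0^'+] -->
    cint mu `[c, d] (fun y => F (a, y)).
  apply: (cvg_side_v (s := id)) => // e y /andP[e0 /ltd0[g1 g2 g3 g4]] yI.
  split; first by split; rewrite /= in_itv//=; have := x12; have := xb; lra.
  by left; left; left; exact: ltW.
have h4 : cint mu `[c + e, d - e] (fun y => F (b - e, y)) @[e --> 0^'+] -->
    cint mu `[c, d] (fun y => F (b, y)).
  apply: (cvg_side_v (s := -%R)) => //; first by rewrite oppr0.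
  move=> e y /andP[e0 /ltd0[g1 g2 g3 g4]] yI.
  split; first by split; rewrite /= in_itv//=; have := x12; have := ax; lra.
  by left; left; right; exact: ltW.
have ci (f : R -> C R) l : f @ 0^'+ --> l -> imag R * f e @[e --> 0^'+] --> imag R * l.
  by move=> hf; apply: cvgM; [exact: cvg_cst|exact: hf].
have cB (f g : R -> C R) (l m : C R) : f @ 0^'+ --> l -> g @ 0^'+ --> m ->
    f e - g e @[e --> 0^'+] --> l - m.
  by move=> hf hg; apply: cvgB; [exact: hf|exact: hg].
have cD (f g : R -> C R) (l m : C R) : f @ 0^'+ --> l -> g @ 0^'+ --> m ->
    f e + g e @[e --> 0^'+] --> l + m.
  by move=> hf hg; apply: cvgD; [exact: hf|exact: hg].
exact: (cB _ _ _ _ (cB _ _ _ _ (cD _ _ _ _ h1 (ci _ _ h4)) h2) (ci _ _ h3)).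
Qed.

End shrinking.

Section polar_pullback.
Context (R : realType).
Variables (alpha r : R) (w : C R -> C R).
Hypotheses (r0 : 0 < r) (r1 : r < 1) (alpha_ge : 2^-1 <= alpha).
Hypotheses (w_C1 : C1_on (Omega alpha r) w)
  (w_cont : {within closure (Omega alpha r), continuous w}).

Let alpha0 : 0 < alpha. Proof. by apply: lt_le_trans alpha_ge; rewrite invr_gt0. Qed.

Let angle_gt0 : 0 < pi / alpha.
Proof. by rewrite divr_gt0// pi_gt0. Qed.

Lemma angle_le : pi / alpha <= 2 * pi.
Proof.
rewrite ler_pdivrMr//; have := pi_gt0 R; have := alpha_ge => h1 h2.
have : 2 * alpha >= 1 by lra.
by move=> h; rewrite mulrAC -[leLHS]mul1r ler_pM2r.
Qed.

Definition open_wedge : set (R * R) := `]r, 1[ `*` `]0, pi / alpha[.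
Definition closed_wedge : set (R * R) := `[r, 1] `*` `[0, pi / alpha].

Lemma Omega_polar q : open_wedge q -> Omega alpha r (polar q.1 q.2).
Proof.
move=> [/=]; rewrite !in_itv/= => /andP[q1 q2] /andP[q3 q4].
have q10 : 0 < q.1 by exact: lt_trans q1.
split; first by rewrite cmod_polar ?q1// ltW.
by rewrite carg_polar ?q3// (ltW q3)/= (lt_le_trans q4)// angle_le.
Qed.

Definition pullback (q : R * R) : C R := w (polar q.1 q.2).

Definition pullback_dbar (q : R * R) : C R := polar 1 (- q.2) * dbar w (polar q.1 q.2).

Let closure_polar q : closed_wedge q -> closure (Omega alpha r) (polar q.1 q.2).
Proof.
move=> [/=]; rewrite !in_itv/= => /andP[q1 q2] /andP[q3 q4] B.
move=> /(@continuous_polar R q)/nbhs_ballP[d d0' Hd].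
have d0 : 0 < d by [].
pose s := Num.min 2^-1 (d / (2 * (1 + pi / alpha))).
have t0 := angle_gt0; have r1' := r1; have r0' := r0.
have s0 : 0 < s by rewrite lt_min invr_gt0 divr_gt0 ?mulr_gt0// ltr_wpDr// ltW.
have s1 : s <= 2^-1 by rewrite /s ge_min lexx.
have sd : s * (1 + pi / alpha) < d.
  apply: (@le_lt_trans _ _ (d / (2 * (1 + pi / alpha)) * (1 + pi / alpha))).
    apply: ler_wpM2r; first by apply: addr_ge0 => //; exact: ltW.
    by rewrite /s ge_min lexx orbT.
  rewrite invfM mulrA mulfVK; last by rewrite gt_eqF// ltr_wpDr// ltW.
  by rewrite ltr_pdivrMr// mulr_natr mulr2n ltrDl.
pose x := q.1 + s * ((r + 1) / 2 - q.1); pose y := q.2 + s * (pi / alpha / 2 - q.2).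
have O : open_wedge (x, y).
  by split; rewrite /= in_itv/= /x /y; apply/andP; split; nra.
exists (polar x y); split; first exact: (Omega_polar O).
apply: (Hd (x, y)); split; rewrite /ball/= /x /y opprD addrA subrr add0r normrN normrM gtr0_norm//.
  apply: le_lt_trans sd; rewrite ler_pM2l//; apply: (@le_trans _ _ 1); last by rewrite lerDl ltW.
  by rewrite ler_norml; apply/andP; split; lra.
apply: le_lt_trans sd; rewrite ler_pM2l//.
by rewrite ler_norml; apply/andP; split; lra.
Qed.

Lemma pullback_continuous : {within closed_wedge, continuous pullback}.
Proof.
apply: (within_continuous_comp_within (g := fun q : R * R => polar q.1 q.2 : C R)) w_cont.
  exact: closure_polar.
exact/continuous_subspaceT/continuous_polar.
Qed.

Lemma open_open_wedge : open open_wedge.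
Proof.
apply: (@openI _ (fst @^-1` `]r, 1[) (snd @^-1` `]0, pi / alpha[)).
  by apply: open_comp; [move=> q _; exact: cvg_fst|exact: interval_open].
by apply: open_comp; [move=> q _; exact: cvg_snd|exact: interval_open].
Qed.

Let D_open (p : R * R) : Omega alpha r (p.1 +i* p.2) ->
  nbhs p [set q : R * R | Omega alpha r (q.1 +i* q.2)].
Proof. by apply: near_sector => //; exact: ltW. Qed.

Lemma pullback_dbar_pair : dbar_pair open_wedge pullback pullback_dbar.
Proof.
exists (fun q => dx w (polar q.1 q.2) * (cos q.2)%:C + dy w (polar q.1 q.2) * (sin q.2)%:C),
  (fun q => dx w (polar q.1 q.2) * (- (q.1 * sin q.2))%:C +
     dy w (polar q.1 q.2) * (q.1 * cos q.2)%:C).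
move=> q Oq; have Dq := Omega_polar Oq; have [_ _ cdx cdy] := w_C1 Dq.
have cx : {for q, continuous (fun q => dx w (polar q.1 q.2))}.
  apply: (@continuous_comp _ _ _ (fun q : R * R => polar q.1 q.2 : C R) (dx w)) cdx.
  exact: continuous_polar.
have cy : {for q, continuous (fun q => dy w (polar q.1 q.2))}.
  apply: (@continuous_comp _ _ _ (fun q : R * R => polar q.1 q.2 : C R) (dy w)) cdy.
  exact: continuous_polar.
have ccos : {for q, continuous (fun q : R * R => cos q.2)}.
  by apply: continuous_comp; [exact: cvg_snd|exact: continuous_cos].
have csin : {for q, continuous (fun q : R * R => sin q.2)}.
  by apply: continuous_comp; [exact: cvg_snd|exact: continuous_sin].
have c1 : {for q, continuous (fun q : R * R => q.1)} by exact: cvg_fst.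
have cR (f : R * R -> R) : {for q, continuous f} ->
    {for q, continuous (fun q => (f q)%:C : C R)} by move=> cf; exact: cvg_real_complex.
have cM (f g : R * R -> R) : {for q, continuous f} -> {for q, continuous g} ->
    {for q, continuous (fun q => f q * g q)} by move=> cf cg; apply: cvgM; [exact: cf|exact: cg].
have cN (f : R * R -> R) : {for q, continuous f} ->
    {for q, continuous (fun q => - f q)} by move=> cf; apply: cvgN; exact: cf.
have cW : {for q, continuous pullback}.
  have /subspace_continuousP/(_ q) := pullback_continuous.
  have [Oq1 Oq2] := Oq; move: Oq1 Oq2; rewrite /= !in_itv/= => /andP[h1 h2] /andP[h3 h4].
  have Tq : closed_wedge q by split; rewrite /= in_itv/= !ltW.
  move=> /(_ Tq); rewrite within_interior//.
  apply: filterS (open_nbhs_nbhs (conj open_open_wedge Oq)) => p [].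
  rewrite /= !in_itv/= => /andP[g1 g2] /andP[g3 g4].
  by split; rewrite /= in_itv/= !ltW.
have cg : {for q, continuous pullback_dbar}.
  apply: continuous_atM.
    apply: cvg_pair_complex; apply: cvgM; (try exact: cvg_cst).
      by apply: continuous_comp; [exact: (cN _ cvg_snd)|exact: continuous_cos].
    by apply: continuous_comp; [exact: (cN _ cvg_snd)|exact: continuous_sin].
  have c2 : {for q, continuous (fun=> 2^-1 : C R)} by exact: cvg_cst.
  have ci : {for q, continuous (fun=> 0 +i* 1 : C R)} by exact: cvg_cst.
  exact: (continuous_atM c2 (continuous_atD cx (continuous_atM ci cy))).
split; split.
- exact: cW.
- exact: cg.
- exact: (continuous_atD (continuous_atM cx (cR _ ccos)) (continuous_atM cy (cR _ csin))).
- exact: (continuous_atD (continuous_atM cx (cR _ (cN _ (cM _ _ c1 csin))))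
    (continuous_atM cy (cR _ (cM _ _ c1 ccos)))).
- exact: (is_cderive_polar_rho w_C1 D_open Dq).
- exact: (is_cderive_polar_t w_C1 D_open Dq).
rewrite /pullback_dbar /dbar; have [q1 _] := Oq.
have q10 : q.1 != 0.
  by move: q1; rewrite /= in_itv/= => /andP[rq _]; rewrite gt_eqF// (lt_trans r0).
set X := dx w _; set Y := dy w _.
have E1 : (- (q.1 * sin q.2))%:C / (q.1)%:C = - (sin q.2)%:C :> C R.
  by rewrite -fmorphV -rmorphM -rmorphN; congr (_%:C); field.
have E2 : (q.1 * cos q.2)%:C / (q.1)%:C = (cos q.2)%:C :> C R.
  by rewrite -fmorphV -rmorphM; congr (_%:C); field.
rewrite mulrDl -!mulrA E1 E2.
have -> : polar 1 (- q.2) = (cos q.2)%:C - imag R * (sin q.2)%:C.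
  by apply: complexP; rewrite ?ReD ?ImD ?ReN ?ImN ?ReM ?ImM/= ?cosN ?sinN; ring.
have ii : imag R * imag R = - 1 by apply: complexP; rewrite ?ReM ?ImM/=; ring.
have -> : (0 +i* 1 : C R) = imag R by [].
have h2 : 2 * (2^-1 : C R) = 1 by rewrite mulfV.
transitivity (2 * 2^-1 * (imag R * ((cos q.2)%:C - imag R * (sin q.2)%:C) * (X + imag R * Y))); last by ring.
rewrite h2 mul1r; transitivity (imag R * (cos q.2)%:C * X - (imag R * imag R) * (sin q.2)%:C * X
  + (imag R * imag R) * (cos q.2)%:C * Y - (imag R * imag R) * imag R * (sin q.2)%:C * Y).
  by rewrite ii; ring.
by ring.
Qed.

End polar_pullback.

Section area_term.
Context (R : realType).
Notation mu := (@lebesgue_measure R).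
Notation mu2 := (mu \x mu)%E.
Variables (alpha r : R) (w f : C R -> C R) (z : C R).
Hypotheses (r0 : 0 < r) (r1 : r < 1) (alpha_ge : 2^-1 <= alpha).
Hypotheses (w_C1 : C1_on (Omega alpha r) w)
  (w_cont : {within closure (Omega alpha r), continuous w}).
Hypotheses (f_dbar : forall z, Omega alpha r z -> f z = dbar w z) (zO : Omega alpha r z).

Let alpha0 : 0 < alpha. Proof. by apply: lt_le_trans alpha_ge; rewrite invr_gt0. Qed.

Definition polar_coord (z : C R) : R * R := (cmod z, carg z).

Let q0 := polar_coord z.
Let u := cpow alpha z.
Let a := r `^ alpha.

Let q0r : r < q0.1 < 1. Proof. by case: zO. Qed.
Let q0t : 0 < q0.2 < pi / alpha. Proof. by case: zO. Qed.

Let uI : a < cmod u < 1.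
Proof. exact: (cmod_wedge_pole alpha0 r0 q0r). Qed.

Definition polar_density (q : R * R) : C R :=
  kernelK alpha r u q * pullback_dbar w q -
  conjc (kernelK alpha r (conjc u) q * pullback_dbar w q : C R).

Lemma area_density_polar q : open_wedge alpha r q ->
  area_density alpha r f z (polar q.1 q.2) * (q.1)%:C = polar_density q.
Proof.
move=> Oq; have Dq := Omega_polar r0 alpha_ge Oq.
have [/= q1 q2] := Oq; move: q1 q2; rewrite !in_itv/= => /andP[q1 q1'] /andP[q2 q2'].
have q10 : 0 < q.1 by exact: lt_trans q1.
have cm : cmod (polar q.1 q.2) = q.1 by rewrite cmod_polar// ltW.
have ca : carg (polar q.1 q.2) = q.2.
  by rewrite carg_polar// (ltW q2)/= (lt_le_trans q2')// angle_le.
rewrite /area_density /cpow cm ca (f_dbar Dq) -/u.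
have Aq : annular r q by rewrite /annular/= !ltW.
have pb := vpow_annular alpha0 r0 Aq.
rewrite /polar_density.
have -> : conjc (kernelK alpha r (conjc u) q * pullback_dbar w q : C R) =
    conjc (kernelK alpha r (conjc u) q) * conjc (pullback_dbar w q) :> C R.
  exact: (rmorphM (@conjc R)).
rewrite /kernelK (conj_H2 alpha0 r0 r1 (conj uI pb)).
have E : ppow (alpha - 1) q.1 q.2 * (q.1)%:C = vpow alpha q * polar 1 (- q.2).
  have -> : (q.1)%:C = polar q.1 0 :> C R.
    by apply: complexP; rewrite /= ?cos0 ?sin0 ?mulr1 ?mulr0.
  rewrite /vpow /ppow !polarM addr0 mulr1; congr polar.
    rewrite -{2}(powRr1 (ltW q10)) -powRD ?subrK//.
    by rewrite (gt_eqF q10) implybT.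
  by ring.
have cE : conjc (ppow (alpha - 1) q.1 q.2) * (q.1)%:C =
    conjc (vpow alpha q) * conjc (polar 1 (- q.2)) :> C R.
  transitivity (conjc (ppow (alpha - 1) q.1 q.2 * (q.1)%:C : C R) : C R).
    transitivity (conjc (ppow (alpha - 1) q.1 q.2) * conjc ((q.1)%:C : C R) : C R).
      by congr (_ * _); rewrite conjc_real.
    by symmetry; exact: (rmorphM (@conjc R)).
  by rewrite E; exact: (rmorphM (@conjc R)).
have cg : conjc (pullback_dbar w q) =
    conjc (polar 1 (- q.2)) * conjc (dbar w (polar q.1 q.2)) :> C R.
  exact: (rmorphM (@conjc R)).
rewrite cg /pullback_dbar -/(vpow alpha q).
have alg (x1 x2 x3 x4 : C R) : x1 * x2 * x3 * x4 = x1 * x4 * (x2 * x3) by ring.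
rewrite mulrBl; congr (_ - _).
  by rewrite alg E; ring.
by rewrite alg cE; ring.
Qed.

Let S1 : open_wedge alpha r `\ q0 `<=` closed_wedge alpha r `\ q0.
Proof.
move=> q [[q1 q2] qq0]; split=> //; move: q1 q2.
by rewrite /= !in_itv/= => /andP[h1 h2] /andP[h3 h4]; split; rewrite /= in_itv/= !ltW.
Qed.

Lemma cmeasurable_polar_density : cmeasurable (open_wedge alpha r) polar_density.
Proof.
have mO : measurable (open_wedge alpha r).
  by apply: measurableX; exact: measurable_itv.
have m1 := measurable_set1_plane q0.
have mOq : measurable (open_wedge alpha r `\` [set q0]) by exact: measurableD.
have cg : {within open_wedge alpha r `\` [set q0], continuous (pullback_dbar w)}.
  apply: continuous_at_within => q [Oq _].
  have [Wr [Wt H]] := pullback_dbar_pair r0 r1 alpha_ge w_C1 w_cont.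
  by have [[_ h _ _] _] := H q Oq; exact: h.
have ck := kernelK_wedge alpha0 r0 r1 q0r q0t S1.
have ckb : {within open_wedge alpha r `\` [set q0], continuous (kernelK alpha r (conjc u))}.
  apply: continuous_subspaceW (kernelK_wedge_conj alpha0 r0 r1 q0r q0t).
  by move=> q /S1[].
have c1 := within_continuousM ck cg; have c2 := within_continuousM ckb cg.
have c3 : {within open_wedge alpha r `\` [set q0], continuous polar_density}.
  apply: within_continuousB; first exact: c1.
  by move=> q; apply: cvg_conjc; exact: c2.
exact: (cmeasurable_punctured mO (continuous_cmeasurable_plane mOq c3)).
Qed.

Section subsector.
Variables (s1 s2 t1 t2 : R).
Hypotheses (rs1 : r <= s1) (s21 : s2 <= 1) (t10 : 0 <= t1) (t2a : t2 <= pi / alpha).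
Let S : set (R * R) := `]s1, s2[ `*` `]t1, t2[.

Let SO : S `<=` open_wedge alpha r.
Proof.
move=> q [/=]; rewrite !in_itv/= => /andP[h1 h2] /andP[h3 h4].
have := rs1; have := s21; have := t10; have := t2a => g1 g2 g3 g4.
by split; rewrite /= in_itv/=; apply/andP; split; lra.
Qed.

Let mS : measurable S. Proof. by apply: measurableX; exact: measurable_itv. Qed.

Let polar_value (c : C R -> R) (q : R * R) : R := c (polar_density q) / q.1.

Let measurable_polar_value c : measurable_fun S (fun q => c (polar_density q)) ->
  measurable_fun S (polar_value c).
Proof.
move=> mc; apply: measurable_funM => //.
apply: (@measurableT_comp _ _ _ _ _ _ (@GRing.inv R : R -> R) _ (fst : R * R -> R)).
  exact: measurable_inv.
by apply: measurable_funTS; exact: measurable_fst.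
Qed.

Let cM (c : C R -> R) := forall (x : C R) (y : R), 0 <= y -> c (x * y%:C) = c x * y.

Let polar_valueE c p : cM c -> plane (sector_ring s1 s2 t1 t2) p ->
  polar_value c (cmod (p.1 +i* p.2), carg (p.1 +i* p.2)) =
  c (area_density alpha r f z (p.1 +i* p.2)).
Proof.
move=> cm [h1 h2]; rewrite /polar_value.
have Sq : S (cmod (p.1 +i* p.2), carg (p.1 +i* p.2)) by split; rewrite /= in_itv.
have m0 : cmod (p.1 +i* p.2) != 0.
  by case/andP: h1 => h1 _; rewrite gt_eqF// (lt_trans _ h1)// (lt_le_trans r0).
rewrite -(area_density_polar (SO Sq)) /= cm ?cmod_ge0// mulfK//.
by rewrite (polarK (z := p.1 +i* p.2)) // -cmod_eq0.
Qed.

Let integral_polar (c : C R -> R) : cM c ->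
  measurable_fun S (fun q => c (polar_density q)) ->
  (\int[mu2]_(p in plane (sector_ring s1 s2 t1 t2))
     (c (area_density alpha r f z (p.1 +i* p.2)))%:E =
   \int[mu2]_(q in S) (c (polar_density q))%:E)%E.
Proof.
move=> cm mc; have s10 : 0 <= s1 by exact: le_trans (ltW r0) rs1.
have t22 : t2 <= 2 * pi by apply: le_trans t2a (angle_le alpha_ge).
transitivity (\int[mu2]_(q in S) (polar_value c q * q.1)%:E)%E.
  rewrite -(integral_sector s10 t10 t22 (measurable_polar_value mc)).
  by apply: eq_integral => p; rewrite inE => /(polar_valueE cm) <-.
apply: eq_integral => q; rewrite inE => /SO[/=]; rewrite in_itv/= => /andP[rq _] _.
by rewrite /polar_value mulfVK// gt_eqF// (lt_trans r0).
Qed.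

Let mdens : cmeasurable S polar_density.
Proof.
have mO : measurable (open_wedge alpha r).
  by apply: measurableX; exact: measurable_itv.
have [mR mI] := cmeasurable_polar_density.
by split; [exact: measurable_funS SO mR|exact: measurable_funS SO mI].
Qed.

Let ReMr : cM (@complex.Re R).
Proof. by move=> x y _; rewrite ReM/= mulr0 subr0. Qed.

Let ImMr : cM (@complex.Im R).
Proof. by move=> x y _; rewrite ImM/= mulr0 add0r. Qed.

Lemma iint_polar : iint (sector_ring s1 s2 t1 t2) (area_density alpha r f z) =
  cint mu2 S polar_density.
Proof.
have [mR mI] := mdens.
by apply: complexP; rewrite /= /Rintegral;
  [rewrite (integral_polar ReMr mR)|rewrite (integral_polar ImMr mI)].
Qed.

Lemma area_integrable_polar :
  area_integrable (sector_ring s1 s2 t1 t2) (area_density alpha r f z) ->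
  cintegrable mu2 S polar_density.
Proof.
have [mR mI] := mdens.
have key (c : C R -> R) : cM c -> measurable_fun S (fun q => c (polar_density q)) ->
    mu2.-integrable (plane (sector_ring s1 s2 t1 t2))
      (fun p : R * R => (c (area_density alpha r f z (p.1 +i* p.2)))%:E) ->
    mu2.-integrable S (fun q => (c (polar_density q))%:E).
  move=> cm mc /integrableP[_ fin]; apply/integrableP; split; first exact/measurable_EFinP.
  have cm' : cM (fun x => `|c x|) by move=> x y y0; rewrite cm// normrM (ger0_norm y0).
  have mc' : measurable_fun S (fun q => `|c (polar_density q)|).
    by apply: measurableT_comp mc; exact: normr_measurable.
  have := integral_polar cm' mc'; under [in RHS]eq_integral do rewrite -abse_EFin.
  by move=> /= <-.
by move=> [iR iI]; split; [exact: key ReMr mR iR|exact: key ImMr mI iI].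
Qed.

End subsector.

End area_term.

Lemma boundary_algebra (K : numFieldType) (a P I h0 h0' v1 v1' ht ht' vr vr' J : K) :
  P != 0 -> I != 0 ->
  a / (2 * (P * I)) *
    (I * (v1 - v1') - 2 * I * (I * J) + - (I * (vr - vr'))) +
  a / (P * I) * (- (2^-1 * (ht + ht')) + 2^-1 * (h0 + h0')) + a / P * (I * J) =
  a / (2 * (P * I)) *
    (h0 + I * v1 - ht - I * vr + (h0' - I * v1' - ht' + I * vr')).
Proof. by move=> P0 I0; field; rewrite P0 I0. Qed.

Section boundary_term.
Context (R : realType).
Notation mu := (@lebesgue_measure R).
Notation mu2 := (mu \x mu)%E.

Lemma coint_cint (a b : R) (G : R -> C R) : a <= b -> coint a b G = cint mu `[a, b] G.
Proof. by move=> ab; rewrite /coint /oint ab. Qed.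

Lemma coint_cintN (a b : R) (G : R -> C R) : b < a -> coint a b G = - cint mu `[b, a] G.
Proof. by move=> ba; rewrite /coint /oint leNgt ba. Qed.

Lemma conjcM (x y : C R) : conjc (x * y : C R) = (conjc x : C R) * conjc y.
Proof. exact: (rmorphM (@conjc R)). Qed.

Lemma conjcD (x y : C R) : conjc (x + y : C R) = (conjc x : C R) + conjc y.
Proof. exact: (rmorphD (@conjc R)). Qed.

Lemma conjcB (x y : C R) : conjc (x - y : C R) = (conjc x : C R) - conjc y.
Proof. exact: (rmorphB (@conjc R)). Qed.

Lemma conjc_imag (x : C R) : conjc (imag R * x : C R) = - (imag R * conjc x) :> C R.
Proof.
by apply: complexP; rewrite ?ReN ?ImN ?Re_conjc ?Im_conjc ?ReM ?ImM ?Re_conjc ?Im_conjc/=; ring.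
Qed.

Lemma add_conjc (x : C R) : x + conjc x = 2 * (complex.Re x)%:C.
Proof. by apply: complexP; rewrite ?ReD ?ImD ?ReM ?ImM ?Re_conjc ?Im_conjc/=; ring. Qed.

Lemma sub_conjc (x : C R) : x - conjc x = 2 * (imag R * (complex.Im x)%:C).
Proof.
by apply: complexP; rewrite ?ReD ?ImD ?ReN ?ImN !(ReM,ImM) ?Re_conjc ?Im_conjc/=; ring.
Qed.

Variables (alpha r : R) (w f : C R -> C R) (z : C R).
Hypotheses (r0 : 0 < r) (r1 : r < 1) (alpha_ge : 2^-1 <= alpha).
Hypotheses (w_C1 : C1_on (Omega alpha r) w)
  (w_cont : {within closure (Omega alpha r), continuous w}).
Hypotheses (f_dbar : forall z, Omega alpha r z -> f z = dbar w z) (zO : Omega alpha r z).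

Let alpha0 : 0 < alpha. Proof. by apply: lt_le_trans alpha_ge; rewrite invr_gt0. Qed.

Let q0 := polar_coord z.
Let u := cpow alpha z.
Let a := r `^ alpha.
Let theta := pi / alpha.
Let q0r : r < q0.1 < 1. Proof. by case: zO. Qed.
Let q0t : 0 < q0.2 < theta. Proof. by case: zO. Qed.
Let theta0 : 0 < theta. Proof. by case/andP: q0t; exact: lt_trans. Qed.
Let uI : a < cmod u < 1. Proof. exact: (cmod_wedge_pole alpha0 r0 q0r). Qed.

Let W := pullback w.
Let Ku := kernelK alpha r u.
Let Kb := kernelK alpha r (conjc u).

Let vI q : r <= q.1 <= 1 -> a <= cmod (vpow alpha q) <= 1.
Proof. exact: (vpow_annular alpha0 r0). Qed.

Let conj_Kb q : r <= q.1 <= 1 ->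
  conjc (Kb q) = conjc (vpow alpha q) * H2 alpha r u (conjc (vpow alpha q)) :> C R.
Proof. by move=> qI; exact: (conj_H2 alpha0 r0 r1 (conj uI (vI qI))). Qed.

Let arc_cancel (x : C R) rho t : 0 < rho -> x / polar rho t * ((0 +i* 1) * polar rho t) = imag R * x.
Proof.
move=> rho0; rewrite -[0 +i* 1]/(imag R); field; exact: polar_neq0.
Qed.

Let outer_arc t : 
  (complex.Re (w (polar 1 t)))%:C * H1 alpha r u (ppow alpha 1 t) =
  W (1, t) * Ku (1, t) - conjc (W (1, t) * Kb (1, t) : C R)
   - 2 * imag R * (complex.Im (w (polar 1 t)))%:C.
Proof.
have qI : r <= (1 : R, t).1 <= 1 by apply/andP; split => /=; [exact: ltW|].

have v1 : cmod (vpow alpha (1, t)) = 1 by rewrite cmod_vpow powR1.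
rewrite conjcM (conj_Kb qI) -[ppow alpha 1 t]/(vpow alpha (1, t)).
rewrite (H2_conj_unit alpha0 r0 r1 (conj uI (vI qI)) v1).
rewrite (H1_unit alpha0 r0 r1 (conj uI (vI qI)) v1) /Ku /kernelK.
set k := vpow alpha (1, t) * _; set x := W (1, t).
have xR : x + conjc x = 2 * (complex.Re x)%:C := add_conjc x.
have xI : x - conjc x = 2 * (imag R * (complex.Im x)%:C) := sub_conjc x.
transitivity ((x + conjc x) * (k - 1)); first by rewrite xR; ring.
transitivity (x * k - conjc x * (2 - k) - (x - conjc x)); first by ring.
by rewrite xI; ring.
Qed.

Let inner_arc t :
  (complex.Re (w (polar r t)))%:C * H1 alpha r u (ppow alpha r t) =
  W (r, t) * Ku (r, t) - conjc (W (r, t) * Kb (r, t) : C R).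
Proof.
have qI : r <= (r, t).1 <= 1 by apply/andP; split => /=; [|exact: ltW].
have va : cmod (vpow alpha (r, t)) = a by rewrite cmod_vpow.
rewrite conjcM (conj_Kb qI) -[ppow alpha r t]/(vpow alpha (r, t)).
rewrite (H2_conj_inner alpha0 r0 r1 (conj uI (vI qI)) va).
rewrite (H1_inner alpha0 r0 r1 (conj uI (vI qI)) va) /Ku /kernelK.
set k := vpow alpha (r, t) * _; set x := W (r, t).
have xR : x + conjc x = 2 * (complex.Re x)%:C := add_conjc x.
transitivity ((x + conjc x) * k); first by rewrite xR; ring.
by ring.
Qed.

Let ray x y : r <= x <= 1 -> y = 0 \/ y = theta ->
  2 * ((complex.Re (w (polar x y)))%:C * H2 alpha r u (ppow alpha x y) * ppow (alpha - 1) x y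
    * polar 1 y) =
  W (x, y) * Ku (x, y) / x%:C + conjc (W (x, y) * Kb (x, y) / x%:C : C R).
Proof.
move=> xI y0; have x0 : 0 < x by case/andP: xI => + _; exact: lt_le_trans.
have qI : r <= (x, y).1 <= 1 by [].
have cv : conjc (vpow alpha (x, y)) = vpow alpha (x, y).
  have s0 : sin (alpha * y) = 0.
    by case: y0 => ->; rewrite ?mulr0 ?sin0// /theta mulrC divfK ?gt_eqF// sinpi.
  by apply: complexP; rewrite ?Re_conjc ?Im_conjc//= s0 mulr0 oppr0.
have pE : ppow (alpha - 1) x y * polar 1 y = vpow alpha (x, y) / x%:C.
  apply: (@mulIf _ x%:C); first exact: realC_neq0.
  rewrite mulfVK; last exact: realC_neq0.
  have -> : x%:C = polar x 0 :> C R.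
    by apply: complexP; rewrite /= ?cos0 ?sin0 ?mulr1 ?mulr0.
  rewrite /vpow /ppow !polarM addr0 mulr1; congr polar.
    rewrite -{2}(powRr1 (ltW x0)) -powRD ?subrK//.
    by rewrite (gt_eqF x0) implybT.
  by rewrite /=; ring.
rewrite -[_ * ppow _ _ _ * _]mulrA pE.
have -> : conjc (W (x, y) * Kb (x, y) / x%:C : C R) =
    conjc (W (x, y)) * conjc (Kb (x, y)) / x%:C :> C R.
  rewrite conjcM conjcM; congr (_ * _); rewrite -(conjc_real x).
  by rewrite -[RHS]fmorphV conjc_real.
rewrite (conj_Kb qI) cv /Ku /kernelK -[ppow alpha x y]/(vpow alpha (x, y)).
set k := H2 _ _ _ _; set v := vpow _ _; set xx := W (x, y).
have xR : xx + conjc xx = 2 * (complex.Re xx)%:C := add_conjc xx.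
transitivity ((xx + conjc xx) * k * v / x%:C); first by rewrite xR; ring.
by ring.
Qed.

Let x1 := (r + q0.1) / 2.
Let x2 := (q0.1 + 1) / 2.
Let y1 := q0.2 / 2.
Let y2 := (q0.2 + theta) / 2.

Let hole : [/\ r < x1, x1 < q0.1, q0.1 < x2 & x2 < 1] /\
  [/\ 0 < y1, y1 < q0.2, q0.2 < y2 & y2 < theta].
Proof.
have /andP[h1 h2] := q0r; have /andP[h3 h4] := q0t.
by rewrite /x1 /x2 /y1 /y2; split; split; lra.
Qed.

Let rx1 : r < x1. Proof. by case: hole => -[]. Qed.
Let x12 : x1 <= x2. Proof. by case: hole => -[_ h1 h2 _] _; exact: ltW (lt_trans h1 h2). Qed.
Let x21 : x2 < 1. Proof. by case: hole => -[]. Qed.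
Let y10 : 0 < y1. Proof. by case: hole => _ []. Qed.
Let y12 : y1 <= y2. Proof. by case: hole => _ [_ h1 h2 _]; exact: ltW (lt_trans h1 h2). Qed.
Let y2t : y2 < theta. Proof. by case: hole => _ []. Qed.

Let N := frame r 1 0 theta x1 x2 y1 y2.

Let NT : N `<=` closed_wedge alpha r `\ q0.
Proof.
move=> q [Tq qN]; split=> // /= qq; move: qN; rewrite qq.
have [[_ h1 h2 _] [_ h3 h4 _]] := hole.
by move=> [[[]|]|] /=; apply/negP; rewrite -ltNge.
Qed.

Let cW : {within closed_wedge alpha r, continuous W}.
Proof. exact: (pullback_continuous r0 r1 alpha_ge w_cont). Qed.

Let cWu : {within N, continuous (fun q => W q * Ku q)}.
Proof.
apply: within_continuousM; last exact: (kernelK_wedge alpha0 r0 r1 q0r q0t NT).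
by apply: continuous_subspaceW cW => q /NT[].
Qed.

Let cWb : {within closed_wedge alpha r, continuous (fun q => W q * Kb q)}.
Proof. exact: (within_continuousM cW (kernelK_wedge_conj alpha0 r0 r1 q0r q0t)). Qed.

Let cWb' : {within N, continuous (fun q => W q * Kb q)}.
Proof. by apply: continuous_subspaceW cWb => q /NT[]. Qed.

Definition boundary_sum x1 x2 y1 y2 : C R :=
  bdry x1 x2 y1 y2 (fun q => W q * Ku q) +
  conjc (bdry x1 x2 y1 y2 (fun q => W q * Kb q)).

Lemma cvg_boundary_sum :
  boundary_sum (r + e) (1 - e) e (theta - e) @[e --> 0^'+] --> boundary_sum r 1 0 theta.
Proof.
have h1 := cvg_bdry r0 rx1 x12 x21 y10 y12 y2t cWu.
have h2 := cvg_bdry r0 rx1 x12 x21 y10 y12 y2t cWb'.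
move: h2 => /cvg_conjc h2.
rewrite (_ : (fun e => _) = (fun e =>
  bdry (r + e) (1 - e) (0 + e) (theta - e) (fun q => W q * Ku q) +
  conjc (bdry (r + e) (1 - e) (0 + e) (theta - e) (fun q => W q * Kb q)))).
  by apply: cvgD; [exact: h1|exact: h2].
by apply/funext => e; rewrite add0r.
Qed.

Let conj_bdry_expand (A B D E : C R) :
  conjc (A + imag R * B - D - imag R * E : C R) =
  conjc A - imag R * conjc B - conjc D + imag R * conjc E :> C R.
Proof. by rewrite !conjcB conjcD !conjc_imag opprK. Qed.

Let iu := frame_bdry_integrable r0 rx1 x12 x21 y10 y12 y2t cWu.
Let ib := frame_bdry_integrable r0 rx1 x12 x21 y10 y12 y2t cWb'.

Let mI (b c : R) : measurable (`[b, c]%classic : set R).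
Proof. exact: measurable_itv. Qed.

Let iWc (F : R -> C R) b c : cintegrable mu `[b, c] F ->
  cint mu `[b, c] (fun x => conjc (F x)) = conjc (cint mu `[b, c] F).
Proof. by move=> iF; apply: cint_conj. Qed.

Let iB (F G : R -> C R) b c : cintegrable mu `[b, c] F -> cintegrable mu `[b, c] G ->
  cintegrable mu `[b, c] (fun x => F x - G x).
Proof. by move=> iF iG; apply: cintegrableB; [exact: mI|exact: iF|exact: iG]. Qed.

Let iD (F G : R -> C R) b c : cintegrable mu `[b, c] F -> cintegrable mu `[b, c] G ->
  cintegrable mu `[b, c] (fun x => F x + G x).
Proof. by move=> iF iG; apply: cintegrableD; [exact: mI|exact: iF|exact: iG]. Qed.

Let iZ (k : C R) (F : R -> C R) b c : cintegrable mu `[b, c] F ->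
  cintegrable mu `[b, c] (fun x => k * F x).
Proof. by move=> iF; apply: cintegrableZl; [exact: mI|exact: iF]. Qed.

Let iC (F : R -> C R) b c : cintegrable mu `[b, c] F ->
  cintegrable mu `[b, c] (fun x => conjc (F x)).
Proof. by move=> iF; apply: cintegrable_conj; [exact: mI|exact: iF]. Qed.

Let eB (F G : R -> C R) b c : cintegrable mu `[b, c] F -> cintegrable mu `[b, c] G ->
  cint mu `[b, c] (fun x => F x - G x) = cint mu `[b, c] F - cint mu `[b, c] G.
Proof. by move=> iF iG; apply: cintB; [exact: mI|exact: iF|exact: iG]. Qed.

Let eD (F G : R -> C R) b c : cintegrable mu `[b, c] F -> cintegrable mu `[b, c] G ->
  cint mu `[b, c] (fun x => F x + G x) = cint mu `[b, c] F + cint mu `[b, c] G.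
Proof. by move=> iF iG; apply: cintD; [exact: mI|exact: iF|exact: iG]. Qed.

Let eZ (k : C R) (F : R -> C R) b c : cintegrable mu `[b, c] F ->
  cint mu `[b, c] (fun x => k * F x) = k * cint mu `[b, c] F.
Proof. by move=> iF; apply: cintZl; [exact: mI|exact: iF]. Qed.

Let iW1 : cintegrable mu `[0, theta] (fun t => (complex.Im (w (polar 1 t)))%:C : C R).
Proof.
apply: continuous_cintegrable.
have c1 : {within `[0, theta], continuous (fun t => W (1, t))}.
  by apply: (within_continuous_section2 cW); rewrite lexx ltW.
move=> t; apply: cvg_real_complex.
exact: (within_continuous_Im c1).
Qed.

Lemma representation_boundary D :
  representation alpha r w f z D =
  alpha%:C / (2 * (pi%:C * imag R)) * boundary_sum r 1 0 theta
  - alpha%:C / pi%:C * iint D (area_density alpha r f z).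
Proof.
have [u1 u2 u3 u4] := iu; have [b1 b2 b3 b4] := ib.
rewrite /representation; congr (_ - _).
rewrite -/u -[0 +i* 1]/(imag R).
set F1 := fun rho t : R => _ * H1 _ _ _ _ / _.
set F2 := fun rho t : R => _ * H2 _ _ _ _ * _.
pose J := cint mu `[0, theta] (fun t => (complex.Im (w (polar 1 t)))%:C : C R).
have EJ : int_Gamma1 alpha (fun rho t => (complex.Im (w (polar rho t)))%:C / polar rho t) =
    imag R * J.
  rewrite /int_Gamma1 /arc_int coint_cint ?(ltW theta0)// /J -(eZ _ iW1).
  by apply: eq_cint => t _; exact: arc_cancel.
have E1 : int_Gamma1 alpha F1 =
    imag R * (cint mu `[0, theta] (fun t => W (1, t) * Ku (1, t)) -
      conjc (cint mu `[0, theta] (fun t => W (1, t) * Kb (1, t)))) - 2 * imag R * (imag R * J).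
  rewrite /int_Gamma1 /arc_int coint_cint ?(ltW theta0)//.
  have i1 := iC b4.
  have i2 := iB u4 i1.
  have i3 := iZ (2 * imag R) iW1.
  have -> : cint mu `[0, theta] (fun t => F1 1 t * ((0 +i* 1) * polar 1 t)) =
      cint mu `[0, theta] (fun t => imag R * (W (1, t) * Ku (1, t) -
        conjc (W (1, t) * Kb (1, t) : C R) - 2 * imag R * (complex.Im (w (polar 1 t)))%:C)).
    by apply: eq_cint => t _; rewrite /F1 arc_cancel// outer_arc.
  by rewrite (eZ _ (iB i2 i3)) (eB i2 i3) (eB u4 i1) (iWc b4) (eZ _ iW1) -/J; ring.
have E2 : int_Gamma2 alpha r F1 =
    - (imag R * (cint mu `[0, theta] (fun t => W (r, t) * Ku (r, t)) -
      conjc (cint mu `[0, theta] (fun t => W (r, t) * Kb (r, t))))).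
  rewrite /int_Gamma2 /arc_int coint_cintN//; congr (- _).
  have i1 := iC b3.
  have i2 := iB u3 i1.
  rewrite -(iWc b3) -(eB u3 i1) -(eZ _ i2).
  by apply: eq_cint => t _; rewrite /F1 arc_cancel// inner_arc.
have ER y : y = 0 \/ y = theta ->
    cintegrable mu `[r, 1] (fun x => W (x, y) * Ku (x, y) / x%:C) ->
    cintegrable mu `[r, 1] (fun x => W (x, y) * Kb (x, y) / x%:C) ->
    cint mu `[r, 1] (fun x => F2 x y * polar 1 y) = 2^-1 *
    (cint mu `[r, 1] (fun x => W (x, y) * Ku (x, y) / x%:C) +
     conjc (cint mu `[r, 1] (fun x => W (x, y) * Kb (x, y) / x%:C))).
  move=> yE j1 j2.
  have i1 := iC j2.
  rewrite -(iWc j2) -(eD j1 i1) -(eZ _ (iD j1 i1)).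
  apply: eq_cint => x; rewrite inE/= in_itv/= => xI.
  by rewrite -(ray xI yE) mulKf// pnatr_eq0.
have E3 : int_r_1 r F2 = 2^-1 *
    (cint mu `[r, 1] (fun x => W (x, 0) * Ku (x, 0) / x%:C) +
     conjc (cint mu `[r, 1] (fun x => W (x, 0) * Kb (x, 0) / x%:C))).
  by rewrite /int_r_1 /ray_int coint_cint ?(ltW r1)// ER//; left.
have E4 : int_varpi_omega alpha r F2 = - (2^-1 *
    (cint mu `[r, 1] (fun x => W (x, theta) * Ku (x, theta) / x%:C) +
     conjc (cint mu `[r, 1] (fun x => W (x, theta) * Kb (x, theta) / x%:C)))).
  by rewrite /int_varpi_omega /ray_int coint_cintN// ER//; right.
rewrite EJ E1 E2 E3 E4 /boundary_sum /bdry conj_bdry_expand.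
have pi0 : (pi%:C : C R) != 0 by apply: realC_neq0; exact: pi_gt0.
have I0 : imag R != 0 by rewrite -cmod_eq0 cmod_imag oner_eq0.
exact: boundary_algebra.
Qed.

End boundary_term.

Section exhaustion.
Context (R : realType).
Notation mu := (@lebesgue_measure R).
Notation mu2 := (mu \x mu)%E.

Lemma cvg_cint_exhaustion (D : set (R * R)) (E : nat -> set (R * R)) (F : R * R -> C R) :
  measurable D -> (forall n, measurable (E n)) -> (forall n, E n `<=` D) ->
  (forall q, D q -> \forall n \near \oo, E n q) -> cintegrable mu2 D F ->
  cint mu2 (E n) F @[n --> \oo] --> cint mu2 D F.
Proof.
move=> mD mE ED Ecvg iF.
have key (c : R * R -> R) : mu2.-integrable D (EFin \o c) ->
    \int[mu2]_(q in E n) c q @[n --> \oo] --> \int[mu2]_(q in D) c q.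
  move=> ic; apply: fine_cvg; rewrite fineK; last exact: integrable_fin_num.
  have ED' n : (\int[mu2]_(q in E n) (c q)%:E = \int[mu2]_(q in D) ((EFin \o c) \_ (E n)) q)%E.
    by rewrite -integral_mkcondr; congr (integral _ _ _); apply/esym/setIidPr; exact: ED.
  under eq_fun do rewrite ED'.
  have mc : measurable_fun D (EFin \o c) by case/integrableP: ic.
  pose cn n := (EFin \o c) \_ (E n).
  have mcn n : measurable_fun D (cn n).
    apply/(measurable_restrict (EFin \o c) (mE n) mD).
    by apply: (measurable_funS mD _ mc); exact: subIsetl.
  have cnc : {ae mu2, forall q, D q -> cn ^~ q @ \oo --> (c q)%:E}.
    apply: aeW => q Dq; apply: cvg_near_cst; apply: filterS (Ecvg q Dq) => n Enq.
    by rewrite /cn /= patchE mem_set.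
  have ia := integrable_abse ic.
  have cb : {ae mu2, forall q n, D q -> (`|cn n q| <= (abse \o (EFin \o c)) q)%E}.
    apply: aeW => q n Dq; rewrite /cn patchE; case: ifPn => //= _.
    by rewrite normr0 lee_fin.
  by have [_ _] := @dominated_convergence _ _ R mu2 D mD cn (EFin \o c) _ mcn mc cnc ia cb.
by apply/cvg_complexP; split; apply: key; case: iF.
Qed.

End exhaustion.

Lemma conjc_2i (R : realType) (B : C R) :
  conjc (2 * imag R * B : C R) = - (2 * imag R * conjc B) :> C R.
Proof.
by apply: complexP;
  rewrite ?ReN ?ImN ?Re_conjc ?Im_conjc !(ReM, ImM) ?Re_conjc ?Im_conjc/=; ring.
Qed.

Lemma area_algebra (K : numFieldType) (al P I A B x : K) :
  al != 0 -> P != 0 -> I != 0 -> al / P * (A - B) =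
  al / (2 * (P * I)) * (2 * I * A + 2 * I * (P / al) * x + - (2 * I * B)) - x.
Proof. by move=> al0 P0 I0; field; rewrite al0 P0 I0. Qed.

Section truncated.
Context (R : realType).
Notation mu := (@lebesgue_measure R).
Notation mu2 := (mu \x mu)%E.
Variables (alpha r : R) (w f : C R -> C R) (z : C R).
Hypotheses (r0 : 0 < r) (r1 : r < 1) (alpha_ge : 2^-1 <= alpha).
Hypotheses (w_C1 : C1_on (Omega alpha r) w)
  (w_cont : {within closure (Omega alpha r), continuous w}).
Hypotheses (f_dbar : forall z, Omega alpha r z -> f z = dbar w z) (zO : Omega alpha r z).

Let alpha0 : 0 < alpha. Proof. by apply: lt_le_trans alpha_ge; rewrite invr_gt0. Qed.
Let q0 := polar_coord z.
Let q0r : r < q0.1 < 1. Proof. by case: zO. Qed.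
Let q0t : 0 < q0.2 < pi / alpha. Proof. by case: zO. Qed.

Definition margin : R :=
  Num.min (Num.min (q0.1 - r) (1 - q0.1)) (Num.min q0.2 (pi / alpha - q0.2)).

Lemma margin_gt0 : 0 < margin.
Proof. by rewrite !lt_min !subr_gt0; case/andP: q0r => -> ->; case/andP: q0t => -> ->. Qed.

Lemma area_term_trunc e : 0 < e < margin ->
  alpha%:C / pi%:C * iint (Omega_trunc alpha r e) (area_density alpha r f z) =
  alpha%:C / (2 * (pi%:C * imag R)) *
    boundary_sum alpha r w z (r + e) (1 - e) e (pi / alpha - e) - w z.
Proof.
move=> /andP[e0]; rewrite !lt_min => /andP[/andP[e1 e2] /andP[e3 e4]].
have h1 : r <= r + e by lra.
have h2 : r + e < q0.1 by lra.
have h3 : q0.1 < 1 - e by lra.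
have h4 : 1 - e <= 1 by lra.
have h5 : 0 <= e by lra.
have h6 : e < q0.2 by lra.
have h7 : q0.2 < pi / alpha - e by lra.
have h8 : pi / alpha - e <= pi / alpha by lra.
rewrite /Omega_trunc (iint_polar r0 r1 alpha_ge w_C1 w_cont f_dbar zO h1 h4 h5 h8).
set S : set (R * R) := `[r + e, 1 - e] `*` `[e, pi / alpha - e].
have SO : S `<=` open_wedge alpha r.
  move=> q [/=]; rewrite !in_itv/= => /andP[g1 g2] /andP[g3 g4].
  by split; rewrite /= in_itv/=; apply/andP; split; lra.
have HW := pullback_dbar_pair r0 r1 alpha_ge w_C1 w_cont.
have Bu := bdry_kernelK alpha0 r0 r1 q0r q0t h1 h2 h3 h4 h5 h6 h7 h8 SO HW.
have Bb := bdry_kernelK_conj alpha0 r0 r1 q0r q0t h1 h2 h3 h4 h5 h6 h7 h8 SO HW.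
have iu := cintegrable_kernelK alpha0 r0 r1 q0r q0t h1 h2 h3 h4 h5 h6 h7 h8 SO HW.
have ib := cintegrable_kernelK_conj alpha0 r0 r1 q0r q0t h1 h4 h5 h8 SO HW.
have mS : measurable S by exact: measurable_rect.
have ibc : cintegrable mu2 S (fun q =>
    conjc (kernelK alpha r (conjc (cpow alpha z)) q * pullback_dbar w q : C R) : C R).
  by apply: cintegrable_conj; [exact: mS|exact: ib].
have ED : cint mu2 (`]r + e, 1 - e[ `*` `]e, pi / alpha - e[) (polar_density alpha r w z) =
    cint mu2 S (polar_density alpha r w z).
  apply: cint_rect_boundary => //.
  - by apply: measurableX; exact: measurable_itv.
  - move=> q [/=]; rewrite ?in_itv/= => /andP[g1 g2] /andP[g3 g4].
    by split; rewrite /= ?in_itv/= !ltW.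
  - by apply: cintegrableB; [exact: mS|exact: iu|exact: ibc].
have EB : cint mu2 S (polar_density alpha r w z) =
    cint mu2 S (fun q => kernelK alpha r (cpow alpha z) q * pullback_dbar w q) -
    cint mu2 S (fun q =>
      conjc (kernelK alpha r (conjc (cpow alpha z)) q * pullback_dbar w q : C R)).
  by apply: cintB; [exact: mS|exact: iu|exact: ibc].
have EC : cint mu2 S (fun q =>
      conjc (kernelK alpha r (conjc (cpow alpha z)) q * pullback_dbar w q : C R)) =
    conjc (cint mu2 S (fun q => kernelK alpha r (conjc (cpow alpha z)) q * pullback_dbar w q)).
  by apply: cint_conj; [exact: mS|exact: ib].
rewrite ED EB EC /boundary_sum Bu Bb.
have z0 : z != 0.
  by rewrite -cmod_eq0 gt_eqF//; case/andP: q0r => + _; exact: lt_trans.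
have -> : pullback w q0 = w z by rewrite /pullback /q0 /polar_coord/= polarK.
rewrite conjc_2i.
have pi0 : (pi%:C : C R) != 0 by apply: realC_neq0; exact: pi_gt0.
have al0 : (alpha%:C : C R) != 0 by exact: realC_neq0.
have I0 : imag R != 0 by rewrite -cmod_eq0 cmod_imag oner_eq0.
have -> : (pi / alpha)%:C = pi%:C / alpha%:C :> C R by rewrite rmorphM fmorphV.
exact: area_algebra.
Qed.

End truncated.

Lemma cvg_seq_at_right0 (R : realType) (v : nat -> R) :
  (forall n, 0 < v n) -> v n @[n --> \oo] --> 0 -> v n @[n --> \oo] --> 0^'+.
Proof.
move=> v0 vl A [d d0' HA]; have d0 : 0 < d by [].
have /cvgrPdist_lt/(_ d d0) := vl.
by apply: filterS => n h; apply: HA => //; exact: h.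
Qed.

Lemma cvg_affine (R : realType) (T : Type) (F : set_system T) (FF : Filter F)
    (g : T -> C R) (b k l : C R) :
  g @ F --> l -> b - k * g x @[x --> F] --> b - k * l.
Proof.
move=> gl; apply: cvgB; first exact: cvg_cst.
by apply: cvgM; [exact: cvg_cst|exact: gl].
Qed.

Theorem theorem2p1 (R : realType) (r alpha : R) (w f : C R -> C R)
    (r_gt0 : 0 < r) (r_lt1 : r < 1) (alpha_ge : 2^-1 <= alpha)
    (w_C1 : C1_on (Omega alpha r) w)
    (w_cont : {within closure (Omega alpha r), continuous w})
    (f_dbar : forall z, Omega alpha r z -> f z = dbar w z)
    (z : C R) (z_in : Omega alpha r z) :
  (representation alpha r w f z (Omega_trunc alpha r e) @[e --> 0^'+]
     --> w z) /\
  (area_integrable (Omega alpha r) (area_density alpha r f z) ->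
   w z = representation alpha r w f z (Omega alpha r)).
Proof.
have repE D := representation_boundary f r_gt0 r_lt1 alpha_ge w_cont z_in D.
set c : C R := alpha%:C / (2 * (pi%:C * imag R)) in repE.
have m0 := margin_gt0 z_in.
have part1 : representation alpha r w f z (Omega_trunc alpha r e) @[e --> 0^'+] --> w z.
  have cX := cvg_boundary_sum r_gt0 r_lt1 alpha_ge w_cont z_in.
  have E (x y : C R) : x - (x - y) = y by rewrite opprB addrC subrK.
  rewrite -[X in _ --> X](E (c * boundary_sum alpha r w z r 1 0 (pi / alpha))).
  have cc : c * boundary_sum alpha r w z r 1 0 (pi / alpha)
      - (c * boundary_sum alpha r w z (r + e) (1 - e) e (pi / alpha - e) - w z)
      @[e --> 0^'+] --> c * boundary_sum alpha r w z r 1 0 (pi / alpha)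
      - (c * boundary_sum alpha r w z r 1 0 (pi / alpha) - w z).
    apply: cvgB; first exact: cvg_cst.
    apply: cvgB; last exact: cvg_cst.
    by apply: cvgM; [exact: cvg_cst|exact: cX].
  apply: cvg_trans cc; apply: near_eq_cvg; near=> e.
  rewrite repE (area_term_trunc r_gt0 r_lt1 alpha_ge w_C1 w_cont f_dbar z_in)//.
  apply/andP; split; first by near: e; exact: nbhs_right_gt.
  by near: e; exact: nbhs_right_lt.
split=> // area_int.
pose v n : R := margin alpha r z / 2 * harmonic n.
have v0 n : 0 < v n by rewrite mulr_gt0 ?divr_gt0// harmonic_gt0.
have vl : v n @[n --> \oo] --> 0.
  rewrite -(mulr0 (margin alpha r z / 2)); apply: cvgM; first exact: cvg_cst.
  exact: cvg_harmonic.
have lim1 : representation alpha r w f z (Omega_trunc alpha r (v n)) @[n --> \oo] --> w z.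
  exact: cvg_comp (cvg_seq_at_right0 v0 vl) part1.
have al0 : 0 < alpha by apply: lt_le_trans alpha_ge; rewrite invr_gt0.
have dI := area_integrable_polar r_gt0 r_lt1 alpha_ge w_C1 w_cont f_dbar z_in
  (lexx r) (lexx 1) (lexx 0) (lexx (pi / alpha)) area_int.
have EO := iint_polar r_gt0 r_lt1 alpha_ge w_C1 w_cont f_dbar z_in
  (lexx r) (lexx 1) (lexx 0) (lexx (pi / alpha)).
have En n := iint_polar r_gt0 r_lt1 alpha_ge w_C1 w_cont f_dbar z_in
  (s1 := r + v n) (s2 := 1 - v n) (t1 := v n) (t2 := pi / alpha - v n).
have lim2 : representation alpha r w f z (Omega_trunc alpha r (v n)) @[n --> \oo] -->
    representation alpha r w f z (Omega alpha r).
  have cI : iint (Omega_trunc alpha r (v n)) (area_density alpha r f z) @[n --> \oo] -->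
      iint (Omega alpha r) (area_density alpha r f z).
    rewrite /Omega EO; under eq_fun do
      rewrite /Omega_trunc En ?lerDl ?gerBl ?(ltW (v0 _))//.
    apply: cvg_cint_exhaustion => //.
    - by apply: measurableX; exact: measurable_itv.
    - by move=> n; apply: measurableX; exact: measurable_itv.
    - move=> n q [/=]; rewrite ?in_itv/= => /andP[h1 h2] /andP[h3 h4].
      have := v0 n => h; split; rewrite /= ?in_itv/=; apply/andP; split; lra.
    - move=> q [/=]; rewrite ?in_itv/= => /andP[h1 h2] /andP[h3 h4].
      pose d := Num.min (Num.min (q.1 - r) (1 - q.1)) (Num.min q.2 (pi / alpha - q.2)).
      have d0 : 0 < d by rewrite !lt_min !subr_gt0 h1 h2 h3 h4.
      have /cvgrPdist_lt/(_ d d0) := vl; apply: filterS => n.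
      rewrite sub0r normrN ger0_norm ?(ltW (v0 _))// !lt_min.
      move=> /andP[/andP[g1 g2] /andP[g3 g4]].
      by split; rewrite /= ?in_itv/=; apply/andP; split; lra.
  have cR : c * boundary_sum alpha r w z r 1 0 (pi / alpha)
      - alpha%:C / pi%:C * iint (Omega_trunc alpha r (v n)) (area_density alpha r f z)
      @[n --> \oo] --> c * boundary_sum alpha r w z r 1 0 (pi / alpha)
      - alpha%:C / pi%:C * iint (Omega alpha r) (area_density alpha r f z).
    exact: cvg_affine cI.
  rewrite repE; apply: cvg_trans cR; apply: near_eq_cvg; apply: nearW => n.
  by rewrite repE.
exact: cvg_uniqC lim1 lim2.
Unshelve. all: by end_near. Qed.
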